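(* Let $P=(a,a')$ and $Q=(b,b')$ be points of $F_0(\mathbb{R}^n,2)$. Let $$h=(a'-a)/2,\quad k=(b'-b)/2,\quad A=(a'+a)/2,\quad B=(b'+b)/2.$$ Let $\delta=\min\{d(tb+(1-t)a,\;tb'+(1-t)a') : 0\le t\le 1\}$, the minimal distance between the two components of the linear path between $P$ and $Q$. Let $S_0=\sqrt{\|h\|^2-1}$ and $S_1=\sqrt{\|k\|^2-1}$. (a) If $\delta\ge 2$, the linear path from $P$ to $Q$ is the unique geodesic between $P$ and $Q$ in $F_0(\mathbb{R}^n,2)$. (b) If $0<\delta\le 2$, there is a unique geodesic in $F_0(\mathbb{R}^n,2)$ from $P$ to $Q$. It is the path composition $\ell_1\sigma\ell_2$, where $\ell_1$ is the linear path from $P$ to $C_0=(x-u,x+u)$, $\sigma$ is the geodesic $\sigma_{x,u;y,v}$ in $\partial F_0$ from $C_0$ to $C_1=(y-v,y+v)$ described in the context, and $\ell_2$ is the linear path from $C_1$ to $Q$. Here $u$ and $v$ are the unique unit vectors in $\mathbb{R}^n$ satisfying $$h\cdot u=1\quad\text{and}\quad k\cdot v=1\qquad (\ast)$$ with minimal $\|u-v\|$. Let $\beta$ be the angle between this $u$ and $v$ with $0\le\beta<\pi$. Then $$x=\frac{\beta A+S_0B+S_1A}{\beta+S_0+S_1},\qquad y=\frac{\beta B+S_0B+S_1A}{\beta+S_0+S_1}.\qquad (\ast\ast)$$ If $\beta=0$, then $C_0=C_1$, $\delta=2$, and $\ell_1\ell_2$ is the linear path from $P$ to $Q$. When $\delta=2$,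 the linear path in (a) can also be obtained by the method of (b). (c) If $\delta=0$, then $h$ and $k$ are parallel in opposite directions, and conversely. In this case, the unit vector solutions $u,v$ of $(\ast)$ with minimal $\|u-v\|$ are $$u=\frac{h}{\|h\|^2}+\frac{S_0}{\|h\|}w,\qquad v=\frac{k}{\|k\|^2}+\frac{S_1}{\|k\|}w,$$ where $w$ ranges over the set of all points satisfying $h\cdot w=0$ and $w\cdot w=1$. The geodesics from $P$ to $Q$ are the paths as described in (b) for each of these pairs $u,v$, with $x,y$ given by $(\ast\ast)$, where $\beta$ is the angle between $u$ and $v$, which satisfies $$\cos(\beta)=\frac{h\cdot k}{\|h\|^2\|k\|^2}+\frac{S_0S_1}{\|h\|\,\|k\|}.$$
   Context: $d$ is the Euclidean distance on $\mathbb{R}^n$. $F(\mathbb{R}^n,2)=\{(x,x')\in\mathbb{R}^n\times\mathbb{R}^n: x\ne x'\}\subset\mathbb{R}^{2n}$ is the ordered configuration space with the Euclidean metric, and $F_0(\mathbb{R}^n,2)=\{(x,x')\in F(\mathbb{R}^n,2): d(x,x')\ge 2\}$. This is a manifold with boundary $\partial F_0=\{(x-u,x+u): x,u\in\mathbb{R}^n,\ \|u\|=1\}$. ''Geodesic'' always means minimal geodesic, i.e. a path of minimal (Euclidean) length among all paths in the given space with the same endpoints (geodesics are regarded as the same if they differ by reparametrization). The linear path from $P$ to $Q$ is $t\mapsto(1-t)P+tQ$, $0\le t\le1$. The geodesic $\sigma_{x,u;y,v}$ in $\partial F_0$: for $x,y\in\mathbb{R}^n$ and unit vectors $u,v$ with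 angle $\alpha\in[0,\pi)$ between them, set $u(t)=\dfrac{\sin((1-t)\alpha)u+\sin(t\alpha)v}{\sin\alpha}$ if $\alpha>0$ and $u(t)=u=v$ if $\alpha=0$; then $\sigma_{x,u;y,v}(t)=((1-t)x+ty-u(t),\,(1-t)x+ty+u(t))$ for $0\le t\le 1$, a path from $(x-u,x+u)$ to $(y-v,y+v)$.
   Formalization: In (b) the u,v,x,y description excludes h·k>1 with ‖h‖=1 or ‖k‖=1 (it contradicts (a)); (∗∗) needs β+S0+S1≠0 (else 0/0). In (c) geodesics and β<π need S0+S1>0 (else β=π, σ undefined); the u,v solution set needs n>1 or S0+S1>0 (n=1 has no w). *)

(* Defs.v *)
From HB Require Import structures.
From mathcomp Require Import all_boot all_order all_algebra.
From mathcomp Require Import all_classical all_reals all_analysis.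

Set Implicit Arguments.
Unset Strict Implicit.
Unset Printing Implicit Defensive.

Import Order.TTheory GRing.Theory Num.Theory.
Import numFieldNormedType.Exports.
Local Open Scope classical_set_scope.
Local Open Scope ring_scope.

Section Euclidean.
Context {R : realType} {n : nat}.
Implicit Types (u v : 'rV[R]_n) (p q : 'rV[R]_n * 'rV[R]_n).

Definition dot u v : R := \sum_(i < n) u ord0 i * v ord0 i.

(* The norm `|u| of the library on 'rV[R]_n is the sup norm; it induces the
   same topology as enorm, so continuity below is the library's. *)
Definition enorm u : R := Num.sqrt (dot u u).

Definition edist u v : R := enorm (u - v).

Definition edist2 p q : R :=
  Num.sqrt (edist p.1 q.1 ^+ 2 + edist p.2 q.2 ^+ 2).

Definition angle u v : R := acos (dot u v / (enorm u * enorm v)).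

Definition F2 : set ('rV[R]_n * 'rV[R]_n) := [set p | p.1 <> p.2].

Definition F0 : set ('rV[R]_n * 'rV[R]_n) :=
  F2 `&` [set p | 2 <= edist p.1 p.2].

Definition bdF0 : set ('rV[R]_n * 'rV[R]_n) :=
  [set p | exists x u, enorm u = 1 /\ p = (x - u, x + u)].

End Euclidean.

(* A path is a function on R of which only the values on [0, 1] matter. *)
Section Paths.
Context {R : realType} {n : nat}.
Local Notation E := ('rV[R]_n * 'rV[R]_n)%type.
Implicit Types (X : set E) (p q : E) (g : R -> E).

Definition is_path X p q g :=
  [/\ {within `[0, 1], continuous g}, g 0 = p, g 1 = q &
      forall t, 0 <= t <= 1 -> X (g t)].

(* Vector-valued counterparts of variation and total_variation. *)
Definition evariation g (s : seq R) : R :=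
  let G := g \o nth 1 (0 :: s) in
  \sum_(0 <= i < size s) edist2 (G i.+1) (G i).

Definition path_length g : \bar R :=
  ereal_sup [set (evariation g s)%:E | s in itv_partition 0 1].

Definition geodesic X p q g :=
  is_path X p q g /\
  forall g', is_path X p q g' -> (path_length g <= path_length g')%E.

Definition reparam (phi : R -> R) :=
  [/\ {within `[0, 1], continuous phi}, phi 0 = 0, phi 1 = 1 &
      forall s t, 0 <= s -> s <= t -> t <= 1 -> phi s <= phi t].

(* Reparametrizations need not be injective: a path of minimal length may stay
   constant for a while, and a composition of paths does so whenever one of its
   factors is constant. Hence two paths are the same up to reparametrization
   when both are monotone reparametrizations of a common one. *)
Definition same_path g1 g2 :=
  exists g phi1 phi2, [/\ reparam phi1, reparam phi2 &
    forall t, 0 <= t <= 1 -> g1 t = g (phi1 t) /\ g2 t = g (phi2 t)].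

Definition unique_geodesic X p q g :=
  geodesic X p q g /\ forall g', geodesic X p q g' -> same_path g' g.

Definition linpath p q : R -> E := fun t => (1 - t) *: p + t *: q.

Definition path_comp g1 g2 : R -> E :=
  fun t => if t <= 2^-1 then g1 (2 * t) else g2 (2 * t - 1).

Definition sphere_arc (u v : 'rV[R]_n) (t : R) : 'rV[R]_n :=
  let alpha := angle u v in
  if alpha == 0 then u
  else (sin alpha)^-1 *: (sin ((1 - t) * alpha) *: u + sin (t * alpha) *: v).

Definition sigma (x u y v : 'rV[R]_n) : R -> E := fun t =>
  let c := (1 - t) *: x + t *: y in
  (c - sphere_arc u v t, c + sphere_arc u v t).

Definition three_piece p q (x u y v : 'rV[R]_n) : R -> E :=
  path_comp (linpath p (x - u, x + u))
    (path_comp (sigma x u y v) (linpath (y - v, y + v) q)).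

End Paths.

Section MinimalPairs.
Context {R : realType} {n : nat}.
Implicit Types (a b h k u v : 'rV[R]_n).

(* The infimum is a minimum, see min_gap_attained. *)
Definition min_gap a a' b b' : R :=
  inf [set edist (t *: b + (1 - t) *: a) (t *: b' + (1 - t) *: a')
      | t in `[0, 1]].

Definition tangent_pair h k u v :=
  [/\ enorm u = 1, enorm v = 1, dot h u = 1 & dot k v = 1].

Definition min_tangent_pair h k u v :=
  tangent_pair h k u v /\
  forall u' v', tangent_pair h k u' v' -> enorm (u - v) <= enorm (u' - v').

(* For points of F0 this is the case where the linear path starts (or ends) on
   the boundary and leaves (or meets) it transversally. Then the minimal gap is
   2, but no unit vector u has dot h u = dot k u = 1, so that every path built
   from a tangent_pair has a nontrivial arc and is longer than the linear path;
   moreover a min_tangent_pair need not be unique, e.g., for k = 2 *: h. *)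
Definition transversal_end h k :=
  1 < dot h k /\ (enorm h = 1 \/ enorm k = 1).

Lemma continuous_gap a a' b b' : continuous (fun t : R =>
  edist (t *: b + (1 - t) *: a) (t *: b' + (1 - t) *: a')).
Proof.
have c i : continuous (fun t : R =>
    (t *: b + (1 - t) *: a - (t *: b' + (1 - t) *: a')) ord0 i).
  move=> s; under eq_fun do rewrite !mxE.
  have cZ (z : R) : (fun t : R => t * z) @ s --> s * z.
    by apply: cvgM; [exact: cvg_id|exact: cvg_cst].
  have cZ' (z : R) : (fun t : R => (1 - t) * z) @ s --> (1 - s) * z.
    apply: cvgM; last exact: cvg_cst.
    by apply: cvgB; [exact: cvg_cst|exact: cvg_id].
  by apply: cvgB; apply: cvgD; [exact: cZ|exact: cZ'|exact: cZ|exact: cZ'].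
move=> t; apply: (@continuous_comp _ _ _ (fun t : R => dot _ _) Num.sqrt);
  last exact: sqrt_continuous.
apply: cvg_big => [|i _]; first exact: add_continuous.
by apply: cvgM; exact: c.
Qed.

Lemma min_gap_attained a a' b b' :
  let gap t := edist (t *: b + (1 - t) *: a) (t *: b' + (1 - t) *: a') in
  exists2 t, 0 <= t <= 1 & min_gap a a' b b' = gap t /\
    forall s, 0 <= s <= 1 -> gap t <= gap s.
Proof.
move=> gap.
have [t t01 tmin] := @EVT_min R gap 0 1 ler01
  (continuous_subspaceT (@continuous_gap a a' b b')).
rewrite in_itv/= in t01; exists t => //; split; last first.
  by move=> s s01; apply: tmin; rewrite in_itv.
apply/eqP; rewrite eq_le; apply/andP; split.
  apply: ge_inf; first by exists 0 => _ [s _ <-]; exact: sqrtr_ge0.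
  by exists t => //=; rewrite in_itv.
apply: lb_le_inf; first by exists (gap t), t => //=; rewrite in_itv.
by move=> _ [s s01 <-]; exact: tmin.
Qed.

End MinimalPairs.

(* Main.v *)
Require Import Defs.
From HB Require Import structures.
From mathcomp Require Import all_boot all_order all_algebra.
From mathcomp Require Import all_classical all_reals all_analysis.
From mathcomp Require Import ring lra.

(* In the coordinates A = (x + x') / 2 and h = (x' - x) / 2 the space F0 is,
   up to a homothety, the product of R^n with the exterior of the unit ball, so
   along a shortest path h runs on a shortest path outside of the ball, and A on
   a segment, proportionally to the length travelled by h.
   Outside of the ball, the function angle(u, .) + psi, psi p = sqrt (|p|^2 - 1)
   - acos (1 / |p|), is 1-Lipschitz for the length metric for every u. If the
   segment between the end points of h enters the ball, then by the intermediate
   value theorem h meets a point p such that the line through its initial point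
   and p is tangent to the sphere. Up to p its length is at least the sum of the
   lengths of the two tangent segments, and from p on it is at least what the
   above function gives; the total is the length S0 + beta + S1 of the path in
   (b). In case of equality the path is straight up to p, hence passes through a
   point of tangency u, and likewise through v; between u and v it must have
   psi = 0 and run on a great circle. All these estimates are made on
   partitions, so that no rectifiable path ever needs to be differentiated. *)

Set Implicit Arguments.
Unset Strict Implicit.
Unset Printing Implicit Defensive.

Import Order.TTheory GRing.Theory Num.Theory.
Import numFieldNormedType.Exports.
Local Open Scope classical_set_scope.
Local Open Scope ring_scope.

(** * Euclidean geometry and angles *)

(** For a point p hidden from a unit vector u by the ball, [angle u p] + [psi 1 (enorm p)] is the
    length of a string stretched from u around the sphere to p: an arc of angle
    [angle u p - topen p] and a tangent segment of length [tlen p]. This is where the calibrating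
    function comes from. The length of a path involves the motions of [hdiff] and [mid] through the
    square root of a sum of squares, which does not add up over consecutive pieces. Lower bounds are
    therefore kept as families of linear ones, with weights c, d such that c^2 + d^2 <= 1; these do
    add up, and the best weights are inserted only at the end. Uniqueness up to reparametrization
    needs no arc length either: two sharp lower bounds, before and after a time t, assign to t a
    fraction tau of the total length, and injectivity of the shortest curve together with
    compactness makes tau continuous in t. By the triangle inequality for angles, [arc_angle h k]
    bounds [angle u v] from below for all tangent pairs. Cases (b) and (c) differ in how many pairs
    attain it: for [angle h k < pi] they lie on one great circle arc, for opposite h and k they can
    be rotated about the common line. *)

Section EuclideanAlgebra.
Context {R : realType} {n : nat}.
Implicit Types (u v w x y : 'rV[R]_n) (c d : R).

Lemma dotC u v : dot u v = dot v u.
Proof. by apply: eq_bigr => i _; rewrite mulrC. Qed.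

Lemma dotDl u v w : dot (u + v) w = dot u w + dot v w.
Proof. by rewrite -big_split; apply: eq_bigr => i _; rewrite mxE mulrDl. Qed.

Lemma dotZl c u v : dot (c *: u) v = c * dot u v.
Proof. by rewrite mulr_sumr; apply: eq_bigr => i _; rewrite mxE mulrA. Qed.

Lemma dotNl u v : dot (- u) v = - dot u v.
Proof. by rewrite -scaleN1r dotZl mulN1r. Qed.

Lemma dotDr u v w : dot u (v + w) = dot u v + dot u w.
Proof. by rewrite dotC dotDl !(dotC u). Qed.

Lemma dotZr c u v : dot u (c *: v) = c * dot u v.
Proof. by rewrite dotC dotZl dotC. Qed.

Lemma dotNr u v : dot u (- v) = - dot u v.
Proof. by rewrite dotC dotNl dotC. Qed.

Lemma dot0l u : dot 0 u = 0.
Proof. by rewrite -(scale0r 0) dotZl mul0r. Qed.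

Definition dotE := (dotDl, dotDr, dotNl, dotNr, dotZl, dotZr).

Lemma dotvv_ge0 u : 0 <= dot u u.
Proof. by apply: sumr_ge0 => i _; rewrite -expr2 sqr_ge0. Qed.

Lemma dotvv_eq0 u : dot u u = 0 -> u = 0.
Proof.
move=> /eqP; rewrite psumr_eq0; last by move=> i _; rewrite -expr2 sqr_ge0.
move=> /allP u0; apply/rowP => i; rewrite mxE.
by have /u0/= := mem_index_enum i; rewrite -expr2 sqrf_eq0 => /eqP.
Qed.

Lemma enorm_ge0 u : 0 <= enorm u. Proof. exact: sqrtr_ge0. Qed.

Lemma enorm2 u : enorm u ^+ 2 = dot u u.
Proof. by rewrite sqr_sqrtr ?dotvv_ge0. Qed.

Lemma enorm_eq0 u : enorm u = 0 -> u = 0.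
Proof. by move=> u0; apply: dotvv_eq0; rewrite -enorm2 u0 expr0n. Qed.

Lemma enorm0 : enorm (0 : 'rV[R]_n) = 0.
Proof. by rewrite /enorm dot0l sqrtr0. Qed.

Lemma enormZ c u : enorm (c *: u) = `|c| * enorm u.
Proof.
by rewrite /enorm dotZl dotZr mulrA -expr2 sqrtrM ?sqr_ge0// sqrtr_sqr.
Qed.

Lemma enormN u : enorm (- u) = enorm u.
Proof. by rewrite /enorm dotNl dotNr opprK. Qed.

Lemma edistC u v : enorm (u - v) = enorm (v - u).
Proof. by rewrite -opprB enormN. Qed.

Lemma enormP u c : 0 <= c -> dot u u = c ^+ 2 -> enorm u = c.
Proof. by move=> c0; rewrite /enorm => ->; rewrite sqrtr_sqr ger0_norm. Qed.

Lemma cauchy_schwarz u v : dot u v <= enorm u * enorm v.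
Proof.
have [v0|v0] := eqVneq (enorm v) 0.
  by rewrite dotC (enorm_eq0 v0) dot0l enorm0 mulr0.
have vv0 : 0 < enorm v by rewrite lt_def v0 enorm_ge0.
have := dotvv_ge0 (enorm v ^+ 2 *: u - dot u v *: v).
rewrite !dotE (dotC v u) -!enorm2 => H.
have {}H : 0 <= enorm v ^+ 2 * ((enorm u * enorm v) ^+ 2 - dot u v ^+ 2).
  by apply: le_trans H _; rewrite le_eqVlt; apply/orP; left; apply/eqP; ring.
rewrite pmulr_rge0 ?exprn_gt0// subr_ge0 in H.
apply: le_trans (ler_norm _) _.
by rewrite -ler_sqr ?nnegrE ?mulr_ge0 ?enorm_ge0// (real_normK (num_real _)).
Qed.

Lemma ler_enormD u v : enorm (u + v) <= enorm u + enorm v.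
Proof.
rewrite -ler_sqr ?nnegrE ?addr_ge0 ?enorm_ge0// enorm2 !dotE (dotC v u) sqrrD.
by rewrite !enorm2; have := cauchy_schwarz u v; lra.
Qed.

Lemma ler_edistD w u v : enorm (u - v) <= enorm (u - w) + enorm (w - v).
Proof. by apply: le_trans (ler_enormD _ _); rewrite addrA subrK. Qed.

(** The squared norm of [enorm v *: u - enorm u *: v] is 2 |u| |v| (|u| |v| - u.v), and the
    hypothesis makes the last factor nonpositive. The form without division covers zero vectors. *)
Lemma enormD_eq u v : enorm u + enorm v <= enorm (u + v) ->
  enorm v *: u = enorm u *: v.
Proof.
move=> H; apply/eqP; rewrite -subr_eq0; apply/eqP/dotvv_eq0/eqP.
rewrite eq_le dotvv_ge0 andbT.
have {}H : enorm u * enorm v <= dot u v.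
  have := H; rewrite -ler_sqr ?nnegrE ?addr_ge0 ?enorm_ge0//.
  by rewrite [_ ^+ 2 in X in _ <= X]enorm2 !dotE (dotC v u) sqrrD !enorm2; lra.
rewrite !dotE (dotC v u) -!enorm2.
have := mulr_ge0 (enorm_ge0 u) (enorm_ge0 v).
move: (enorm u) (enorm v) (dot u v) H => a b d H ab.
nra.
Qed.

Lemma enormD_eq_param u v : enorm u + enorm v <= enorm (u + v) ->
  exists2 t, 0 <= t <= 1 & u = t *: (u + v) /\ v = (1 - t) *: (u + v).
Proof.
move=> H; have E := enormD_eq H.
have [s0|s0] := eqVneq (enorm u + enorm v) 0.
  have u0 : enorm u = 0.
    by apply/eqP; rewrite eq_le enorm_ge0 -s0 lerDl enorm_ge0.
  have v0 : enorm v = 0 by move: s0; rewrite u0 add0r.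
  by exists 0; rewrite ?lexx ?ler01// (enorm_eq0 u0) (enorm_eq0 v0) !addr0 !scaler0.
have sp : 0 < enorm u + enorm v by rewrite lt_def s0 addr_ge0 ?enorm_ge0.
have Eu : (enorm u + enorm v) *: u = enorm u *: (u + v).
  by rewrite scalerDl scalerDr E.
have Eu' : u = (enorm u / (enorm u + enorm v)) *: (u + v).
  by rewrite mulrC -scalerA -Eu scalerA mulVf ?scale1r.
exists (enorm u / (enorm u + enorm v)).
  rewrite divr_ge0 ?enorm_ge0 ?(ltW sp)//= ler_pdivrMr// mul1r lerDl.
  exact: enorm_ge0.
by split=> //; rewrite scalerBl scale1r -Eu' addrAC subrr add0r.
Qed.

End EuclideanAlgebra.

Section TangentOfSine.
Context {R : realType}.
Implicit Types x f : R.

(** Concavity of sine accounts for x >= 0. Down to -f the bound survives because the intermediate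
    point c of the mean value theorem still has |c| <= f, hence cos c >= cos f. *)
Lemma sin_le_tangent f x : 0 <= f <= pi / 2 -> - f <= x <= pi ->
  sin x <= sin f + cos f * (x - f).
Proof.
have p0 := @pi_gt0 R.
move=> /andP[f0 f2] /andP[xf xp].
have cle (y z : R) : `|y| <= `|z| -> z \in `[-pi, pi] -> cos z <= cos y.
  move=> yz; rewrite in_itv/= => /andP[z1 z2].
  have zp : `|z| <= pi by rewrite ler_norml z1.
  rewrite -(cos_norm y) -(cos_norm z) leNgt ltr_cos ?in_itv/= ?normr_ge0//=.
    by rewrite -leNgt.
  exact: le_trans zp.
have [->|xNf] := eqVneq x f; first by rewrite subrr mulr0 addr0.
have dsin (y : R) : is_derive y (1 : R) (@sin R) (cos y) by exact: is_derive_sin.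
have csin A : {within A, continuous (@sin R)}.
  by apply: continuous_subspaceT => y; exact: continuous_sin.
case: (ltgtP x f) xNf => // xf' _.
  have [c /[!in_itv]/= /andP[c1 c2] E] := MVT xf' (fun y _ => dsin y) (csin _).
  have : cos f <= cos c.
    apply: cle; last by rewrite in_itv/=; lra.
    by rewrite (ger0_norm f0) ler_norml; apply/andP; split; lra.
  by move: E; nra.
have [c /[!in_itv]/= /andP[c1 c2] E] := MVT xf' (fun y _ => dsin y) (csin _).
have : cos c <= cos f.
  apply: cle; last by rewrite in_itv/=; lra.
  by rewrite !ger0_norm//; lra.
by move: E; nra.
Qed.

Lemma sin_le_id x : 0 <= x <= pi -> sin x <= x.
Proof.
move=> /andP[x0 xp].
have := @sin_le_tangent 0 x; rewrite subr0 oppr0 sin0 cos0 add0r mul1r.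
by have := @pi_gt0 R => p0; apply; apply/andP; split; lra.
Qed.

End TangentOfSine.

Section Angles.
Context {R : realType} {n : nat}.
Implicit Types (u v p q r : 'rV[R]_n) (a b s t : R).

Lemma ler_cos_pi a b : 0 <= a <= pi -> 0 <= b <= pi ->
  (cos a <= cos b) = (b <= a).
Proof. by move=> a0 b0; rewrite !leNgt ltr_cos// in_itv. Qed.

Lemma ler_acos a b : -1 <= a -> a <= b -> b <= 1 -> acos b <= acos a.
Proof.
move=> a1 ab b1; have aI : -1 <= a <= 1 by rewrite a1 (le_trans ab).
have bI : -1 <= b <= 1 by rewrite b1 (le_trans a1).
by rewrite -ler_cos_pi ?acos_ge0 ?acos_lepi// !acosK ?in_itv.
Qed.

Lemma cos_ratio_itv u v : -1 <= dot u v / (enorm u * enorm v) <= 1.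
Proof.
have [z|z] := eqVneq (enorm u * enorm v) 0.
  by rewrite z invr0 mulr0 ler01 lerN10.
have zp : 0 < enorm u * enorm v by rewrite lt_def z mulr_ge0 ?enorm_ge0.
rewrite ler_pdivlMr// ler_pdivrMr// mul1r mulN1r cauchy_schwarz andbT.
by rewrite lerNl -dotNl -(enormN u) cauchy_schwarz.
Qed.

Lemma angle_ge0 u v : 0 <= angle u v.
Proof. exact/acos_ge0/cos_ratio_itv. Qed.

Lemma angle_lepi u v : angle u v <= pi.
Proof. exact/acos_lepi/cos_ratio_itv. Qed.

Lemma angleI u v : 0 <= angle u v <= pi.
Proof. by rewrite angle_ge0 angle_lepi. Qed.

Lemma cos_angle u v : cos (angle u v) = dot u v / (enorm u * enorm v).
Proof. by rewrite acosK// in_itv/= cos_ratio_itv. Qed.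

Lemma sin_angle_ge0 u v : 0 <= sin (angle u v).
Proof. exact/sin_ge0_pi/angleI. Qed.

(** Zero vectors are allowed: division by zero turns their angle into acos 0, and both sides
    vanish. *)
Lemma dot_angle u v : dot u v = enorm u * enorm v * cos (angle u v).
Proof.
rewrite cos_angle; have [z|z] := eqVneq (enorm u * enorm v) 0; last first.
  by rewrite mulrC divfK.
rewrite z mul0r; move/eqP: z; rewrite mulf_eq0 => /orP[] /eqP/enorm_eq0->.
  by rewrite dot0l.
by rewrite dotC dot0l.
Qed.

Lemma angleC u v : angle u v = angle v u.
Proof. by rewrite /angle dotC [_ * enorm v]mulrC. Qed.

Lemma angleZl c u v : 0 < c -> angle (c *: u) v = angle u v.
Proof.
move=> c0; rewrite /angle dotZl enormZ gtr0_norm// -[c * enorm u * _]mulrA invfM mulrACA.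
rewrite divff ?mul1r//.
by rewrite gt_eqF.
Qed.

Lemma angle_le u v a : 0 <= a <= pi -> 0 < enorm u -> 0 < enorm v ->
  enorm u * enorm v * cos a <= dot u v -> angle u v <= a.
Proof.
move=> aI u0 v0; rewrite dot_angle ler_pM2l ?mulr_gt0//.
by rewrite ler_cos_pi// angleI.
Qed.

Lemma angleP u v a : 0 <= a <= pi -> 0 < enorm u -> 0 < enorm v ->
  dot u v = enorm u * enorm v * cos a -> angle u v = a.
Proof.
move=> aI u0 v0 E; rewrite /angle E mulrAC divff ?mul1r ?cosK ?in_itv//.
by rewrite mulf_eq0 !gt_eqF.
Qed.

Lemma angle_normalize u : 0 < enorm u -> enorm ((enorm u)^-1 *: u) = 1.
Proof. by move=> u0; rewrite enormZ gtr0_norm ?invr_gt0// mulVf ?gt_eqF. Qed.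

(** The components of p and r orthogonal to q have norms sin (angle p q) and sin (angle q r).
    Cauchy-Schwarz for these components bounds p.r below by the cosine of the sum of the angles. *)
Let angle_triangle_unit p q r : enorm p = 1 -> enorm q = 1 -> enorm r = 1 ->
  angle p r <= angle p q + angle q r.
Proof.
move=> p1 q1 r1; have [big|small] := lerP pi (angle p q + angle q r).
  exact: le_trans (angle_lepi _ _) big.
apply: angle_le; rewrite ?p1 ?r1 ?addr_ge0 ?angle_ge0 ?(ltW small)// !mul1r.
have w (x y : 'rV[R]_n) : enorm x = 1 -> enorm y = 1 ->
    enorm (x - cos (angle x y) *: y) = sin (angle x y).
  move=> x1 y1; apply: enormP; first exact: sin_angle_ge0.
  rewrite !dotE (dotC y x) -!enorm2 x1 y1 dot_angle x1 y1 sin2cos2; ring.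
have := cauchy_schwarz (p - cos (angle p q) *: q) (- (r - cos (angle r q) *: q)).
rewrite enormN !w// cosD !dotE (dotC q r) -enorm2 q1 (angleC r q).
rewrite [dot p q]dot_angle [dot r q]dot_angle p1 q1 r1 (angleC r q); lra.
Qed.

Lemma angle_triangle q p r : 0 < enorm p -> 0 < enorm q -> 0 < enorm r ->
  angle p r <= angle p q + angle q r.
Proof.
move=> p0 q0 r0; have N (u v : 'rV[R]_n) : 0 < enorm u -> 0 < enorm v ->
    angle u v = angle ((enorm u)^-1 *: u) ((enorm v)^-1 *: v).
  by move=> u0 v0; rewrite angleZl ?invr_gt0// [RHS]angleC angleZl ?invr_gt0// angleC.
by rewrite (N p r)// (N p q)// (N q r)//; apply: angle_triangle_unit; exact: angle_normalize.
Qed.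

Lemma unit_angle0 u v : enorm u = 1 -> enorm v = 1 -> angle u v = 0 -> u = v.
Proof.
move=> u1 v1 uv; apply/eqP; rewrite -subr_eq0; apply/eqP/dotvv_eq0.
rewrite !dotE (dotC v u) -!enorm2 dot_angle u1 v1 uv cos0; ring.
Qed.

(** The difference of the two sides, multiplied by sin (angle p r), has a squared norm that depends
    only on the three pairwise angles, and it vanishes by the addition formulas. No plane containing
    the three vectors has to be exhibited. *)
Lemma angle_triangle_eq p q r : enorm p = 1 -> enorm q = 1 -> enorm r = 1 ->
  angle p q + angle q r <= angle p r -> angle p r < pi ->
  q = sphere_arc p r (angle p q / angle p r).
Proof.
move=> p1 q1 r1 le lt.
have E : angle p r = angle p q + angle q r.
  by apply/eqP; rewrite eq_le le angle_triangle ?p1 ?q1 ?r1.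
rewrite /sphere_arc; case: eqVneq => [z|z].
  apply/esym/unit_angle0 => //; apply/eqP; rewrite eq_le angle_ge0 -z E lerDl.
  by rewrite angle_ge0.
have -> : (1 - angle p q / angle p r) * angle p r = angle q r.
  by rewrite mulrBl divfK// mul1r E addrAC subrr add0r.
rewrite divfK//; have s0 : sin (angle p r) != 0.
  by rewrite gt_eqF// sin_gt0_pi// lt andbT lt_def z angle_ge0.
apply: (scalerI s0); rewrite scalerA divff// scale1r.
apply/eqP; rewrite eq_sym -subr_eq0; apply/eqP/dotvv_eq0.
rewrite !dotE (dotC q p) (dotC r p) (dotC r q) -!enorm2 p1 q1 r1.
rewrite [dot p q]dot_angle [dot p r]dot_angle [dot q r]dot_angle p1 q1 r1 E.
rewrite sinD cosD; move: (cos2Dsin2 (angle p q)) (cos2Dsin2 (angle q r)).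
move: (cos (angle p q)) (sin (angle p q)) (cos (angle q r)) (sin (angle q r)).
move=> ca sa cb sb Ea Eb.
transitivity (sb ^+ 2 * (1 - (ca ^+ 2 + sa ^+ 2))
              + sa ^+ 2 * (1 - (cb ^+ 2 + sb ^+ 2))); first by ring.
by rewrite Ea Eb subrr !mulr0 addr0.
Qed.

Section Arc.
Variables u v : 'rV[R]_n.
Hypotheses (u1 : enorm u = 1) (v1 : enorm v = 1) (uv : angle u v < pi).

Let sin_gt0 : angle u v != 0 -> 0 < sin (angle u v).
Proof. by move=> z; rewrite sin_gt0_pi// uv lt_def z angle_ge0. Qed.

Lemma sphere_arc0 : sphere_arc u v 0 = u.
Proof.
rewrite /sphere_arc; case: eqVneq => // /sin_gt0 s0.
by rewrite subr0 mul1r mul0r sin0 scale0r addr0 scalerA mulVf ?scale1r ?gt_eqF.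
Qed.

Lemma sphere_arc1 : sphere_arc u v 1 = v.
Proof.
rewrite /sphere_arc; case: eqVneq => [/unit_angle0->|/sin_gt0 s0] //.
by rewrite subrr mul0r mul1r sin0 scale0r add0r scalerA mulVf ?scale1r ?gt_eqF.
Qed.

(** The arc is thus run through at constant angular speed; unit norm, angles and chords along it are
    all read off from this formula. *)
Lemma dot_sphere_arc s t :
  dot (sphere_arc u v s) (sphere_arc u v t) = cos ((s - t) * angle u v).
Proof.
rewrite /sphere_arc; case: eqVneq => [->|/sin_gt0 s0].
  by rewrite mulr0 cos0 -enorm2 u1 expr1n.
rewrite [(s - t) * _]mulrBl cosB ![(1 - _) * _]mulrBl !mul1r !sinB !dotE (dotC v u) -!enorm2.
rewrite u1 v1 dot_angle u1 v1; move: s0 (cos2Dsin2 (angle u v)).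
move: (sin (angle u v)) (cos (angle u v)) => S C S0 E.
move: (sin (s * _)) (cos (s * _)) (sin (t * _)) (cos (t * _)) => a b c d.
transitivity (S^-1 ^+ 2 * (S ^+ 2 * (b * d + a * c)
  + a * c * (1 - (C ^+ 2 + S ^+ 2)))); first by rewrite expr1n; ring.
by rewrite E subrr mulr0 addr0 mulrA -exprMn mulVf ?expr1n ?mul1r ?gt_eqF.
Qed.

Lemma enorm_sphere_arc t : enorm (sphere_arc u v t) = 1.
Proof.
by apply: enormP => //; rewrite dot_sphere_arc subrr mul0r cos0 expr1n.
Qed.

Lemma angle_sphere_arc s t : 0 <= s -> s <= t -> t <= 1 ->
  angle (sphere_arc u v s) (sphere_arc u v t) = (t - s) * angle u v.
Proof.
move=> s0 st t1; apply: angleP; rewrite ?enorm_sphere_arc//.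
  rewrite mulr_ge0 ?angle_ge0 ?subr_ge0//=.
  apply: le_trans (angle_lepi u v); rewrite ler_piMl ?angle_ge0//; lra.
by rewrite dot_sphere_arc !mul1r -[in RHS]cosN -mulNr opprB.
Qed.

Lemma chord_sphere_arc s t : 0 <= s -> s <= t -> t <= 1 ->
  enorm (sphere_arc u v t - sphere_arc u v s) <= (t - s) * angle u v.
Proof.
move=> s0 st t1; set x := (t - s) * _.
have x0 : 0 <= x by rewrite mulr_ge0 ?angle_ge0 ?subr_ge0.
have xpi : x <= pi.
  apply: le_trans (angle_lepi u v); rewrite ler_piMl ?angle_ge0//; lra.
rewrite -ler_sqr ?nnegrE ?enorm_ge0// enorm2 !dotE -!enorm2 !enorm_sphere_arc.
rewrite (dotC (sphere_arc u v s)) dot_sphere_arc -/x.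
have h : 0 <= x / 2 <= pi by have := @pi_ge0 R; lra.
have := sin_le_id h; have := sin_ge0_pi h; have := sin2cos2 (x / 2).
have -> : cos x = cos (x / 2) ^+ 2 *+ 2 - 1.
  by rewrite -cos_mulr2n; congr cos; rewrite mulr2n; lra.
by move: (sin _) (cos _) => a b; nra.
Qed.

End Arc.
End Angles.

(** * The tangent cone of a ball and the calibrating function *)

Section TangentCone.
Context {R : realType} {n : nat}.
Implicit Types (p q : 'rV[R]_n) (rho r x : R).

(* Half the opening angle, seen from the origin, of the tangent cone from a
   point at distance r to the sphere of radius rho. *)
Definition half_opening rho r : R := acos (rho / r).

(* The gradient of p |-> rho * angle u p + psi rho (enorm p) is a unit vector
   outside the ball of radius rho; radii rho < 1 are needed because the chord
   between two points of the unit sphere enters the unit ball. *)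
Definition psi rho r : R := Num.sqrt (r ^+ 2 - rho ^+ 2) - rho * half_opening rho r.

Let ratio_itv rho r : 0 < rho <= r -> -1 <= rho / r <= 1.
Proof.
move=> /andP[rho0 rr]; have r0 := lt_le_trans rho0 rr.
rewrite (le_trans _ (ltW (divr_gt0 rho0 r0))) ?lerN10//= ler_pdivrMr//; lra.
Qed.

Lemma cos_half_opening rho r : 0 < rho <= r -> r * cos (half_opening rho r) = rho.
Proof.
move=> rr; rewrite acosK ?in_itv/= ?ratio_itv// mulrC divfK// gt_eqF//; lra.
Qed.

Lemma half_openingI rho r : 0 < rho <= r -> 0 <= half_opening rho r <= pi / 2.
Proof.
move=> rr; rewrite acos_ge0 ?ratio_itv//= -acos0; apply: ler_acos; rewrite ?lerN10//.
  by rewrite divr_ge0//; lra.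
by have /andP[] := ratio_itv rr.
Qed.

Lemma sin_half_opening rho r : 0 < rho <= r ->
  r * sin (half_opening rho r) = Num.sqrt (r ^+ 2 - rho ^+ 2).
Proof.
move=> rr; have r0 : 0 < r by lra.
rewrite sin_acos ?ratio_itv// -{1}(gtr0_norm r0) -sqrtr_sqr -sqrtrM ?sqr_ge0//.
by congr (Num.sqrt _); field; rewrite gt_eqF.
Qed.

(** [psi rho r] is the maximum over x of r sin x - rho x, attained where r cos x = rho, that is, at
    the half opening. Being a maximum, it can be compared for different radii by inserting the
    maximizer of one into the expression of the other. *)
Lemma psi_ge rho r x : 0 < rho <= r -> 0 <= x <= pi ->
  r * sin x - rho * x <= psi rho r.
Proof.
move=> rr xI; rewrite /psi -sin_half_opening//.
have := half_openingI rr; have := cos_half_opening rr.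
move: (half_opening rho r) => f E f2.
have xI' : - f <= x <= pi by lra.
have := sin_le_tangent f2 xI'; move: (sin x) (sin f) (cos f) E => sx sf cf E H.
have r0 : 0 < r by lra.
have := ler_wpM2l (ltW r0) H; rewrite -E; nra.
Qed.

Lemma psi1_le rho r : 0 < rho <= 1 -> 1 <= r -> psi 1 r <= psi rho r.
Proof.
move=> rho1 r1; have rr : 0 < (1 : R) <= r by lra.
have f := half_openingI rr.
apply: (@le_trans _ _ (r * sin (half_opening 1 r) - rho * half_opening 1 r)).
  by rewrite /psi -sin_half_opening//; nra.
by apply: psi_ge; have := @pi_ge0 R; lra.
Qed.

(** Together with [psi1_le] this gives an error of at most (1 - rho) pi, uniformly in r, when the
    radius rho is replaced by 1. *)
Lemma psi_le_psi1 rho r : 0 < rho <= 1 -> 1 <= r ->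
  psi rho r <= psi 1 r + (1 - rho) * pi.
Proof.
move=> rho1 r1; have rr : 0 < rho <= r by lra.
have rr1 : 0 < (1 : R) <= r by lra.
have f := half_openingI rr; have p0 := @pi_ge0 R.
have fI : 0 <= half_opening rho r <= pi by lra.
by have := psi_ge rr1 fI; rewrite {2}/psi -sin_half_opening//; nra.
Qed.

(** The bound on the chord is the length of a chord of the unit sphere touching the ball of radius
    rho, so that p and q see each other past that ball. For such points the calibration holds with
    the straight distance. *)
Lemma chord_ge rho p q : 0 < rho <= 1 -> 1 <= enorm p -> 1 <= enorm q ->
  enorm (p - q) ^+ 2 <= 4 * (1 - rho ^+ 2) ->
  rho * angle p q + (psi rho (enorm q) - psi rho (enorm p)) <= enorm (p - q).
Proof.
move=> rho1 p1 q1 pq.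
have rp : 0 < rho <= enorm p by lra.
have rq : 0 < rho <= enorm q by lra.
have Epq : enorm (p - q) ^+ 2 = enorm p ^+ 2 + enorm q ^+ 2
    - 2 * (enorm p * enorm q * cos (angle p q)).
  by rewrite enorm2 !dotE (dotC q p) -dot_angle !enorm2; ring.
have vis : angle p q <= half_opening rho (enorm p) + half_opening rho (enorm q).
  have f1 : 0 < rho <= 1 by [].
  have fI := half_openingI f1; have cf := cos_half_opening f1.
  have le_f r : 1 <= r -> half_opening rho 1 <= half_opening rho r.
    move=> r1; have /ratio_itv/andP[? _] : 0 < rho <= r by lra.
    by apply: ler_acos => //; rewrite divr1; [rewrite ler_pdivrMr//; nra|lra].
  suff : angle p q <= half_opening rho 1 *+ 2.
    by have := le_f _ p1; have := le_f _ q1; rewrite mulr2n; lra.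
  rewrite -ler_cos_pi ?angleI//; last by rewrite mulr2n; lra.
  rewrite cos_mulr2n; rewrite mul1r in cf; rewrite cf.
  have := cos_le1 (angle p q); move: (cos (angle p q)) Epq => c Epq c1.
  have p0 : 0 <= enorm p - 1 by lra.
  have q0 : 0 <= enorm q - 1 by lra.
  have c0 : 0 <= 1 - c by lra.
  have := mulr_ge0 (mulr_ge0 p0 q0) c0; have := mulr_ge0 p0 c0.
  have := mulr_ge0 q0 c0; have := sqr_ge0 (enorm p - enorm q).
  by rewrite !expr2 in Epq pq *; nra.
have fp := half_openingI rp; have fq := half_openingI rq.
rewrite /psi -!sin_half_opening//.
have := cos_half_opening rp; have := cos_half_opening rq.
move: vis fp fq Epq; have := angleI p q.
move: (angle p q) (half_opening _ (enorm p)) (half_opening _ (enorm q)).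
move=> th f1 f2 thI vis f1I f2I Epq c2 c1.
(* Projection of p - q onto a tangent line from q to the ball of radius rho, with p at the angle th
   - f2 beyond the point of tangency. The square left over is that of the orthogonal component. *)
have chord : enorm p * sin (th - f2) + enorm q * sin f2 <= enorm (p - q).
  apply: le_trans (ler_norm _) _.
  rewrite -ler_sqr ?nnegrE ?enorm_ge0// real_normK ?num_real// Epq.
  rewrite -subr_ge0 (_ : _ - _ = (enorm p * cos (th - f2) - enorm q * cos f2) ^+ 2).
    exact: sqr_ge0.
  have {1 2}-> : th = (th - f2) + f2 by rewrite subrK.
  rewrite addrK cosD.
  have := cos2Dsin2 (th - f2); have := cos2Dsin2 f2.
  move: (sin (th - f2)) (cos (th - f2)) (sin f2) (cos f2) => b a d c E1 E2.
  transitivity (enorm p ^+ 2 * (1 - (a ^+ 2 + b ^+ 2))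
    + enorm q ^+ 2 * (1 - (c ^+ 2 + d ^+ 2))
    + (enorm p * a - enorm q * c) ^+ 2); first by ring.
  by rewrite E1 E2 subrr !mulr0 !add0r.
have p0 := @pi_ge0 R.
(* Visibility is exactly the condition under which the tangent line of sine at f1 may be used at f2
   - th; its slope, multiplied by |p|, is rho. *)
have xI : - f1 <= f2 - th <= pi by lra.
have := sin_le_tangent f1I xI.
rewrite -opprB sinN => H.
have := ler_wpM2l (enorm_ge0 p) H; rewrite mulrDr mulrA c1 => {}H.
lra.
Qed.

End TangentCone.

(** * Lengths of paths *)

Section MidHalf.
Context {R : realType} {n : nat}.
Local Notation V := 'rV[R]_n.
Local Notation E := (V * V)%type.
Implicit Types (p q r : E) (c d : R).

(* In the coordinates mid and hdiff the Euclidean metric is, up to a factor of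
   the square root of 2, the product metric, and F0 is the product of the space
   with the complement of the open unit ball. *)
Definition mid p : V := 2^-1 *: (p.2 + p.1).
Definition hdiff p : V := 2^-1 *: (p.2 - p.1).

Let halfR : 2^-1 + 2^-1 = 1 :> R. Proof. by field. Qed.

Lemma mid_sub_hdiff p : mid p - hdiff p = p.1.
Proof.
by rewrite /mid /hdiff -scalerBr opprB addrC addrA subrK scalerDr -scalerDl halfR scale1r.
Qed.

Lemma mid_add_hdiff p : mid p + hdiff p = p.2.
Proof.
rewrite /mid /hdiff -scalerDr addrACA subrr addr0.
by rewrite scalerDr -scalerDl halfR scale1r.
Qed.

Lemma mid_hdiff_inj p q : mid p = mid q -> hdiff p = hdiff q -> p = q.
Proof.
move=> m h; rewrite [p]surjective_pairing [q]surjective_pairing.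
by rewrite -!mid_sub_hdiff -!mid_add_hdiff m h.
Qed.

Lemma mid_pair (x u : V) : mid (x - u, x + u) = x.
Proof. by rewrite /mid/= addrACA subrr addr0 scalerDr -scalerDl halfR scale1r. Qed.

Lemma hdiff_pair (x u : V) : hdiff (x - u, x + u) = u.
Proof.
rewrite /hdiff/= opprB addrC addrA subrK.
by rewrite scalerDr -scalerDl halfR scale1r.
Qed.

Lemma edist2E p q : edist2 p q ^+ 2 = 2 * (enorm (mid p - mid q) ^+ 2
                                          + enorm (hdiff p - hdiff q) ^+ 2).
Proof.
rewrite sqr_sqrtr ?addr_ge0 ?sqr_ge0//.
rewrite /Defs.edist -(mid_sub_hdiff p) -(mid_sub_hdiff q) -(mid_add_hdiff p) -(mid_add_hdiff q).
rewrite !enorm2; move: (mid p) (mid q) (hdiff p) (hdiff q) => a b h k.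
by rewrite !dotE (dotC b a) (dotC h a) (dotC k a) (dotC h b) (dotC k b) (dotC k h); ring.
Qed.

Lemma edist2_ge0 p q : 0 <= edist2 p q. Proof. exact: sqrtr_ge0. Qed.

Lemma edist2_eq0 p q : edist2 p q = 0 -> p = q.
Proof.
move=> d0; have := edist2E p q; rewrite d0 expr0n/= => /esym/eqP.
rewrite mulf_eq0 pnatr_eq0/= paddr_eq0 ?sqr_ge0// !sqrf_eq0.
move=> /andP[/eqP/enorm_eq0/subr0_eq m /eqP/enorm_eq0/subr0_eq h].
exact: mid_hdiff_inj.
Qed.

(** Cauchy-Schwarz for the weights (c, d): this replaces the product metric by linear expressions,
    which are additive along a chain. *)
Lemma edist2_weights c d p q : 0 <= c -> 0 <= d -> c ^+ 2 + d ^+ 2 <= 1 ->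
  Num.sqrt 2 * (c * enorm (hdiff p - hdiff q) + d * enorm (mid p - mid q))
    <= edist2 p q.
Proof.
move=> c0 d0 cd; rewrite -ler_sqr ?nnegrE ?edist2_ge0//; last first.
  by rewrite mulr_ge0 ?sqrtr_ge0// addr_ge0// mulr_ge0// enorm_ge0.
rewrite edist2E exprMn sqr_sqrtr// ler_pM2l//.
move: (enorm (hdiff _ - _)) (enorm (mid _ - _)) => h m.
have Hs := sqr_ge0 (c * m - d * h).
have : 0 <= (h ^+ 2 + m ^+ 2) * (1 - (c ^+ 2 + d ^+ 2)).
  by apply: mulr_ge0; [rewrite addr_ge0 ?sqr_ge0|rewrite subr_ge0].
by lra.
Qed.

Lemma dot_row_mx m (a b : V) (c' d' : 'rV[R]_m) :
  dot (row_mx a c') (row_mx b d') = dot a b + dot c' d'.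
Proof.
rewrite /dot big_split_ord/=; congr (_ + _).
  by apply: eq_bigr => i _; rewrite !row_mxEl.
by apply: eq_bigr => i _; rewrite !row_mxEr.
Qed.

(** Identifies pairs with vectors of dimension 2n, so that the triangle inequality for [enorm] and
    its equality case apply to [edist2]. *)
Definition row_pair p := row_mx p.1 p.2.

Lemma row_pairB p q : row_pair (p - q) = row_pair p - row_pair q.
Proof. by rewrite /row_pair opp_row_mx add_row_mx. Qed.

Lemma row_pairD p q : row_pair (p + q) = row_pair p + row_pair q.
Proof. by rewrite /row_pair add_row_mx. Qed.

Lemma row_pairZ c p : row_pair (c *: p) = c *: row_pair p.
Proof. by rewrite /row_pair scale_row_mx. Qed.

Lemma row_pair_inj : injective row_pair.
Proof.
move=> [a b] [c d]; rewrite /row_pair/= => H.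
have := congr1 lsubmx H; have := congr1 rsubmx H.
by rewrite !row_mxKl !row_mxKr => -> ->.
Qed.

Lemma edist2_row p q : edist2 p q = enorm (row_pair p - row_pair q).
Proof.
apply/esym/enormP; rewrite ?edist2_ge0// -row_pairB dot_row_mx.
by rewrite sqr_sqrtr ?addr_ge0 ?sqr_ge0// /Defs.edist !enorm2.
Qed.

Lemma edist2C p q : edist2 p q = edist2 q p.
Proof. by rewrite !edist2_row edistC. Qed.

Lemma edist2_triangle r p q : edist2 p q <= edist2 p r + edist2 r q.
Proof. by rewrite !edist2_row; exact: ler_edistD. Qed.

Lemma edist2xx p : edist2 p p = 0.
Proof. by rewrite edist2_row subrr enorm0. Qed.

Lemma F0P p : F0 p <-> 1 <= enorm (hdiff p).
Proof.
have Hh : enorm (hdiff p) = 2^-1 * enorm (p.1 - p.2).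
  by rewrite /hdiff enormZ ger0_norm ?invr_ge0// edistC.
rewrite Hh mulrC ler_pdivlMr// mul1r; split=> [[]//|p2]; split=> //= p12.
by move: p2; rewrite p12 /Defs.edist subrr enorm0 lern0.
Qed.

Lemma bdF0P p : bdF0 p <-> enorm (hdiff p) = 1.
Proof.
split=> [[x [u [u1 ->]]]|h1]; first by rewrite hdiff_pair.
by exists (mid p), (hdiff p); rewrite mid_sub_hdiff mid_add_hdiff -surjective_pairing.
Qed.

Lemma bdF0_sub_F0 : bdF0 `<=` (F0 : set E).
Proof. by move=> p /bdF0P h1; apply/F0P; rewrite h1. Qed.

End MidHalf.

Section Continuity.
Context {R : realType} {n : nat}.
Local Notation V := 'rV[R]_n.
Local Notation E := (V * V)%type.

Section Dot.
Context {T : Type} (F : set_system T) {FF : Filter F}.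

Lemma cvg_dot (f g : T -> V) (a b : V) :
  f @ F --> a -> g @ F --> b -> dot (f x) (g x) @[x --> F] --> dot a b.
Proof.
move=> fa gb; apply: cvg_big => [|i _]; first exact: add_continuous.
have c (h : T -> V) (l : V) : h @ F --> l -> (h x) ord0 i @[x --> F] --> l ord0 i.
  move=> hl; apply: (@cvg_comp _ _ _ h (fun M : V => M ord0 i) _ _ _ hl).
  exact: coord_continuous.
by apply: cvgM; exact: c.
Qed.

Lemma cvg_enorm (f : T -> V) (a : V) :
  f @ F --> a -> enorm (f x) @[x --> F] --> enorm a.
Proof.
move=> fa; apply: (@cvg_comp _ _ _ _ Num.sqrt _ _ _ (cvg_dot fa fa)).
exact: sqrt_continuous.
Qed.

End Dot.

Lemma continuous_hdiff : continuous (@hdiff R n).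
Proof.
move=> p; apply: cvgZ; first exact: cvg_cst.
by apply: cvgB; [exact: cvg_snd|exact: cvg_fst].
Qed.

Lemma continuous_edist2 (q : E) : continuous (fun p => edist2 p q).
Proof.
move=> p; apply: (@continuous_comp _ _ _ (fun p : E => _ + _) Num.sqrt);
  last exact: sqrt_continuous.
have sq (f : E -> V) : f @ p --> f p -> enorm (f x) ^+ 2 @[x --> p] --> enorm (f p) ^+ 2.
  by move=> fp; exact: cvgM (cvg_enorm fp) (cvg_enorm fp).
apply: cvgD.
  apply: (sq (fun p : E => p.1 - q.1)); apply: cvgB; [exact: cvg_fst|exact: cvg_cst].
apply: (sq (fun p : E => p.2 - q.2)); apply: cvgB; [exact: cvg_snd|exact: cvg_cst].
Qed.

Lemma enorm_ge_norm (v : V) : `|v| <= enorm v.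
Proof.
rewrite /Num.norm/= mx_normrE; apply: bigmax_le => [|[i j] _]; first exact: enorm_ge0.
rewrite -ler_sqr ?nnegrE ?enorm_ge0// real_normK ?num_real// enorm2 /dot.
rewrite (bigD1 j)//= !(ord1 i) -expr2 lerDl.
by apply: sumr_ge0 => k _; rewrite -expr2 sqr_ge0.
Qed.

Lemma edist2_ge_norm (p q : E) : `|p - q| <= edist2 p q.
Proof.
have E2 : edist2 p q ^+ 2 = enorm (p.1 - q.1) ^+ 2 + enorm (p.2 - q.2) ^+ 2.
  by rewrite {1}/edist2 sqr_sqrtr// addr_ge0 ?sqr_ge0.
rewrite /Num.norm/= ge_max; apply/andP; split; apply: le_trans (enorm_ge_norm _) _;
  by rewrite -ler_sqr ?nnegrE ?enorm_ge0 ?edist2_ge0// E2 ?lerDl ?lerDr sqr_ge0.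
Qed.

Lemma within_continuous_edist2P (A : set R) (g : R -> E) :
  {within A, continuous g} <-> forall t, A t -> forall e, 0 < e ->
    exists2 d, 0 < d & forall s, A s -> `|s - t| < d -> edist2 (g s) (g t) < e.
Proof.
rewrite subspace_continuousP; split=> H t At.
  move=> e e0; have : edist2 (g s) (g t) @[s --> within A (nbhs t)] --> (0 : R).
    rewrite -(edist2xx (g t)).
    apply: (@cvg_comp _ _ _ g (fun p => edist2 p (g t)) _ _ _ (H t At)).
    exact: continuous_edist2.
  move=> /cvgrPdist_lt/(_ e e0)/nbhs_ballP[d /= d0 Hd]; exists d => // s As st.
  by move: (Hd s); rewrite /ball/= (distrC t) sub0r normrN (ger0_norm (edist2_ge0 _ _)); apply.
apply/cvgrPdist_lt => e e0; have [d d0 Hd] := H t At e e0.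
apply/nbhs_ballP; exists d => //= s; rewrite /ball/= distrC => st As.
rewrite distrC; exact: le_lt_trans (edist2_ge_norm _ _) (Hd _ As st).
Qed.

Lemma within_continuous_comp_path (A B : set R) (g : R -> E) (f : E -> R) :
  A `<=` B -> {within B, continuous g} -> continuous f ->
  {within A, continuous (f \o g)}.
Proof.
move=> AB /(continuous_subspaceW AB)/subspace_continuousP cg cf.
apply/subspace_continuousP => t At; apply: (cvg_comp _ f (cg t At)); exact: cf.
Qed.

End Continuity.

(** * Chains of points on a path and lower bounds of its length *)

Section PolygonalLength.
Context {R : realType} {n : nat}.
Local Notation V := 'rV[R]_n.
Local Notation E := (V * V)%type.
Implicit Types (g : R -> E) (s t r d e : R) (l : seq R).

Fixpoint chainlen g s l : R :=
  if l is x :: l' then edist2 (g x) (g s) + chainlen g x l' else 0.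

Lemma evariationE g l : evariation g l = chainlen g 0 l.
Proof.
suff H s : \sum_(0 <= i < size l) edist2 ((g \o nth 1 (s :: l)) i.+1)
    ((g \o nth 1 (s :: l)) i) = chainlen g s l by exact: H.
elim: l s => [|x l IH] s; first by rewrite big_geq.
by rewrite big_nat_recl//= -IH.
Qed.

Lemma chainlen_cat g s l1 l2 :
  chainlen g s (l1 ++ l2) = chainlen g s l1 + chainlen g (last s l1) l2.
Proof. by elim: l1 s => [s|x l IH s] /=; rewrite ?add0r// IH addrA. Qed.

(** Says that the supremum of the chain lengths on [s, t] is at least d, without extended reals, so
    that bounds on adjacent intervals can simply be added. *)
Definition length_ge g s t d := forall e, 0 < e ->
  exists2 l, itv_partition s t l & d - e <= chainlen g s l.

Lemma length_ge_le g s t d d' : d' <= d -> length_ge g s t d -> length_ge g s t d'.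
Proof.
by move=> dd H e /H[l sl le]; exists l => //; apply: le_trans le; rewrite lerB.
Qed.

Lemma length_ge_cat g s t r d1 d2 :
  length_ge g s t d1 -> length_ge g t r d2 -> length_ge g s r (d1 + d2).
Proof.
move=> H1 H2 e e0; have e2 : 0 < e / 2 by rewrite divr_gt0.
have [l1 st1 L1] := H1 _ e2; have [l2 st2 L2] := H2 _ e2.
exists (l1 ++ l2); first exact: itv_partition_cat st1 st2.
by rewrite chainlen_cat; move: st1 => [_ /eqP ->]; lra.
Qed.

Lemma length_ge_edist2 g s t : s <= t -> length_ge g s t (edist2 (g s) (g t)).
Proof.
rewrite le_eqVlt => /orP[/eqP ->|st] e e0.
  by exists [::] => //=; rewrite edist2xx; lra.
by exists [:: t]; [exact: itv_partition1|rewrite /= edist2C; lra].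
Qed.

Lemma length_ge_point g s d : length_ge g s s d -> d <= 0.
Proof.
move=> H; apply/ler_addgt0Pl => e e0; have [l /itv_partitionxx->] := H e e0.
by rewrite addr0 subr_le0.
Qed.

Lemma length_ge_path_length g d : length_ge g 0 1 d -> (d%:E <= path_length g)%E.
Proof.
move=> H; apply/lee_addgt0Pr => e e0; have [l pl Hl] := H e e0.
rewrite -leeBlDr// -EFinB.
apply: (@le_trans _ _ (evariation g l)%:E); first by rewrite lee_fin evariationE.
by apply: ereal_sup_ubound; exists l.
Qed.

Lemma path_length_le g (K : R) :
  (forall l, itv_partition 0 1 l -> chainlen g 0 l <= K) ->
  (path_length g <= K%:E)%E.
Proof.
by move=> H; apply: ge_ereal_sup => _ [l pl <-]; rewrite lee_fin evariationE H.
Qed.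

(* The local control of f extends a chain beyond the supremum of the times that
   can be reached by a chain. *)
Lemma chain_of_local (X : set E) g (f : E -> E -> R) (eta s t : R) :
  {within `[0, 1], continuous g} -> (forall x, 0 <= x <= 1 -> X (g x)) ->
  0 <= s -> s <= t -> t <= 1 -> 0 < eta ->
  (forall p, X p -> f p p <= 0) ->
  (forall p q r : E, X p -> X q -> X r -> f p r <= f p q + f q r) ->
  (forall p q, X p -> X q -> edist2 p q < eta -> f p q <= edist2 p q) ->
  exists2 l, itv_partition s t l & f (g s) (g t) <= chainlen g s l.
Proof.
move=> /within_continuous_edist2P cg Xg s0 st t1 eta0 fpp ftri floc.
pose Z := [set x | s <= x <= t /\
  exists2 l, itv_partition s x l & f (g s) (g x) <= chainlen g s l].
have Zs : Z s.
  split; first by rewrite lexx st.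
  by exists [::] => //=; apply: fpp; apply: Xg; lra.
have ubZ : ubound Z t by move=> x [/andP[]].
have hZ : has_sup Z by split; [exists s|exists t].
have supt : sup Z <= t by apply: ge_sup => //; exists s.
have ssup : s <= sup Z by apply: ub_le_sup => //; exists t.
have sup01 : 0 <= sup Z <= 1 by lra.
(* Half of [eta], because two times close to [sup Z] are compared through the image of [sup Z]. *)
have [||d d0 Hd] := cg (sup Z) _ (eta / 2).
- by rewrite /= in_itv.
- by rewrite divr_gt0.
have near x y : 0 <= x <= 1 -> 0 <= y <= 1 -> `|x - sup Z| < d -> `|y - sup Z| < d ->
    edist2 (g x) (g y) < eta.
  move=> x01 y01 xd yd; apply: le_lt_trans (edist2_triangle (g (sup Z)) _ _) _.
  rewrite [X in _ + X]edist2C.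
  have := Hd x; have := Hd y; rewrite /= !in_itv/= => /(_ y01 yd) + /(_ x01 xd); lra.
have [x0 [/andP[sx0 x0t] [l sl Hl]] x0sup] := sup_adherent d0 hZ.
have x0le : x0 <= sup Z.
  by apply: ub_le_sup; [exists t|split; [rewrite sx0|exists l]].
have ext x : x0 <= x -> x <= t -> x < sup Z + d -> Z x.
  rewrite le_eqVlt => /orP[/eqP <- _ _|x0x xt xd].
    by split; [rewrite sx0|exists l].
  split; first by lra.
  exists (l ++ [:: x]); first exact: itv_partition_cat sl (itv_partition1 _).
  rewrite chainlen_cat; move: (sl) => [_ /eqP ->] /=; rewrite addr0 edist2C.
  apply: le_trans (ftri _ (g x0) _ _ _ _) _; try by apply: Xg; lra.
  apply: lerD => //; apply: floc; try by apply: Xg; lra.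
  by apply: near; rewrite ?ltr_norml; lra.
(* A chain reaching d / 2 beyond [sup Z] would contradict the definition of the supremum, so t
   itself must be within reach. *)
have [tt|tt] := lerP t (sup Z + d / 2).
  by have [] : Z t by apply: ext; lra.
have : Z (sup Z + d / 2) by apply: ext; lra.
by move=> /(ub_le_sup (ex_intro _ t ubZ)); lra.
Qed.

End PolygonalLength.

(** * Tangents to the unit sphere and lower bounds of lengths *)

Section TangentLength.
Context {R : realType} {n : nat}.
Implicit Types (p q u v h k : 'rV[R]_n).

(* Length of a tangent segment from u to the unit sphere, and the angle it
   subtends at the origin. *)
Definition tlen u : R := Num.sqrt (enorm u ^+ 2 - 1).
Definition topen u : R := half_opening 1 (enorm u).

Lemma psi1E u : psi 1 (enorm u) = tlen u - topen u.
Proof. by rewrite /psi expr1n mul1r. Qed.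

Lemma tlen_ge0 u : 0 <= tlen u. Proof. exact: sqrtr_ge0. Qed.

Let ge1 u : 1 <= enorm u -> 0 < (1 : R) <= enorm u.
Proof. by move=> ->; rewrite ltr01. Qed.

Lemma tlen2 u : 1 <= enorm u -> tlen u ^+ 2 = dot u u - 1.
Proof. by move=> u1; rewrite -enorm2 sqr_sqrtr// subr_ge0 -(expr1n _ 2) lerXn2r ?nnegrE//; lra. Qed.

Lemma topenI u : 1 <= enorm u -> 0 <= topen u <= pi / 2.
Proof. by move=> /ge1; exact: half_openingI. Qed.

Lemma cos_topen u : 1 <= enorm u -> enorm u * cos (topen u) = 1.
Proof. by move=> /ge1; exact: cos_half_opening. Qed.

Lemma sin_topen u : 1 <= enorm u -> enorm u * sin (topen u) = tlen u.
Proof. by move=> /ge1 /sin_half_opening ->; rewrite expr1n. Qed.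

Lemma tlen_unit u : enorm u = 1 -> tlen u = 0.
Proof. by rewrite /tlen => ->; rewrite expr1n subrr sqrtr0. Qed.

Lemma topen_unit u : enorm u = 1 -> topen u = 0.
Proof. by rewrite /topen /half_opening => ->; rewrite divr1 acos1. Qed.

Lemma psi1_ge0 u : 1 <= enorm u -> 0 <= psi 1 (enorm u).
Proof.
move=> u1; have := @psi_ge R 1 (enorm u) 0 (ge1 u1).
by rewrite lexx pi_ge0 sin0 !mulr0 subrr; apply.
Qed.

Lemma psi1_unit u : enorm u = 1 -> psi 1 (enorm u) = 0.
Proof. by move=> u1; rewrite psi1E tlen_unit// topen_unit// subrr. Qed.

(** With f = [topen u], [psi 1 (enorm u)] is tan f - f. The tangent of sine at f / 2 gives f (1 +
    cos f) / 2 <= sin f; combined with sin f <= f cos f this forces f = 0 or cos f = 1. *)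
Lemma psi1_le0 u : 1 <= enorm u -> psi 1 (enorm u) <= 0 -> enorm u = 1.
Proof.
move=> u1; rewrite psi1E -sin_topen//; have := cos_topen u1.
have := topenI u1; move: (topen u) => f fI cf sf.
have p0 := @pi_gt0 R.
have f2 : 0 <= f / 2 <= pi / 2 by lra.
have := @sin_le_tangent R (f / 2) 0 f2; rewrite sin0 => /(_ ltac:(lra)) tan2.
have c2 : 0 <= cos (f / 2) by apply: cos_ge0_pihalf; lra.
have E : f = f / 2 *+ 2 by rewrite mulr2n; lra.
have sE : sin f = 2 * (sin (f / 2) * cos (f / 2)).
  by rewrite {1}E sin_mulr2n mulr2n; ring.
have cE : cos f = cos (f / 2) ^+ 2 *+ 2 - 1 by rewrite {1}E cos_mulr2n.
have sf' : f * (1 + cos f) / 2 <= sin f.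
  rewrite sE cE mulr2n; move: tan2 c2; move: (sin _) (cos _) => s c; nra.
have fc : f * (1 + cos f) <= f * (2 * cos f).
  have e0 := lt_le_trans ltr01 u1.
  have H : f * (1 + cos f) / 2 * enorm u <= f by nra.
  rewrite -(ler_pM2l e0).
  by have -> : enorm u * (f * (2 * cos f)) = 2 * f * (enorm u * cos f); [ring|rewrite cf; lra].
have c1 : cos f = 1.
  have [f0|f0] := eqVneq f 0; first by rewrite f0 cos0.
  have fp : 0 < f by rewrite lt_def f0; lra.
  have := cos_le1 f; move: (cos f) fc => c fc; rewrite ler_pM2l// in fc; lra.
by move: cf; rewrite c1 mulr1.
Qed.

Let cos_topenD p q : 1 <= enorm p -> 1 <= enorm q ->
  enorm p * enorm q * cos (topen p + topen q) = 1 - tlen p * tlen q.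
Proof.
move=> p1 q1; rewrite cosD.
transitivity (enorm p * cos (topen p) * (enorm q * cos (topen q))
  - enorm p * sin (topen p) * (enorm q * sin (topen q))); first by ring.
by rewrite !cos_topen// !sin_topen// mul1r.
Qed.

(** Turns a comparison of angles into one of an expression that is continuous along a path, as the
    intermediate value theorem requires. Equality means that the segment from p to q touches the
    sphere. *)
Lemma topen_le_angle p q : 1 <= enorm p -> 1 <= enorm q ->
  (topen p + topen q <= angle p q) = (dot p q + tlen p * tlen q <= 1).
Proof.
move=> p1 q1; have := topenI p1; have := topenI q1 => qI pI.
rewrite -ler_cos_pi ?angleI//; last by lra.
have pq0 : 0 < enorm p * enorm q by nra.
by rewrite -(ler_pM2l pq0) -dot_angle cos_topenD// lerBrDr.
Qed.

Lemma angle_le_topen p q : 1 <= enorm p -> 1 <= enorm q ->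
  (angle p q <= topen p + topen q) = (1 <= dot p q + tlen p * tlen q).
Proof.
move=> p1 q1; have := topenI p1; have := topenI q1 => qI pI.
transitivity (cos (topen p + topen q) <= cos (angle p q)).
  by rewrite ler_cos_pi ?angleI//; lra.
have pq0 : 0 < enorm p * enorm q by nra.
by rewrite -[LHS](ler_pM2l pq0) cos_topenD// -dot_angle lerBlDr.
Qed.

Lemma common_tangent_angle p q : 1 <= enorm p -> 1 <= enorm q ->
  dot p q + tlen p * tlen q = 1 -> angle p q = topen p + topen q.
Proof.
by move=> p1 q1 E; apply/eqP; rewrite eq_le topen_le_angle// angle_le_topen// E lexx.
Qed.

Lemma common_tangent_dist p q : 1 <= enorm p -> 1 <= enorm q ->
  dot p q + tlen p * tlen q = 1 -> enorm (p - q) = tlen p + tlen q.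
Proof.
move=> p1 q1 E; apply: enormP; first by rewrite addr_ge0 ?tlen_ge0.
by rewrite !dotE (dotC q p) sqrrD !tlen2// -mulr_natl; lra.
Qed.

Lemma tangent_angle h u : 1 <= enorm h -> enorm u = 1 -> dot h u = 1 ->
  angle h u = topen h.
Proof.
move=> h1 u1 hu.
have E : dot h u + tlen h * tlen u = 1 by rewrite hu (tlen_unit u1) mulr0 addr0.
by rewrite common_tangent_angle ?u1// (topen_unit u1) addr0.
Qed.

Lemma tangent_dist h u : 1 <= enorm h -> enorm u = 1 -> dot h u = 1 ->
  enorm (h - u) = tlen h.
Proof.
move=> h1 u1 hu.
have E : dot h u + tlen h * tlen u = 1 by rewrite hu (tlen_unit u1) mulr0 addr0.
by rewrite common_tangent_dist ?u1// (tlen_unit u1) addr0.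
Qed.

(** Triangle inequality for angles along h, u, v, k. Pairs attaining this bound turn out to be the
    minimal ones. *)
Lemma tangent_angle_ge h k u v : 1 <= enorm h -> 1 <= enorm k ->
  tangent_pair h k u v -> angle h k - topen h - topen k <= angle u v.
Proof.
move=> h1 k1 [u1 v1 hu kv].
have h0 : 0 < enorm h by lra.
have k0 : 0 < enorm k by lra.
have u0 : 0 < enorm u by lra.
have v0 : 0 < enorm v by lra.
have := angle_triangle h0 u0 k0; have := angle_triangle u0 v0 k0.
rewrite (tangent_angle h1 u1 hu) (angleC v k) (tangent_angle k1 v1 kv); lra.
Qed.

End TangentLength.

Section HalfLength.
Context {R : realType} {n : nat}.
Local Notation V := 'rV[R]_n.
Local Notation E := (V * V)%type.
Implicit Types (g : R -> E) (s t r X : R).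

(* X is a lower bound of the length of hdiff \o g on [s, t], in a form that
   is superadditive in s, t and accounts for the displacement of mid \o g. *)
Definition half_length_ge g s t X := forall c d, 0 <= c -> 0 <= d ->
  c ^+ 2 + d ^+ 2 <= 1 ->
  length_ge g s t (Num.sqrt 2 * (c * X + d * enorm (mid (g t) - mid (g s)))).

Lemma half_length_ge_le g s t X X' : X' <= X ->
  half_length_ge g s t X -> half_length_ge g s t X'.
Proof.
move=> XX H c d c0 d0 cd; apply: length_ge_le (H c d c0 d0 cd).
by rewrite ler_wpM2l ?sqrtr_ge0// lerD2r ler_wpM2l.
Qed.

Lemma half_length_ge_cat g s t r X1 X2 :
  half_length_ge g s t X1 -> half_length_ge g t r X2 ->
  half_length_ge g s r (X1 + X2).
Proof.
move=> H1 H2 c d c0 d0 cd.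
apply: length_ge_le (length_ge_cat (H1 c d c0 d0 cd) (H2 c d c0 d0 cd)).
rewrite -mulrDr ler_wpM2l ?sqrtr_ge0//.
have := ler_wpM2l d0 (ler_edistD (mid (g t)) (mid (g r)) (mid (g s))); lra.
Qed.

Lemma half_length_ge_dist g s t : s <= t ->
  half_length_ge g s t (enorm (hdiff (g s) - hdiff (g t))).
Proof.
move=> st c d c0 d0 cd; apply: length_ge_le (length_ge_edist2 g st).
by rewrite (edistC (mid (g t))); exact: edist2_weights.
Qed.

(** For rho < 1 the calibrated quantity satisfies the triangle inequality and is locally at most the
    distance, so chains realize it globally; then rho tends to 1. Using [chord_ge] in both
    directions produces the absolute value. *)
Lemma half_length_ge_calibration P Q g s t : is_path F0 P Q g ->
  0 <= s -> s <= t -> t <= 1 ->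
  half_length_ge g s t (angle (hdiff (g s)) (hdiff (g t))
    + `|psi 1 (enorm (hdiff (g t))) - psi 1 (enorm (hdiff (g s)))|).
Proof.
move=> [cg _ _ Xg] s0 st t1 c d c0 d0 cd e e0.
have pi0 := @pi_gt0 R.
have s2 : 0 <= Num.sqrt 2 :> R by exact: sqrtr_ge0.
have s22 : Num.sqrt 2 <= 2 :> R.
  by rewrite -ler_sqr ?nnegrE// sqr_sqrtr//; lra.
have c1 : c <= 1 by nra.
(* Passing from rho to 1 costs (1 - rho) pi for the angle and as much for [psi]; with a factor c
   sqrt 2 <= 2 this stays below e. The maximum with 1/2 keeps rho positive. *)
pose rho : R := Num.max 2^-1 (1 - e / (4 * pi)).
have rho1 : 0 < rho < 1.
  rewrite lt_max gt_max; apply/andP; split; first by apply/orP; left; lra.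
  by apply/andP; split; [lra|rewrite ltrBlDr ltrDl divr_gt0// mulr_gt0].
have rhoe : (1 - rho) * (4 * pi) <= e.
  rewrite -ler_pdivlMr ?mulr_gt0// lerBlDr -lerBlDl /rho.
  by rewrite le_max lexx orbT.
pose eta : R := Num.sqrt (4 * (1 - rho ^+ 2)).
have eta0 : 0 < eta by rewrite sqrtr_gt0; nra.
pose f0 (p q : E) := rho * angle (hdiff p) (hdiff q)
  + `|psi rho (enorm (hdiff q)) - psi rho (enorm (hdiff p))|.
pose f (p q : E) := Num.sqrt 2 * (c * f0 p q + d * enorm (mid p - mid q)).
have f0pp p : F0 p -> f0 p p <= 0.
  move=> /F0P p1; have p0 : 0 < enorm (hdiff p) by lra.
  rewrite /f0 subrr normr0 addr0 (_ : angle _ _ = 0) ?mulr0//.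
  by apply: angleP => //; rewrite ?lexx ?pi_ge0// cos0 mulr1 -expr2 enorm2.
have f0tri (p q r : E) : F0 p -> F0 q -> F0 r -> f0 p r <= f0 p q + f0 q r.
  move=> /F0P p1 /F0P q1 /F0P r1; rewrite /f0 addrACA -mulrDr.
  apply: lerD; last by rewrite [leRHS]addrC; exact: ler_distD.
  by rewrite ler_pM2l; [apply: angle_triangle; lra|lra].
have half_le (p q : E) : enorm (hdiff p - hdiff q) <= edist2 p q.
  rewrite -ler_sqr ?nnegrE ?enorm_ge0 ?edist2_ge0// edist2E.
  by have := sqr_ge0 (enorm (mid p - mid q)); have := sqr_ge0 (enorm (hdiff p - hdiff q)); lra.
have f0loc p q : F0 p -> F0 q -> edist2 p q < eta ->
    f0 p q <= enorm (hdiff p - hdiff q).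
  move=> /F0P p1 /F0P q1 pq.
  have pq2 : enorm (hdiff p - hdiff q) ^+ 2 <= 4 * (1 - rho ^+ 2).
    have eta2 : eta ^+ 2 = 4 * (1 - rho ^+ 2) by rewrite sqr_sqrtr//; nra.
    rewrite -eta2 ler_sqr ?nnegrE ?enorm_ge0 ?(ltW eta0)//.
    by apply: le_trans (half_le _ _) _; exact: ltW.
  have rho1' : 0 < rho <= 1 by lra.
  have A := chord_ge rho1' p1 q1 pq2.
  rewrite edistC in pq2; have := chord_ge rho1' q1 p1 pq2.
  rewrite edistC angleC => B; rewrite /f0 -lerBrDl ler_norml; lra.
have [] := @chain_of_local R n F0 g f eta s t cg Xg s0 st t1 eta0.
- move=> p Fp; rewrite /f subrr enorm0 mulr0 addr0 mulr_ge0_le0// mulr_ge0_le0//.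
  exact: f0pp.
- move=> p q r Fp Fq Fr; rewrite /f -mulrDr ler_wpM2l// addrACA -!mulrDr.
  by apply: lerD; apply: ler_wpM2l => //; [exact: f0tri|exact: ler_edistD].
- move=> p q Fp Fq pq; apply: le_trans (edist2_weights p q c0 d0 cd).
  by rewrite ler_wpM2l// lerD2r ler_wpM2l//; exact: f0loc.
move=> l pl Hl; exists l => //; apply: le_trans Hl; rewrite /f (edistC (mid (g t))).
rewrite lerBlDr.
have Xs : 1 <= enorm (hdiff (g s)) by apply/F0P/Xg; lra.
have Xt : 1 <= enorm (hdiff (g t)) by apply/F0P/Xg; lra.
have : angle (hdiff (g s)) (hdiff (g t))
    + `|psi 1 (enorm (hdiff (g t))) - psi 1 (enorm (hdiff (g s)))|
    <= f0 (g s) (g t) + (1 - rho) * (2 * pi).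
  have rho1' : 0 < rho <= 1 by lra.
  have := psi1_le rho1' Xs; have := psi1_le rho1' Xt.
  have := psi_le_psi1 rho1' Xs; have := psi_le_psi1 rho1' Xt.
  have := angleI (hdiff (g s)) (hdiff (g t)); rewrite /f0.
  move: (angle _ _) (psi 1 (enorm (hdiff (g s)))) (psi rho (enorm (hdiff (g s)))).
  move: (psi 1 (enorm (hdiff (g t)))) (psi rho (enorm (hdiff (g t)))) => a b th a' b'.
  move=> thI H1 H2 H3 H4.
  have N : `|a - a'| <= `|b - b'| + (1 - rho) * pi.
    have := ler_norm (b - b'); have := ler_norm (b' - b); rewrite (distrC b' b).
    by rewrite ler_norml; lra.
  nra.
move: (angle _ _ + _) (f0 _ _) (enorm (mid _ - _)) => x y m xy.
have : Num.sqrt 2 * (c * x) <= Num.sqrt 2 * (c * y) + e.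
  have : c * x <= c * y + (1 - rho) * (2 * pi).
    apply: le_trans (ler_wpM2l c0 xy) _; rewrite mulrDr lerD2l ler_piMl//.
    by rewrite mulr_ge0; lra.
  move=> /(ler_wpM2l s2) /le_trans; apply; rewrite mulrDr lerD2l.
  apply: le_trans rhoe; have : 0 <= (1 - rho) * (2 * pi) by rewrite mulr_ge0; lra.
  by move: s22; nra.
by rewrite !mulrDr; lra.
Qed.

(** The weights (X / N, Y / N) are the equality case of Cauchy-Schwarz. For N = 0 both X and Y
    vanish, and zero weights do. *)
Lemma half_length_ge_length g s t X : 0 <= X -> half_length_ge g s t X ->
  length_ge g s t
    (Num.sqrt 2 * Num.sqrt (X ^+ 2 + enorm (mid (g t) - mid (g s)) ^+ 2)).
Proof.
move=> X0; set Y := enorm _; have Y0 : 0 <= Y by exact: enorm_ge0.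
set N := Num.sqrt (X ^+ 2 + _) => H.
have N2 : N ^+ 2 = X ^+ 2 + Y ^+ 2 by rewrite [LHS]sqr_sqrtr// addr_ge0 ?sqr_ge0.
have N0 : 0 <= N by exact: sqrtr_ge0.
have [z|z] := eqVneq N 0.
  apply: length_ge_le (H 0 0 _ _ _); rewrite ?lexx// ?expr0n/= ?addr0 ?ler01//.
  by rewrite z !mul0r addr0 mulr0.
have Np : 0 < N by rewrite lt_def z.
apply: length_ge_le (H (X / N) (Y / N) _ _ _); rewrite ?divr_ge0//.
  rewrite -/Y (_ : _ + _ = N)//; transitivity ((X ^+ 2 + Y ^+ 2) / N); first by ring.
  by rewrite -N2; field.
by rewrite !expr_div_n -mulrDl -N2 divff// sqrf_eq0.
Qed.

(* Two lower bounds adding up to the length of a shortest path are sharp, and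
   by the equality case of the triangle inequality in the product of the line
   and the space, mid moves proportionally to the length of hdiff \o g. *)
Lemma half_length_rigid g L t X1 X2 :
  let M := enorm (mid (g 1) - mid (g 0)) in
  let K := Num.sqrt 2 * Num.sqrt (L ^+ 2 + M ^+ 2) in
  (path_length g <= K%:E)%E -> 0 <= L -> 0 <= X1 -> 0 <= X2 ->
  half_length_ge g 0 t X1 -> half_length_ge g t 1 X2 -> L <= X1 + X2 ->
  exists tau, [/\ 0 <= tau <= 1, X1 = tau * L, X2 = (1 - tau) * L,
    mid (g t) = mid (g 0) + tau *: (mid (g 1) - mid (g 0)) &
    length_ge g 0 t (K * tau) /\ length_ge g t 1 (K * (1 - tau))].
Proof.
move=> M K gK L0 X10 X20 H1 H2 LX.
have G1 := half_length_ge_length X10 H1; have G2 := half_length_ge_length X20 H2.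
have s2 : 0 < Num.sqrt 2 :> R by rewrite sqrtr_gt0.
have enorm_cons (x : R) (w : V) :
    enorm (row_mx (const_mx x : 'rV_1) w) = Num.sqrt (x ^+ 2 + enorm w ^+ 2).
  apply: enormP; first exact: sqrtr_ge0.
  rewrite [RHS]sqr_sqrtr; last by rewrite addr_ge0 ?sqr_ge0.
  rewrite dot_row_mx enorm2; congr (_ + _).
  by rewrite /dot big_ord1 !mxE expr2.
pose a := row_mx (const_mx X1 : 'rV_1) (mid (g t) - mid (g 0)).
pose b := row_mx (const_mx X2 : 'rV_1) (mid (g 1) - mid (g t)).
have ab : a + b = row_mx (const_mx (X1 + X2)) (mid (g 1) - mid (g 0)).
  rewrite add_row_mx; congr row_mx; first by apply/rowP => i; rewrite !mxE.
  by rewrite addrC addrA subrK.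
have sum : enorm a + enorm b <= Num.sqrt (L ^+ 2 + M ^+ 2).
  rewrite !enorm_cons -(ler_pM2l s2) mulrDr -[leRHS]/K -lee_fin.
  by apply: le_trans gK; exact: length_ge_path_length (length_ge_cat G1 G2).
(* The triangle inequality also bounds X1 + X2 from above, since the second components of a and b
   add up to the fixed displacement of [mid]. *)
have XL : X1 + X2 <= L.
  have := le_trans (ler_enormD a b) sum; rewrite ab enorm_cons ler_sqrt; last first.
    by rewrite addr_ge0 ?sqr_ge0.
  by rewrite lerD2r ler_sqr// nnegrE addr_ge0.
have {}XL : X1 + X2 = L by apply/eqP; rewrite eq_le LX XL.
have Eab : enorm (a + b) = Num.sqrt (L ^+ 2 + M ^+ 2) by rewrite ab enorm_cons XL.
rewrite -Eab in sum; have [tau tau01 [Ea Eb]] := enormD_eq_param sum.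
have coords (x y : R) (w z : V) c :
    row_mx (const_mx x : 'rV_1) w = c *: row_mx (const_mx y : 'rV_1) z ->
    x = c * y /\ w = c *: z.
  rewrite scale_row_mx => /eq_row_mx[/rowP/(_ ord0) + ->].
  by rewrite !mxE.
exists tau; move: (Ea) (Eb); rewrite ab XL.
move=> /coords[E1 E1'] /coords[E2 _]; split => //.
  by rewrite -E1' addrC subrK.
by split; [apply: length_ge_le G1|apply: length_ge_le G2];
  rewrite -enorm_cons -/a -/b /K -mulrA ler_pM2l// mulrC -Eab;
  [rewrite [X in _ <= enorm X]Ea|rewrite [X in _ <= enorm X]Eb];
  rewrite enormZ ger0_norm//; lra.
Qed.

End HalfLength.

(** * Shortest paths around the unit ball *)

Section ShortestPaths.
Context {R : realType} {n : nat}.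
Local Notation V := 'rV[R]_n.
Local Notation E := (V * V)%type.

Lemma path_ivt (g : R -> E) (f : E -> R) (s t v : R) :
  {within `[0, 1], continuous g} -> continuous f -> 0 <= s -> s <= t -> t <= 1 ->
  f (g s) <= v <= f (g t) \/ f (g t) <= v <= f (g s) ->
  exists2 x, s <= x <= t & f (g x) = v.
Proof.
move=> cg cf s0 st t1 H.
have sub : `[s, t]%classic `<=` `[0, 1]%classic.
  by move=> x /=; rewrite !in_itv/=; lra.
have [|x] := @IVT R (f \o g) s t v st (within_continuous_comp_path sub cg cf).
  by rewrite ge_min le_max /=; case: H => /andP[-> ->]; rewrite ?orbT.
by rewrite in_itv/=; exists x.
Qed.

Lemma continuous_tangency (q : V) :
  continuous (fun e : E => dot q (hdiff e) + tlen q * tlen (hdiff e)).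
Proof.
move=> e; have ch := @continuous_hdiff R n e.
apply: cvgD; first by apply: cvg_dot; [exact: cvg_cst|exact: ch].
apply: cvgM; first exact: cvg_cst.
apply: (@cvg_comp _ _ _ (fun e : E => enorm (hdiff e) ^+ 2 - 1) Num.sqrt).
  apply: cvgB; last exact: cvg_cst.
  exact: cvgM (cvg_enorm ch) (cvg_enorm ch).
exact: sqrt_continuous.
Qed.

Lemma continuous_hdiff_dist (q : V) : continuous (fun e : E => enorm (q - hdiff e)).
Proof.
move=> e; apply: cvg_enorm; apply: cvgB; first exact: cvg_cst.
exact: continuous_hdiff.
Qed.

(** Expanding |h - p|^2 gives h.(h - p) = [tlen h] ([tlen h] + [tlen p]), so the point at distance
    [tlen h] from h on the segment is the point of contact. The ratio r is given by a product in
    order to admit vanishing tangent lengths. *)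
Lemma tangency_point (h p : V) (r : R) : 1 <= enorm h -> 1 <= enorm p ->
  enorm (h - p) = tlen h + tlen p -> r * (tlen h + tlen p) = tlen h ->
  enorm (h - r *: (h - p)) = 1 /\ dot h (h - r *: (h - p)) = 1.
Proof.
move=> h1 p1 dp rd.
have dd : dot (h - p) (h - p) = (tlen h + tlen p) ^+ 2 by rewrite -enorm2 dp.
have hh : dot h h = 1 + tlen h ^+ 2 by rewrite tlen2//; lra.
have hp : dot h (h - p) = tlen h * (tlen h + tlen p).
  move: dd; rewrite !dotE (dotC p h); have := tlen2 h1; have := tlen2 p1.
  by move: (tlen h) (tlen p) => x y; lra.
have E2 : dot h (h - r *: (h - p)) = 1.
  rewrite dotDr dotNr dotZr hp hh.
  by rewrite (_ : r * _ = tlen h * (r * (tlen h + tlen p))); [rewrite rd; ring|ring].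
split => //; apply: enormP => //.
rewrite {1}dotDl E2 dotNl dotZl dotDr dotNr dotZr (dotC _ h) hp dd.
transitivity (1 - tlen h * (r * (tlen h + tlen p)) + (r * (tlen h + tlen p)) ^+ 2).
  by ring.
by rewrite rd; ring.
Qed.

(* The angle of the arc and the length of the shortest curve from h to k outside
   of the unit ball, provided that arc_angle h k is not negative, i.e., that the
   segment from h to k meets the ball between the points of tangency. *)
Definition arc_angle (h k : V) : R := angle h k - topen h - topen k.
Definition detour (h k : V) : R := tlen h + tlen k + arc_angle h k.

Definition detour_length (P Q : E) : R :=
  Num.sqrt 2 * Num.sqrt (detour (hdiff P) (hdiff Q) ^+ 2
                         + enorm (mid Q - mid P) ^+ 2).

(* Keeps lra from comparing the atoms up to conversion. *)
Ltac lra_atoms := repeat match goal with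
  | |- context [psi ?r ?x] => generalize (psi r x)
  | |- context [arc_angle ?x ?y] => generalize (arc_angle x y)
  | |- context [angle ?x ?y] => generalize (angle x y)
  | |- context [tlen ?x] => generalize (tlen x)
  | |- context [topen ?x] => generalize (topen x)
  | |- context [enorm ?x] => generalize (enorm x)
  end; intros; lra.

Variables (P Q : E) (g : R -> E).
Hypothesis gP : is_path F0 P Q g.
Local Notation h := (hdiff P).
Local Notation k := (hdiff Q).
Local Notation L := (detour h k).
Hypothesis beta0 : 0 <= arc_angle h k.

Local Lemma path_cont : {within `[0, 1], continuous g}. Proof. by case: gP. Qed.
Local Lemma path_start : g 0 = P. Proof. by case: gP. Qed.
Local Lemma path_end : g 1 = Q. Proof. by case: gP. Qed.
Local Lemma path_norm_ge1 x : 0 <= x <= 1 -> 1 <= enorm (hdiff (g x)).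
Proof. by case: gP => _ _ _ Xg x01; apply/F0P/Xg. Qed.
Local Lemma start_norm_ge1 : 1 <= enorm h.
Proof. by rewrite /h -path_start; apply: path_norm_ge1; lra. Qed.
Local Lemma end_norm_ge1 : 1 <= enorm k.
Proof. by rewrite /k -path_end; apply: path_norm_ge1; lra. Qed.
Local Lemma start_norm_gt0 : 0 < enorm h. Proof. exact: lt_le_trans ltr01 start_norm_ge1. Qed.
Local Lemma end_norm_gt0 : 0 < enorm k. Proof. exact: lt_le_trans ltr01 end_norm_ge1. Qed.
Local Lemma detour_ge0 : 0 <= L.
Proof. by rewrite addr_ge0// addr_ge0 ?tlen_ge0. Qed.

Lemma tangent_crossing : exists T p, [/\ 0 <= T <= 1, p = hdiff (g T),
  1 <= enorm p, angle h p = topen h + topen p & enorm (h - p) = tlen h + tlen p].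
Proof.
have [|T T01 ET] := @path_ivt g _ 0 1 1 path_cont (@continuous_tangency h) (lexx 0) ler01 (lexx 1).
  (* The function is 2 |h|^2 - 1 >= 1 at the start; at the end it is at most 1 because
     [arc_angle h k] is not negative. *)
  right; rewrite path_start path_end -topen_le_angle ?start_norm_ge1 ?end_norm_ge1//.
  apply/andP; split.
    by move: beta0; rewrite /arc_angle; lra.
  have := tlen2 start_norm_ge1; have := dotvv_ge0 h; rewrite -enorm2; nra.
have T1 := path_norm_ge1 T01; exists T, (hdiff (g T)); split => //.
  exact: common_tangent_angle start_norm_ge1 T1 ET.
exact: common_tangent_dist start_norm_ge1 T1 ET.
Qed.

Local Lemma path_calibration s t : 0 <= s -> s <= t -> t <= 1 ->
  half_length_ge g s t (angle (hdiff (g s)) (hdiff (g t))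
    + `|psi 1 (enorm (hdiff (g t))) - psi 1 (enorm (hdiff (g s)))|).
Proof. exact: half_length_ge_calibration gP. Qed.

(** The contributions of [tlen p] and [topen p] cancel between the tangent segment and the change of
    [psi], so the bound does not depend on where the crossing point lies. *)
Local Lemma calibration_tail (p : V) : 1 <= enorm p -> angle h p = topen h + topen p ->
  L <= tlen h + tlen p
       + (angle p k + `|psi 1 (enorm k) - psi 1 (enorm p)|).
Proof.
move=> p1 ap.
have p0 : 0 < enorm p by lra.
have := angle_triangle start_norm_gt0 p0 end_norm_gt0.
have := ler_norm (psi 1 (enorm k) - psi 1 (enorm p)).
by rewrite /detour /arc_angle ap !psi1E; lra.
Qed.

Lemma half_length_ge_detour : half_length_ge g 0 1 L.
Proof.
have [T [p [/andP[T0 T1] pE p1 ap dp]]] := tangent_crossing.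
have := half_length_ge_cat (half_length_ge_dist g T0) (path_calibration T0 T1 (lexx 1)).
by rewrite path_start path_end -pE  dp => H; apply: half_length_ge_le H; exact: calibration_tail.
Qed.

Lemma path_length_ge_detour : ((detour_length P Q)%:E <= path_length g)%E.
Proof.
apply: length_ge_path_length.
by have := half_length_ge_length detour_ge0 half_length_ge_detour; rewrite path_start path_end.
Qed.

Hypothesis gK : (path_length g <= (detour_length P Q)%:E)%E.

Local Lemma path_rigid t X1 X2 : 0 <= X1 -> 0 <= X2 ->
  half_length_ge g 0 t X1 -> half_length_ge g t 1 X2 -> L <= X1 + X2 ->
  exists tau, [/\ 0 <= tau <= 1, X1 = tau * L, X2 = (1 - tau) * L,
    mid (g t) = mid P + tau *: (mid Q - mid P) &
    length_ge g 0 t (detour_length P Q * tau)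
    /\ length_ge g t 1 (detour_length P Q * (1 - tau))].
Proof.
move=> X10 X20 H1 H2 LX; have := @half_length_rigid R n g L t X1 X2.
by rewrite path_start path_end => /(_ gK detour_ge0 X10 X20 H1 H2 LX).
Qed.

Local Lemma path_rigid_sum t X1 X2 : 0 <= X1 -> 0 <= X2 ->
  half_length_ge g 0 t X1 -> half_length_ge g t 1 X2 -> L <= X1 + X2 ->
  X1 + X2 = L.
Proof.
move=> X10 X20 H1 H2 LX; have [tau [_ E1 E2 _ _]] := path_rigid X10 X20 H1 H2 LX.
by rewrite E1 E2; ring.
Qed.

(* The path starts with a segment up to the crossing point of
   tangent_crossing, hence it passes through the point of tangency. *)
Local Lemma path_touch_start : exists2 tu, 0 <= tu <= 1 &
  enorm (hdiff (g tu)) = 1 /\ dot h (hdiff (g tu)) = 1.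
Proof.
have [T [p [/andP[T0 T1] pE p1 ap dp]]] := tangent_crossing.
(* A time before the crossing at which the distance from h is the tangent length; once the path is
   known to be straight there, this is the point of contact. *)
have [|x /andP[x0 xT] Ex] := @path_ivt g _ 0 T (tlen h) path_cont
    (@continuous_hdiff_dist h) (lexx 0) T0 T1.
  by left; rewrite path_start subrr enorm0 -pE dp tlen_ge0 lerDl tlen_ge0.
have x01 : 0 <= x <= 1 by lra.
exists x => //.
have D1 := half_length_ge_dist g x0; have D2 := half_length_ge_dist g xT.
have D3 := half_length_ge_cat D2 (path_calibration T0 T1 (lexx 1)).
rewrite path_start in D1; rewrite path_end -pE in D3.
have tri := ler_edistD (hdiff (g x)) h p.
have tl := calibration_tail p1 ap; rewrite -dp in tl.
have Y0 : 0 <= angle p k + `|psi 1 (enorm k) - psi 1 (enorm p)|.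
  by rewrite addr_ge0 ?angle_ge0.
have := path_rigid_sum (enorm_ge0 _) (addr_ge0 (enorm_ge0 _) Y0) D1 D3 ltac:(lra).
move=> S; have {S D1 D2 D3}le : enorm (h - hdiff (g x)) + enorm (hdiff (g x) - p)
    <= enorm ((h - hdiff (g x)) + (hdiff (g x) - p)).
  by rewrite addrA subrK; lra.
have [r r01 [E1 _]] := enormD_eq_param le; rewrite addrA subrK in E1.
have rd : r * (tlen h + tlen p) = tlen h.
  by rewrite -dp -Ex E1 enormZ ger0_norm//; lra.
have Ehx : hdiff (g x) = h - r *: (h - p) by rewrite -E1 opprB addrC subrK.
by rewrite Ehx; apply: tangency_point => //; exact: start_norm_ge1.
Qed.

(** Reversing time would give a contact point for k, but not one after [tu]. Instead, a point p with
    a common tangent with k is found after [tu]; the bounds before and after it exceed L by 2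
    [psi 1 (enorm p)], so p lies on the sphere. *)
Local Lemma path_touch_end tu : 0 <= tu <= 1 ->
  enorm (hdiff (g tu)) = 1 -> dot h (hdiff (g tu)) = 1 ->
  exists2 tv, tu <= tv <= 1 & enorm (hdiff (g tv)) = 1 /\ dot k (hdiff (g tv)) = 1.
Proof.
move=> /andP[tu0 tu1] u1 hu; set u := hdiff (g tu) in u1 hu.
have au := tangent_angle start_norm_ge1 u1 hu; have du := tangent_dist start_norm_ge1 u1 hu.
have u0 : 0 < enorm u by lra.
have auk := angle_triangle start_norm_gt0 u0 end_norm_gt0; rewrite au in auk.
have [|x /andP[x0 x1] Ex] := @path_ivt g _ tu 1 1 path_cont
    (@continuous_tangency k) tu0 tu1 (lexx 1).
  left; rewrite path_end -/u -topen_le_angle ?u1 ?end_norm_ge1// (topen_unit u1) addr0 angleC.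
  apply/andP; split; first by move: beta0; rewrite /arc_angle; lra.
  have := tlen2 end_norm_ge1; have := dotvv_ge0 k; rewrite -enorm2; nra.
have x01 : 0 <= x <= 1 by lra.
have p1 := path_norm_ge1 x01; set p := hdiff (g x) in Ex p1.
have p0 : 0 < enorm p by lra.
have ap := common_tangent_angle end_norm_ge1 p1 Ex.
have dp := common_tangent_dist end_norm_ge1 p1 Ex.
have aup := angle_triangle u0 p0 end_norm_gt0; rewrite (angleC p k) ap in aup.
exists x; first by rewrite x0.
rewrite -/p; suff p1' : enorm p = 1.
  by split=> //; rewrite -Ex (tlen_unit p1') mulr0 addr0.
apply: psi1_le0 => //.
have D1 := half_length_ge_cat (half_length_ge_dist g tu0) (path_calibration tu0 x0 x1).
have D2 := half_length_ge_dist g x1.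
rewrite path_start -/u -/p du in D1; rewrite path_end -/p edistC dp in D2.
have N : psi 1 (enorm p) <= `|psi 1 (enorm p) - psi 1 (enorm u)|.
  by rewrite (psi1_unit u1) subr0 ler_norm.
have X10 : 0 <= tlen h + (angle u p + `|psi 1 (enorm p) - psi 1 (enorm u)|).
  by rewrite !addr_ge0 ?tlen_ge0 ?angle_ge0.
have X20 : 0 <= tlen k + tlen p by rewrite addr_ge0 ?tlen_ge0.
have LE : L + 2 * psi 1 (enorm p) <= tlen h
    + (angle u p + `|psi 1 (enorm p) - psi 1 (enorm u)|) + (tlen k + tlen p).
  move: N; rewrite /detour /arc_angle  => N.
  by have := psi1E p; move: auk aup N; clear -gP beta0 gK; lra_atoms.
have pp := psi1_ge0 p1.
have LX : L <= tlen h + (angle u p + `|psi 1 (enorm p) - psi 1 (enorm u)|)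
    + (tlen k + tlen p) by move: pp LE; clear -gP beta0 gK; lra_atoms.
by have := path_rigid_sum X10 X20 D1 D2 LX; move: LE; clear -gP beta0 gK; lra_atoms.
Qed.

Hypothesis betapi : arc_angle h k < pi.

(** The same tau governs [mid], [hdiff] and the lengths before and after t; these are the data from
    which [minimal_factor] builds a reparametrization. The parameter r is local to one of the three
    pieces. *)
Lemma detour_rigid : exists u v,
  [/\ tangent_pair h k u v, angle u v = arc_angle h k &
  forall t, 0 <= t <= 1 -> exists tau, [/\ 0 <= tau <= 1,
    mid (g t) = mid P + tau *: (mid Q - mid P),
    length_ge g 0 t (detour_length P Q * tau)
    /\ length_ge g t 1 (detour_length P Q * (1 - tau)) &
    exists2 r, 0 <= r <= 1 &
    [\/ tau * L = r * tlen h /\ hdiff (g t) = h + r *: (u - h),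
      tau * L = tlen h + r * arc_angle h k /\ hdiff (g t) = sphere_arc u v r |
      tau * L = tlen h + arc_angle h k + r * tlen k
      /\ hdiff (g t) = v + r *: (k - v)]]].
Proof.
have [tu tu01 [u1 hu]] := path_touch_start.
have [tv tv1 [v1 kv]] := path_touch_end tu01 u1 hu.
set u := hdiff (g tu) in u1 hu; set v := hdiff (g tv) in v1 kv.
have tp : tangent_pair h k u v by [].
have uv := tangent_angle_ge start_norm_ge1 end_norm_ge1 tp; rewrite -/(arc_angle h k) in uv.
have u0 : 0 < enorm u by lra.
have v0 : 0 < enorm v by lra.
have /andP[tu0 tu1] := tu01.
have [tuv tv1'] := andP tv1.
have du := tangent_dist start_norm_ge1 u1 hu; have dv := tangent_dist end_norm_ge1 v1 kv.
have Du := half_length_ge_dist g tu0; rewrite path_start -/u du in Du.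
have Dv := half_length_ge_dist g tv1'; rewrite path_end -/v edistC dv in Dv.
(* Splitting at x counts [psi 1 (enorm p)] once on either side, on top of the angles from u to p and
   from p to v. No surplus is available, so p is on the sphere and the two angles add up to that
   from u to v. *)
have mid_arc x : tu <= x -> x <= tv -> exists tau, [/\ 0 <= tau <= 1,
    mid (g x) = mid P + tau *: (mid Q - mid P),
    length_ge g 0 x (detour_length P Q * tau)
    /\ length_ge g x 1 (detour_length P Q * (1 - tau)),
    angle u v = arc_angle h k &
    exists2 r, 0 <= r <= 1 &
    tau * L = tlen h + r * arc_angle h k /\ hdiff (g x) = sphere_arc u v r].
  move=> ux xv; have x01 : 0 <= x <= 1 by lra.
  have p1 := path_norm_ge1 x01; have [x0 x1] := andP x01; set p := hdiff (g x) in p1 *.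
  have p0 : 0 < enorm p by lra.
  have D1 := half_length_ge_cat Du (path_calibration tu0 ux x1).
  have D2 := half_length_ge_cat (path_calibration x0 xv tv1') Dv.
  have N1 := ler_norm (psi 1 (enorm p) - psi 1 (enorm u)).
  have N2 := ler_norm (- (psi 1 (enorm v) - psi 1 (enorm p))).
  rewrite normrN in N2; rewrite -/p -/u -/v in D1 D2.
  rewrite (psi1_unit u1) subr0 in N1 D1; rewrite (psi1_unit v1) sub0r opprK normrN in N2 D2.
  have P0 := psi1_ge0 p1; rewrite (ger0_norm P0) in N1 N2 D1 D2.
  have A := angle_triangle u0 p0 v0.
  have A1 := angle_ge0 u p; have A2 := angle_ge0 p v.
  have t1 := tlen_ge0 h; have t2 := tlen_ge0 k.
  have X10 : 0 <= tlen h + (angle u p + psi 1 (enorm p)).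
    by move: A1 t1 P0; clear -gP beta0 gK betapi; lra_atoms.
  have X20 : 0 <= angle p v + psi 1 (enorm p) + tlen k.
    by move: A2 t2 P0; clear -gP beta0 gK betapi; lra_atoms.
  have LX : L <= tlen h + (angle u p + psi 1 (enorm p))
                 + (angle p v + psi 1 (enorm p) + tlen k).
    by rewrite /detour; move: A uv P0; clear -gP beta0 gK betapi; lra_atoms.
  have [tau [tau01 E1 E2 m le]] := path_rigid X10 X20 D1 D2 LX.
  have S : tlen h + (angle u p + psi 1 (enorm p))
           + (angle p v + psi 1 (enorm p) + tlen k) = L by rewrite E1 E2; ring.
  rewrite /detour in S.
  have pp1 : enorm p = 1 by apply: psi1_le0 => //;
    move: A uv S; clear -gP beta0 gK betapi; lra_atoms.
  have psip : psi 1 (enorm p) = 0 by apply: psi1_unit.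
  rewrite psip in E1 S.
  have Euv : angle u v = arc_angle h k by move: A uv S; clear -gP beta0 gK betapi; lra_atoms.
  have Aup : angle u p + angle p v <= angle u v.
    by move: S Euv; clear -gP beta0 gK betapi; lra_atoms.
  (* If [angle u v] is 0, the quotient is 0 by convention, which is right since [angle u p] is then
     0 too. *)
  exists tau; split => //; exists (angle u p / angle u v).
    have [->|z] := eqVneq (angle u v) 0; first by rewrite invr0 mulr0 lexx ler01.
    have zp : 0 < angle u v by rewrite lt_def z angle_ge0.
    by rewrite divr_ge0 ?angle_ge0//= ler_pdivrMr// mul1r;
      move: Aup A2; clear -gP beta0 gK betapi; lra_atoms.
  split; last by apply: angle_triangle_eq => //; rewrite Euv.
  rewrite -E1 addr0 -Euv; have [z|z] := eqVneq (angle u v) 0; last by rewrite divfK.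
  by rewrite z mulr0; move: Aup A1 A2; rewrite z; clear -gP beta0 gK betapi; lra_atoms.
have Euv : angle u v = arc_angle h k by have [? []] := mid_arc _ (lexx tu) tuv.
exists u, v; split => // x x01; have [x0 x1] := andP x01.
have seg (p q : V) (S : R) y : S = enorm (p - q) ->
    enorm (p - y) + enorm (y - q) = enorm (p - q) ->
    exists2 r, 0 <= r <= 1 & enorm (p - y) = r * S /\ y = p + r *: (q - p).
  move=> -> E; have : enorm (p - y) + enorm (y - q) <= enorm ((p - y) + (y - q)).
    by rewrite addrA subrK E.
  move=> /enormD_eq_param[r r01 [E1 _]]; rewrite addrA subrK in E1.
  exists r => //; rewrite E1 enormZ ger0_norm; last by case/andP: r01.
  by split => //; rewrite -opprB scalerN -E1 opprB addrC subrK.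
have [xu|ux] := lerP x tu.
  have D1 := half_length_ge_dist g x0; have D2 := half_length_ge_dist g xu.
  have D3 := half_length_ge_cat D2 (half_length_ge_cat (path_calibration tu0 tuv tv1') Dv).
  rewrite path_start in D1.
  rewrite -/u -/v (psi1_unit u1) (psi1_unit v1) subrr normr0 addr0 Euv in D3.
  have Y0 : 0 <= enorm (hdiff (g x) - u) + (arc_angle h k + tlen k).
    apply: addr_ge0; first exact: enorm_ge0.
    by apply: addr_ge0 => //; exact: tlen_ge0.
  have tri := ler_edistD (hdiff (g x)) h u.
  have LX : L <= enorm (h - hdiff (g x)) + (enorm (hdiff (g x) - u) + (arc_angle h k + tlen k)).
    by rewrite /detour; move: tri du; clear -gP beta0 gK betapi; lra_atoms.
  have [tau [tau01 E1 E2 m le]] := path_rigid (enorm_ge0 _) Y0 D1 D3 LX.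
  have S : enorm (h - hdiff (g x)) + (enorm (hdiff (g x) - u) + (arc_angle h k + tlen k)) = L.
    by rewrite E1 E2; ring.
  rewrite /detour in S.
  have [|r r01 [Er Ey]] := seg h u (tlen h) (hdiff (g x)) (esym du).
    by move: S du; clear -gP beta0 gK betapi; lra.
  exists tau; split => //; exists r => //; apply: Or31; split => //.
  by rewrite -E1.
have [xv|vx] := lerP x tv.
  have [tau [tau01 m le _ [r r01 E]]] := mid_arc x (ltW ux) xv.
  by exists tau; split => //; exists r => //; exact: Or32.
have D1 := half_length_ge_dist g x1; have D2 := half_length_ge_dist g (ltW vx).
have D3 := half_length_ge_cat (half_length_ge_cat Du (path_calibration tu0 tuv tv1')) D2.
rewrite path_end in D1; rewrite -/u -/v (psi1_unit u1) (psi1_unit v1) subrr normr0 addr0 Euv in D3.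
have Y0 : 0 <= tlen h + arc_angle h k + enorm (v - hdiff (g x)).
  apply: addr_ge0; last exact: enorm_ge0.
  by apply: addr_ge0 => //; exact: tlen_ge0.
have tri := ler_edistD (hdiff (g x)) v k.
rewrite edistC in dv.
have LX : L <= tlen h + arc_angle h k + enorm (v - hdiff (g x)) + enorm (hdiff (g x) - k).
  by rewrite /detour; move: tri dv; clear -gP beta0 gK betapi; lra_atoms.
have [tau [tau01 E1 E2 m le]] := path_rigid Y0 (enorm_ge0 _) D3 D1 LX.
have S : tlen h + arc_angle h k + enorm (v - hdiff (g x)) + enorm (hdiff (g x) - k) = L.
  by rewrite E1 E2; ring.
rewrite /detour in S.
have [|r r01 [Er Ey]] := seg v k (tlen k) (hdiff (g x)) (esym dv).
  by move: S dv; clear -gP beta0 gK betapi; lra.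
exists tau; split => //; exists r => //; apply: Or33; split => //.
by rewrite -E1 Er.
Qed.

End ShortestPaths.

(** * Lipschitz curves and reparametrizations *)

Section LipschitzCurves.
Context {R : realType} {n : nat}.
Local Notation V := 'rV[R]_n.
Local Notation E := (V * V)%type.

Lemma within_continuous_realP (A : set R) (f : R -> R) :
  {within A, continuous f} <-> forall t, A t -> forall e, 0 < e ->
    exists2 d, 0 < d & forall s, A s -> `|s - t| < d -> `|f s - f t| < e.
Proof.
rewrite subspace_continuousP; split=> H t At.
  move=> e e0; have := H t At => /cvgrPdist_lt/(_ e e0)/nbhs_ballP[d /= d0 Hd].
  exists d => // s As st; move: (Hd s).
  by rewrite /ball/= (distrC t) (distrC (f t)); apply.
apply/cvgrPdist_lt => e e0; have [d d0 Hd] := H t At e e0.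
apply/nbhs_ballP; exists d => //= s; rewrite /ball/= distrC => st As.
by rewrite distrC; exact: Hd.
Qed.

(** Used with K the minimal length: the constant then bounds the length of every monotone
    reparametrization from above. *)
Definition lipschitz01 (c : R -> E) (K : R) := forall s t,
  0 <= s -> s <= t -> t <= 1 -> edist2 (c s) (c t) <= K * (t - s).

Lemma reparamI (phi : R -> R) t : reparam phi -> 0 <= t <= 1 -> 0 <= phi t <= 1.
Proof.
move=> [_ p0 p1 pm] /andP[t0 t1]; apply/andP; split.
  by rewrite -p0; apply: pm.
by rewrite -p1; apply: pm.
Qed.

Lemma reparam_id : reparam (id : R -> R).
Proof. by split => //; apply: continuous_subspaceT => x; exact: cvg_id. Qed.

Lemma lipschitz01_ge0 c K : lipschitz01 c K -> 0 <= K.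
Proof.
move=> cK; have := cK 0 1 (lexx 0) ler01 (lexx 1); rewrite subr0 mulr1.
exact: le_trans (edist2_ge0 _ _).
Qed.

Lemma lipschitz01_norm c K s t : lipschitz01 c K -> 0 <= s <= 1 -> 0 <= t <= 1 ->
  edist2 (c s) (c t) <= K * `|s - t|.
Proof.
move=> cK /andP[s0 s1] /andP[t0 t1]; have [st|st] := leP s t.
  by rewrite distrC ger0_norm ?subr_ge0//; exact: cK.
by rewrite edist2C ger0_norm ?subr_ge0 ?(ltW st)//; apply: cK => //; exact: ltW.
Qed.

Lemma lipschitz01_continuous c K : lipschitz01 c K -> {within `[0, 1], continuous c}.
Proof.
move=> cK; apply/within_continuous_edist2P => t /= + e e0.
rewrite in_itv/= => tI; have K0 := lipschitz01_ge0 cK.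
exists (e / (K + 1)); first by rewrite divr_gt0// ltr_wpDl.
move=> s /=; rewrite in_itv/= => sI st.
apply: le_lt_trans (lipschitz01_norm cK sI tI) _.
rewrite ltr_pdivlMr ?ltr_wpDl// in st; apply: le_lt_trans st.
by rewrite mulrC ler_wpM2l// lerDl.
Qed.

Section Reparametrized.
Variables (X : set E) (p q : E) (c g : R -> E) (K : R) (phi : R -> R).
Hypotheses (cK : lipschitz01 c K) (c0 : c 0 = p) (c1 : c 1 = q).
Hypothesis cX : forall t, 0 <= t <= 1 -> X (c t).
Hypotheses (phiR : reparam phi) (gE : forall t, 0 <= t <= 1 -> g t = c (phi t)).

Lemma lipschitz01_is_path : is_path X p q g.
Proof.
have [cphi p0 p1 _] := phiR; split.
- have /within_continuous_edist2P cc := lipschitz01_continuous cK.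
  apply/within_continuous_edist2P => t /= + e e0; rewrite in_itv/= => tI.
  have [|d d0 Hd] := cc (phi t) _ e e0; first by rewrite /= in_itv/= reparamI.
  have /within_continuous_realP/(_ t) := cphi; rewrite /= in_itv/= tI.
  move=> /(_ isT d d0)[d' d'0 Hd']; exists d' => // s /=; rewrite in_itv/= => sI st.
  by rewrite !gE//; apply: Hd; rewrite /= ?in_itv/= ?reparamI//; exact: Hd'.
- by rewrite gE ?p0// lexx ler01.
- by rewrite gE ?p1// lexx ler01.
- by move=> t tI; rewrite gE//; apply: cX; exact: reparamI.
Qed.

Lemma lipschitz01_path_length : (path_length g <= K%:E)%E.
Proof.
have [_ p0 p1 pm] := phiR; apply: path_length_le => l.
have -> : K = K * (phi 1 - phi 0) by rewrite p1 p0 subr0 mulr1.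
suff : forall s, 0 <= s -> itv_partition s 1 l -> chainlen g s l <= K * (phi 1 - phi s).
  by apply.
elim: l => [|x l IH] s s0 pl /=.
  by rewrite (itv_partition_nil pl) subrr mulr0.
have [/= /andP[sx _] _] := pl; have pl' := itv_partition_cons pl.
have x1 := itv_partition_le pl'; have x0 : 0 <= x by apply: le_trans s0 (ltW sx).
have xI : 0 <= x <= 1 by rewrite x0.
have sI : 0 <= s <= 1 by rewrite s0 (le_trans (ltW sx)).
rewrite !gE// edist2C; have := IH x x0 pl'.
have /andP[ps0 _] := reparamI phiR sI; have /andP[_ px1] := reparamI phiR xI.
have := cK ps0 (pm _ _ s0 (ltW sx) x1) px1; lra.
Qed.

Hypothesis Kmin : forall g', is_path X p q g' -> (K%:E <= path_length g')%E.

Lemma lipschitz01_geodesic : geodesic X p q g.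
Proof.
split; first exact: lipschitz01_is_path.
by move=> g' /Kmin; apply: le_trans; exact: lipschitz01_path_length.
Qed.

End Reparametrized.

Section Minimal.
Variables (X : set E) (p q : E) (c : R -> E) (K : R).
Hypotheses (cK : lipschitz01 c K) (c0 : c 0 = p) (c1 : c 1 = q).
Hypothesis cX : forall t, 0 <= t <= 1 -> X (c t).
Hypothesis Kmin : forall g', is_path X p q g' -> (K%:E <= path_length g')%E.

(* Cutting out a loop would give a shorter path. *)
Lemma minimal_inj s t : 0 < K -> 0 <= s -> s < t -> t <= 1 -> c s <> c t.
Proof.
move=> K0 s0 st t1 cst; have [w wE] : exists w, w = 1 - (t - s) by exists (1 - (t - s)).
have w0 : 0 <= w by lra.
(* The curve without its loop, slowed down by the factor w to fill [0, 1] again; its Lipschitz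
   constant is K w < K. *)
pose b x := if x * w <= s then c (x * w) else c (x * w + (t - s)).
have bK : lipschitz01 b (K * w).
  move=> x y x0 xy y1; rewrite /b.
  have xw : 0 <= x * w by rewrite mulr_ge0.
  have xyw : x * w <= y * w by rewrite ler_wpM2r.
  have yw : y * w <= w by rewrite ler_piMl.
  have -> : K * w * (y - x) = K * (y * w - x * w) by ring.
  case: ifPn => [xs|]; last rewrite -ltNge => sx.
    case: ifPn => [ys|]; first by apply: cK => //; lra.
    rewrite -ltNge => sy; apply: le_trans (edist2_triangle (c s) _ _) _.
    have A : edist2 (c (x * w)) (c s) <= K * (s - x * w) by apply: cK => //; lra.
    have B : edist2 (c s) (c (y * w + (t - s))) <= K * (y * w + (t - s) - t).
      by rewrite cst; apply: cK; lra.
    by lra.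
  case: ifPn => [ys|]; first by lra.
  rewrite -ltNge => sy; have -> : y * w - x * w = y * w + (t - s) - (x * w + (t - s)) by ring.
  by apply: cK; lra.
have bX x : 0 <= x <= 1 -> X (b x).
  move=> xI; have xw : 0 <= x * w by rewrite mulr_ge0//; lra.
  have xw1 : x * w <= w by rewrite ler_piMl//; lra.
  by rewrite /b; case: ifPn => H; apply: cX; rewrite -?ltNge in H; lra.
have b0 : b 0 = p by rewrite /b mul0r s0.
have b1 : b 1 = q.
  (* The first branch is taken at 1 only if the loop ends at t = 1; the value is then c s = c t =
     q. *)
  rewrite /b mul1r; case: ifPn => [ws|_]; last by rewrite wE subrK.
  have tE : t = 1 by lra.
  by have -> : w = s; [lra|rewrite cst tE].
have := Kmin (lipschitz01_is_path bK b0 b1 bX reparam_id (fun _ _ => erefl)).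
move=> /le_trans/(_ (lipschitz01_path_length bK reparam_id (fun _ _ => erefl))).
by rewrite lee_fin -subr_ge0 (_ : _ - _ = - (K * (t - s))); [nra|rewrite wE; ring].
Qed.

(** Quantitative continuity of the inverse of c, from injectivity and compactness of [a, b]. *)
Let separated tau a b : 0 < K -> 0 <= tau <= 1 -> 0 <= a -> b <= 1 ->
  tau < a \/ b < tau ->
  exists2 m, 0 < m & forall s, a <= s <= b -> m <= edist2 (c s) (c tau).
Proof.
move=> K0 tauI a0 b1 out; have [ba|ab] := ltrP b a.
  by exists 1 => // s; lra.
have sub : `[a, b]%classic `<=` `[0, 1]%classic.
  by move=> x /=; rewrite !in_itv/=; lra.
have [x xI Hx] := @EVT_min _ (fun s => edist2 (c s) (c tau)) a b ab
  (within_continuous_comp_path sub (lipschitz01_continuous cK) (@continuous_edist2 R n (c tau))).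
rewrite in_itv/= in xI.
exists (edist2 (c x) (c tau)); last first.
  by move=> s sI; apply: Hx; rewrite in_itv.
rewrite lt_def edist2_ge0 andbT; apply/eqP => /edist2_eq0 E.
have [xt|tx] := ltrP x tau; first by apply: (minimal_inj K0 _ xt _ E); lra.
by apply: (@minimal_inj tau x K0) (esym E); lra.
Qed.

(** The fractions tau are chosen pointwise. They are monotone because the bounds before s and after
    t add up to at most K, continuous by [separated], and right at the end points because a single
    point has no length. For K = 0 the curve is constant. *)
Lemma minimal_factor g : is_path X p q g -> (path_length g <= K%:E)%E ->
  (forall t, 0 <= t <= 1 -> exists tau, [/\ 0 <= tau <= 1, g t = c tau &
     length_ge g 0 t (K * tau) /\ length_ge g t 1 (K * (1 - tau))]) ->
  exists2 phi, reparam phi & forall t, 0 <= t <= 1 -> g t = c (phi t).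
Proof.
move=> [cg g0 g1 _] gK H; have := lipschitz01_ge0 cK.
rewrite le_eqVlt => /orP[/eqP K0|K0].
  exists id; first exact: reparam_id.
  move=> t tI; have [tau [tauI -> _]] := H t tI.
  apply: edist2_eq0; apply/eqP; rewrite eq_le edist2_ge0 andbT.
  by have := lipschitz01_norm cK tauI tI; rewrite -K0 mul0r.
have /choice[phi Hphi] : forall t, exists tau, 0 <= t <= 1 -> [/\ 0 <= tau <= 1, g t = c tau &
     length_ge g 0 t (K * tau) /\ length_ge g t 1 (K * (1 - tau))].
  by move=> t; have [/H[tau ?]|] := boolP (0 <= t <= 1); [exists tau|exists 0].
have mono s t : 0 <= s -> s <= t -> t <= 1 -> phi s <= phi t.
  move=> s0 st t1.
  have [_ _ [Ls _]] := Hphi s ltac:(lra); have [_ _ [_ Lt]] := Hphi t ltac:(lra).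
  have := length_ge_path_length (length_ge_cat Ls
    (length_ge_cat (length_ge_edist2 g st) Lt)).
  move=> /le_trans/(_ gK); rewrite lee_fin => le.
  have := edist2_ge0 (g s) (g t) => d0.
  have : K * phi s <= K * phi t by lra.
  by rewrite ler_pM2l.
exists phi; last by move=> t /Hphi[].
split => //.
- apply/within_continuous_realP => t /= + e e0; rewrite in_itv/= => tI.
  have [phitI gt _] := Hphi t tI.
  have [m1 m10 M1] := @separated (phi t) 0 (phi t - e) K0 phitI ltac:(lra) ltac:(lra) ltac:(lra).
  have [m2 m20 M2] := @separated (phi t) (phi t + e) 1 K0 phitI ltac:(lra) ltac:(lra) ltac:(lra).
  have m0 : 0 < Num.min m1 m2 by rewrite lt_min m10.
  have /within_continuous_edist2P/(_ t) := cg; rewrite /= in_itv/= tI.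
  move=> /(_ isT _ m0)[d d0 Hd]; exists d => // s /=; rewrite in_itv/= => sI st.
  have [phisI gs _] := Hphi s sI.
  have := Hd s; rewrite /= in_itv/= => /(_ sI st); rewrite gt gs lt_min => /andP[D1 D2].
  rewrite ltNge; apply/negP; rewrite ler_normr => /orP[] le.
    by have := M2 (phi s) ltac:(lra); lra.
  by have := M1 (phi s) ltac:(lra); lra.
- have zI : 0 <= (0 : R) <= 1 by rewrite lexx ler01.
  have [/andP[p0 _] _ [/length_ge_point L0 _]] := Hphi 0 zI.
  by apply/eqP; rewrite eq_le p0 andbT -(pmulr_rle0 _ K0).
- have oI : 0 <= (1 : R) <= 1 by rewrite lexx ler01.
  have [/andP[_ p1] _ [_ /length_ge_point L1]] := Hphi 1 oI.
  by apply/eqP; rewrite eq_le p1 /= -subr_le0 -(pmulr_rle0 _ K0).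
Qed.

End Minimal.

Lemma same_path_reparam (c g1 g2 : R -> E) phi1 phi2 :
  reparam phi1 -> reparam phi2 ->
  (forall t, 0 <= t <= 1 -> g1 t = c (phi1 t)) ->
  (forall t, 0 <= t <= 1 -> g2 t = c (phi2 t)) -> same_path g1 g2.
Proof.
by move=> r1 r2 E1 E2; exists c, phi1, phi2; split => // t tI; rewrite E1// E2.
Qed.

End LipschitzCurves.

Section PiecewiseReparam.
Context {R : realType}.

(** One two-sided estimate carries monotonicity and continuity at once, and it is inherited by
    concatenations. *)
Definition nondecreasing_lipschitz (f : R -> R) (C : R) := forall s t,
  0 <= s -> s <= t -> t <= 1 -> 0 <= f t - f s <= C * (t - s).

Definition join (f g : R -> R) t := if t <= 2^-1 then f (2 * t) else g (2 * t - 1).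

Lemma nondecreasing_lipschitz_join f g C : f 1 = g 0 ->
  nondecreasing_lipschitz f C -> nondecreasing_lipschitz g C ->
  nondecreasing_lipschitz (join f g) (2 * C).
Proof.
move=> fg F G s t s0 st t1; rewrite /join.
case: ifPn => t2; case: ifPn => s2; rewrite -?ltNge in t2 s2.
- by have := F (2 * s) (2 * t) ltac:(lra) ltac:(lra) ltac:(lra); lra.
- by lra.
- have := F (2 * s) 1 ltac:(lra) ltac:(lra) ltac:(lra).
  have := G 0 (2 * t - 1) ltac:(lra) ltac:(lra) ltac:(lra).
  by rewrite fg; lra.
- by have := G (2 * s - 1) (2 * t - 1) ltac:(lra) ltac:(lra) ltac:(lra); lra.
Qed.

Definition affine (a b t : R) := a + t * (b - a).

Lemma nondecreasing_lipschitz_affine a b C : a <= b -> b - a <= C ->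
  nondecreasing_lipschitz (affine a b) C.
Proof. by move=> ab abC s t s0 st t1; rewrite /affine; nra. Qed.

Lemma nondecreasing_lipschitz_reparam f C : nondecreasing_lipschitz f C ->
  f 0 = 0 -> f 1 = 1 -> reparam f.
Proof.
move=> F f0 f1; split => //; last first.
  by move=> s t s0 st t1; have := F s t s0 st t1; lra.
have C0 : 0 <= C by have := F 0 1 (lexx 0) ler01 (lexx 1); rewrite f0 f1; lra.
apply/within_continuous_realP => t /= + e e0; rewrite in_itv/= => tI.
exists (e / (C + 1)); first by rewrite divr_gt0// ltr_wpDl.
move=> s /=; rewrite in_itv/= => sI.
rewrite ltr_pdivlMr ?ltr_wpDl//; apply: le_lt_trans.
have [st|ts] := leP s t.
  rewrite distrC ger0_norm; last by have := F s t; lra.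
  rewrite distrC ger0_norm ?subr_ge0//.
  by have := F s t ltac:(lra) st ltac:(lra); nra.
rewrite ger0_norm; last by have := F t s; lra.
rewrite ger0_norm; last by lra.
by have := F t s ltac:(lra) (ltW ts) ltac:(lra); nra.
Qed.

End PiecewiseReparam.

(** * The shortest curve *)

Section DetourCurve.
Context {R : realType} {n : nat}.
Local Notation V := 'rV[R]_n.
Local Notation E := (V * V)%type.

Section Curve.
Variables h k u v : V.
Hypotheses (h1 : 1 <= enorm h) (k1 : 1 <= enorm k).
Hypothesis uv_tangent : tangent_pair h k u v.
Hypotheses (uv_arc : angle u v = arc_angle h k) (uv_pi : angle u v < pi).
Let beta := angle u v.
Let L := detour h k.

(* The arc length parametrization of the tangent segment from h to u, the arc
   from u to v and the tangent segment from v to k; division by zero yields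
   zero, which is correct for degenerate pieces. *)
Definition detour_curve (s : R) : V :=
  if s <= tlen h then h + (s / tlen h) *: (u - h)
  else if s <= tlen h + beta then sphere_arc u v ((s - tlen h) / beta)
  else v + ((s - tlen h - beta) / tlen k) *: (k - v).

Let u1 : enorm u = 1. Proof. by case: uv_tangent. Qed.
Let v1 : enorm v = 1. Proof. by case: uv_tangent. Qed.
Let hu : dot h u = 1. Proof. by case: uv_tangent. Qed.
Let kv : dot k v = 1. Proof. by case: uv_tangent. Qed.
Let du : enorm (u - h) = tlen h. Proof. by rewrite edistC tangent_dist. Qed.
Let dv : enorm (k - v) = tlen k. Proof. exact: tangent_dist. Qed.
Let th0 : 0 <= tlen h. Proof. exact: tlen_ge0. Qed.
Let tk0 : 0 <= tlen k. Proof. exact: tlen_ge0. Qed.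
Let b0 : 0 <= beta. Proof. exact: angle_ge0. Qed.
Let LE : L = tlen h + beta + tlen k.
Proof. by rewrite /L /detour -uv_arc -/beta addrAC. Qed.

Lemma detour_curve_start r : 0 <= r <= 1 ->
  detour_curve (r * tlen h) = h + r *: (u - h).
Proof.
move=> /andP[r0 r1]; rewrite /detour_curve ler_piMl//.
have [z|z] := eqVneq (tlen h) 0; last by rewrite mulfK.
have /enorm_eq0-> : enorm (u - h) = 0 by rewrite du.
by rewrite !scaler0.
Qed.

Lemma detour_curve_arc r : 0 <= r <= 1 ->
  detour_curve (tlen h + r * beta) = sphere_arc u v r.
Proof.
(* For r beta = 0 the parameter falls into the first branch of [detour_curve], whose last value is
   u. *)
move=> /andP[r0 r1]; have [z|z] := eqVneq (r * beta) 0.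
  have -> : tlen h + r * beta = 1 * tlen h by rewrite z addr0 mul1r.
  rewrite detour_curve_start ?ler01 ?lexx// scale1r addrC subrK.
  move/eqP: z; rewrite mulf_eq0 => /orP[/eqP->|z]; first by rewrite sphere_arc0.
  by rewrite /sphere_arc z.
have rb : 0 < r * beta by rewrite lt_def z mulr_ge0.
have bz : beta != 0 by apply: contraNneq z => ->; rewrite mulr0.
rewrite /detour_curve gerDl leNgt rb/= lerD2l ler_piMl// addrAC subrr add0r.
by rewrite mulfK.
Qed.

Lemma detour_curve_end r : 0 <= r <= 1 ->
  detour_curve (tlen h + beta + r * tlen k) = v + r *: (k - v).
Proof.
move=> /andP[r0 r1]; have [z|z] := eqVneq (r * tlen k) 0.
  have -> : tlen h + beta + r * tlen k = tlen h + 1 * beta by rewrite z addr0 mul1r.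
  rewrite detour_curve_arc ?ler01 ?lexx// sphere_arc1//.
  move/eqP: z; rewrite mulf_eq0 => /orP[/eqP->|/eqP z]; first by rewrite scale0r addr0.
  have /enorm_eq0-> : enorm (k - v) = 0 by rewrite dv.
  by rewrite scaler0 addr0.
have rk : 0 < r * tlen k by rewrite lt_def z mulr_ge0.
have kz : tlen k != 0 by apply: contraNneq z => ->; rewrite mulr0.
rewrite /detour_curve.
have b0' := b0; have tk0' := tk0; rewrite leNgt ifF; last by apply/negbTE/negPn; rewrite ltNge; lra.
rewrite leNgt ifF; last by apply/negbTE/negPn; lra.
congr (_ + _ *: _); rewrite (_ : _ - _ - _ = r * tlen k); last by ring.
by rewrite mulfK.
Qed.

Let ratio (T s : R) : 0 <= T -> 0 <= s <= T -> exists2 r, 0 <= r <= 1 & s = r * T.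
Proof.
move=> T0 /andP[s0 sT]; have [z|z] := eqVneq T 0.
  by exists 0; rewrite ?lexx ?ler01// mul0r; apply/eqP; rewrite eq_le s0 -z sT.
have Tp : 0 < T by rewrite lt_def z.
by exists (s / T); rewrite ?divfK// divr_ge0//= ler_pdivrMr// mul1r.
Qed.

Lemma detour_curve_cases s : 0 <= s <= L -> exists2 r, 0 <= r <= 1 &
  [\/ s = r * tlen h, s = tlen h + r * beta | s = tlen h + beta + r * tlen k].
Proof.
have [th0' tk0' b0'] := And3 th0 tk0 b0; rewrite LE => sI.
have [sh|hs] := lerP s (tlen h).
  have [|r r01 E] := ratio th0 (_ : 0 <= s <= tlen h); first by lra.
  by exists r => //; exact: Or31.
have [sb|bs] := lerP s (tlen h + beta).
  have [|r r01 E] := ratio b0 (_ : 0 <= s - tlen h <= beta); first by lra.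
  by exists r => //; apply: Or32; rewrite -E; ring.
have [|r r01 E] := ratio tk0 (_ : 0 <= s - tlen h - beta <= tlen k); first by lra.
by exists r => //; apply: Or33; rewrite -E; ring.
Qed.

(** A tangent segment lies in the hyperplane touching the sphere at its point of contact, and that
    hyperplane avoids the open ball. *)
Lemma detour_curve_outside s : 0 <= s <= L -> 1 <= enorm (detour_curve s).
Proof.
move=> /detour_curve_cases[r r01 [->|->|->]].
- rewrite detour_curve_start//; apply: le_trans (_ : dot (h + r *: (u - h)) u <= _).
    by rewrite !dotE hu -enorm2 u1; lra.
  by apply: le_trans (cauchy_schwarz _ _) _; rewrite u1 mulr1.
- by rewrite detour_curve_arc// enorm_sphere_arc.
- rewrite detour_curve_end//; apply: le_trans (_ : dot (v + r *: (k - v)) v <= _).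
    by rewrite !dotE kv -enorm2 v1; lra.
  by apply: le_trans (cauchy_schwarz _ _) _; rewrite v1 mulr1.
Qed.

Let segment (p d : V) r r' : r <= r' ->
  enorm (p + r *: d - (p + r' *: d)) = (r' - r) * enorm d.
Proof.
move=> rr; rewrite opprD addrACA subrr add0r -scalerBl enormZ distrC ger0_norm//.
by rewrite subr_ge0.
Qed.

Let param_le (T r r' : R) : 0 <= T -> 0 <= r' -> r * T <= r' * T ->
  r <= r' \/ T = 0.
Proof.
move=> T0 r0 le; have [->|z] := eqVneq T 0; [by right|left].
by rewrite -(ler_pM2r (_ : 0 < T))// lt_def z.
Qed.

Lemma detour_curve_lipschitz s t : 0 <= s -> s <= t -> t <= L ->
  enorm (detour_curve s - detour_curve t) <= t - s.
Proof.
move=> s0 st tL; have [th0' tk0' b0'] := And3 th0 tk0 b0.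
have on_start s' t' : 0 <= s' -> s' <= t' -> t' <= tlen h ->
    enorm (detour_curve s' - detour_curve t') <= t' - s'.
  move=> s'0 st' t'h.
  have [|r r01 Er] := ratio th0 (_ : 0 <= s' <= tlen h); first by lra.
  have [|r' r01' Er'] := ratio th0 (_ : 0 <= t' <= tlen h); first by lra.
  have [||rr|z] := @param_le (tlen h) r r' th0; [lra|by rewrite -Er -Er'| |].
    by rewrite Er Er' !detour_curve_start// segment// du; lra.
  by rewrite Er Er' z !mulr0 subrr enorm0 subrr.
have on_arc s' t' : tlen h <= s' -> s' <= t' -> t' <= tlen h + beta ->
    enorm (detour_curve s' - detour_curve t') <= t' - s'.
  move=> s'0 st' t'h.
  have [|r r01 Er] := ratio b0 (_ : 0 <= s' - tlen h <= beta); first by lra.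
  have [|r' r01' Er'] := ratio b0 (_ : 0 <= t' - tlen h <= beta); first by lra.
  have -> : s' = tlen h + r * beta by rewrite -Er; ring.
  have -> : t' = tlen h + r' * beta by rewrite -Er'; ring.
  have [||rr|z] := @param_le beta r r' b0; [lra|by rewrite -Er -Er'; lra| |].
    rewrite !detour_curve_arc// edistC.
    apply: le_trans (chord_sphere_arc u1 v1 uv_pi _ rr _) _; [lra|lra|].
    by rewrite -/beta; lra.
  by rewrite z !mulr0 subrr enorm0 subrr.
have on_end s' t' : tlen h + beta <= s' -> s' <= t' -> t' <= L ->
    enorm (detour_curve s' - detour_curve t') <= t' - s'.
  rewrite LE => s'0 st' t'h.
  have [|r r01 Er] := ratio tk0 (_ : 0 <= s' - tlen h - beta <= tlen k); first by lra.
  have [|r' r01' Er'] := ratio tk0 (_ : 0 <= t' - tlen h - beta <= tlen k); first by lra.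
  have -> : s' = tlen h + beta + r * tlen k by rewrite -Er; ring.
  have -> : t' = tlen h + beta + r' * tlen k by rewrite -Er'; ring.
  have [||rr|z] := @param_le (tlen k) r r' tk0; [lra|by rewrite -Er -Er'; lra| |].
    by rewrite !detour_curve_end// segment// dv; lra.
  by rewrite z !mulr0 subrr enorm0 subrr.
have glue m s' t' :
    enorm (detour_curve s' - detour_curve m) <= m - s' ->
    enorm (detour_curve m - detour_curve t') <= t' - m ->
    enorm (detour_curve s' - detour_curve t') <= t' - s'.
  by move=> A B; apply: le_trans (ler_edistD (detour_curve m) _ _) _; lra.
have [th|ht] := lerP t (tlen h); first exact: on_start.
have [tb|bt] := lerP t (tlen h + beta).
  have [sh|hs] := lerP s (tlen h); last by apply: on_arc => //; exact: ltW.
  by apply: (glue (tlen h)); [exact: on_start|apply: on_arc => //; exact: ltW].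
have [sb|bs] := lerP s (tlen h + beta); last by apply: on_end => //; exact: ltW.
apply: (glue (tlen h + beta)); last by apply: on_end => //; exact: ltW.
have [sh|hs] := lerP s (tlen h); last by apply: on_arc => //; exact: ltW.
by apply: (glue (tlen h)); [exact: on_start|apply: on_arc => //; lra].
Qed.

End Curve.

Section Paths.
Variables (P Q : E) (u v : V).
Let h := hdiff P.
Let k := hdiff Q.
Hypotheses (h1 : 1 <= enorm h) (k1 : 1 <= enorm k).
Hypothesis uv_tangent : tangent_pair h k u v.
Hypotheses (uv_arc : angle u v = arc_angle h k) (uv_pi : angle u v < pi).
Let L := detour h k.

Definition detour_path (s : R) : E :=
  let m := mid P + s *: (mid Q - mid P) in
  let c := detour_curve h k u v (s * detour h k) in
  (m - c, m + c).

Let LE : L = tlen h + angle u v + tlen k.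
Proof. by rewrite /L /detour -uv_arc addrAC. Qed.

Let L0 : 0 <= L.
Proof. by rewrite LE !addr_ge0 ?tlen_ge0 ?angle_ge0. Qed.

Let sL s : 0 <= s <= 1 -> 0 <= s * L <= L.
Proof. by move=> /andP[s0 s1]; rewrite mulr_ge0//= ler_piMl. Qed.

(** The speeds of [hdiff] and [mid] are at most L and the distance of the end midpoints; the product
    metric combines them to exactly the lower bound of all lengths. *)
Lemma detour_path_lipschitz : lipschitz01 detour_path (detour_length P Q).
Proof.
move=> s t s0 st t1.
have D0 : 0 <= detour_length P Q by rewrite mulr_ge0 ?sqrtr_ge0.
rewrite -ler_sqr ?nnegrE ?edist2_ge0 ?mulr_ge0 ?subr_ge0//.
rewrite edist2E !mid_pair !hdiff_pair.
have := @detour_curve_lipschitz h k u v h1 k1 uv_tangent uv_arc uv_pi (s * L) (t * L).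
have /andP[sL0 _] := @sL s ltac:(lra); have /andP[_ tL1] := @sL t ltac:(lra).
move=> /(_ sL0 (ler_wpM2r L0 st) tL1); rewrite -mulrBl.
set x := enorm _ => xle.
have x2 : x ^+ 2 <= ((t - s) * L) ^+ 2.
  by rewrite ler_sqr ?nnegrE ?enorm_ge0// mulr_ge0// subr_ge0.
have -> : mid P + s *: (mid Q - mid P) - (mid P + t *: (mid Q - mid P))
        = (s - t) *: (mid Q - mid P).
  by rewrite opprD addrACA subrr add0r -scalerBl.
have D2 : detour_length P Q ^+ 2 = 2 * (L ^+ 2 + enorm (mid Q - mid P) ^+ 2).
  rewrite /detour_length exprMn [X in X * _ = _]sqr_sqrtr//.
  by rewrite [X in _ * X = _]sqr_sqrtr// addr_ge0 ?sqr_ge0.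
rewrite enormZ exprMn real_normK ?num_real// [leRHS]exprMn D2.
rewrite exprMn in x2; move: (enorm (mid Q - _)) x2 => m x2; lra.
Qed.

Lemma detour_path_eq s c : 0 <= s <= 1 ->
  detour_curve h k u v (s * L) = c -> forall e : E,
  mid e = mid P + s *: (mid Q - mid P) -> hdiff e = c -> e = detour_path s.
Proof.
by move=> sI E e me he; apply: mid_hdiff_inj; rewrite ?mid_pair ?hdiff_pair// he -E.
Qed.

Lemma detour_path0 : detour_path 0 = P.
Proof.
have zI : 0 <= (0 : R) <= 1 by rewrite lexx ler01.
apply/esym/(@detour_path_eq 0 h zI) => //; last by rewrite scale0r addr0.
rewrite mul0r -(mul0r (tlen h)) detour_curve_start//.
by rewrite scale0r addr0.
Qed.

Lemma detour_path1 : detour_path 1 = Q.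
Proof.
have oI : 0 <= (1 : R) <= 1 by rewrite lexx ler01.
apply/esym/(@detour_path_eq 1 k oI) => //; last by rewrite scale1r addrC subrK.
rewrite mul1r LE -[tlen k]mul1r detour_curve_end//.
by rewrite scale1r addrC subrK.
Qed.

Lemma detour_path_F0 s : 0 <= s <= 1 -> F0 (detour_path s).
Proof.
move=> /sL sI; apply/F0P; rewrite hdiff_pair.
exact: detour_curve_outside.
Qed.

Let beta0 : 0 <= arc_angle h k. Proof. by rewrite -uv_arc angle_ge0. Qed.

Lemma detour_length_min g : is_path F0 P Q g ->
  ((detour_length P Q)%:E <= path_length g)%E.
Proof. by move=> gP; exact: path_length_ge_detour gP beta0. Qed.

Lemma detour_path_geodesic g phi : reparam phi ->
  (forall t, 0 <= t <= 1 -> g t = detour_path (phi t)) -> geodesic F0 P Q g.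
Proof.
move=> phiR gE; apply: lipschitz01_geodesic detour_path_lipschitz _ _ _ phiR gE _.
- exact: detour_path0.
- exact: detour_path1.
- exact: detour_path_F0.
- exact: detour_length_min.
Qed.

Lemma detour_path_length_le :
  (path_length detour_path <= (detour_length P Q)%:E)%E.
Proof.
exact: lipschitz01_path_length detour_path_lipschitz reparam_id (fun _ _ => erefl).
Qed.

End Paths.

(* The parameters on the shortest curve of the end points C0 and C1 of its arc,
   whose midpoints are the points x and y of the statement. *)
Definition start_ratio (h k : V) : R := tlen h / detour h k.
Definition end_ratio (h k : V) : R := (tlen h + arc_angle h k) / detour h k.

Definition detour_point (P Q : E) (s : R) : V := mid P + s *: (mid Q - mid P).

(** The given pair u, v only supplies a competitor that attains the lower bound. The geodesic may
    follow another pair, as it can for opposite h and k. *)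
Lemma geodesic_detour (P Q : E) g (u v : V) :
  1 <= enorm (hdiff P) -> 1 <= enorm (hdiff Q) ->
  tangent_pair (hdiff P) (hdiff Q) u v ->
  angle u v = arc_angle (hdiff P) (hdiff Q) -> angle u v < pi ->
  geodesic F0 P Q g -> exists u' v',
  [/\ tangent_pair (hdiff P) (hdiff Q) u' v',
      angle u' v' = arc_angle (hdiff P) (hdiff Q) &
      exists2 phi, reparam phi &
        forall t, 0 <= t <= 1 -> g t = detour_path P Q u' v' (phi t)].
Proof.
move=> h1 k1 uvt uva uvp [gP gmin].
have cP := lipschitz01_is_path (detour_path_lipschitz h1 k1 uvt uva uvp)
  (detour_path0 h1 uvt) (detour_path1 h1 k1 uvt uva uvp)
  (detour_path_F0 h1 k1 uvt uva uvp) reparam_id (fun _ _ => erefl).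
have gK := le_trans (gmin _ cP) (detour_path_length_le h1 k1 uvt uva uvp).
have b0 : 0 <= arc_angle (hdiff P) (hdiff Q) by rewrite -uva angle_ge0.
have bpi : arc_angle (hdiff P) (hdiff Q) < pi by rewrite -uva.
have [u' [v' [uvt' uva' H]]] := detour_rigid gP b0 gK bpi.
have uvp' : angle u' v' < pi by rewrite uva'.
exists u', v'; split => //.
apply: (minimal_factor (detour_path_lipschitz h1 k1 uvt' uva' uvp')
  (detour_path0 h1 uvt') (detour_path1 h1 k1 uvt' uva' uvp')
  (detour_path_F0 h1 k1 uvt' uva' uvp') _ gP gK) => [g' g'P|t tI].
  exact (detour_length_min uva' g'P).
have [tau [tauI m le [r r01 D]]] := H t tI.
exists tau; split => //; case: D => -[EL E].
- by apply: (detour_path_eq tauI _ m E); rewrite EL detour_curve_start.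
- by apply: (detour_path_eq tauI _ m E); rewrite EL -uva' detour_curve_arc.
- by apply: (detour_path_eq tauI _ m E); rewrite EL -uva' detour_curve_end.
Qed.

End DetourCurve.

(** * Tangent pairs *)

Section TangentPairs.
Context {R : realType} {n : nat}.
Local Notation V := 'rV[R]_n.
Implicit Types (h k u v w : V).

Lemma chord_le_angle u v u' v' : enorm u = 1 -> enorm v = 1 -> enorm u' = 1 ->
  enorm v' = 1 -> (enorm (u - v) <= enorm (u' - v')) = (angle u v <= angle u' v').
Proof.
move=> u1 v1 u1' v1'; rewrite -ler_sqr ?nnegrE ?enorm_ge0//.
have E (p q : V) : enorm p = 1 -> enorm q = 1 ->
    enorm (p - q) ^+ 2 = 2 - 2 * cos (angle p q).
  move=> p1 q1; rewrite enorm2 !dotE (dotC q p) -!enorm2 dot_angle p1 q1; ring.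
by rewrite !E// lerD2l lerN2 ler_pM2l// ler_cos_pi// angleI.
Qed.

(** A single pair attaining the lower bound [arc_angle h k] suffices to recognize all minimal
    pairs. *)
Lemma min_tangent_pair_angle h k u0 v0 : 1 <= enorm h -> 1 <= enorm k ->
  tangent_pair h k u0 v0 -> angle u0 v0 = arc_angle h k -> forall u v,
  min_tangent_pair h k u v <-> tangent_pair h k u v /\ angle u v = arc_angle h k.
Proof.
move=> h1 k1 uv0 a0 u v; have [u01 v01 _ _] := uv0; split=> [[uv min]|[uv a]].
  have [u1 v1 _ _] := uv; split => //; apply/eqP; rewrite eq_le.
  by rewrite -{1}a0 -chord_le_angle// min//= tangent_angle_ge.
have [u1 v1 _ _] := uv; split => // u' v' uv'; have [u1' v1' _ _] := uv'.
by rewrite chord_le_angle// a tangent_angle_ge.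
Qed.

Let unit_of h : V := (enorm h)^-1 *: h.

Let angle_unit_l h u : 1 <= enorm h -> angle (unit_of h) u = angle h u.
Proof. by move=> h1; rewrite angleZl// invr_gt0 (lt_le_trans ltr01). Qed.

Let angle_unit_r h u : 1 <= enorm h -> angle u (unit_of h) = angle u h.
Proof. by move=> h1; rewrite angleC angle_unit_l// angleC. Qed.

Let norm_unit h : 1 <= enorm h -> enorm (unit_of h) = 1.
Proof. by move=> h1; rewrite angle_normalize// (lt_le_trans ltr01). Qed.

Let tangent_of_angle h u : 1 <= enorm h -> enorm u = 1 -> angle h u = topen h ->
  dot h u = 1.
Proof. by move=> h1 u1 a; rewrite dot_angle u1 a mulr1 cos_topen. Qed.

Section Planar.
Variables h k : V.
Hypotheses (h1 : 1 <= enorm h) (k1 : 1 <= enorm k).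
Hypotheses (hk_pi : angle h k < pi) (beta0 : 0 <= arc_angle h k).

(** On the great circle arc from the direction of h to that of k, the points at the angles [topen h]
    from its start and [topen k] from its end. *)
Definition planar_start : V :=
  sphere_arc (unit_of h) (unit_of k) (topen h / angle h k).
Definition planar_end : V :=
  sphere_arc (unit_of h) (unit_of k) ((angle h k - topen k) / angle h k).

Let th0 : 0 <= topen h. Proof. by case/andP: (topenI h1). Qed.
Let tk0 : 0 <= topen k. Proof. by case/andP: (topenI k1). Qed.

Lemma planar_tangent_pair :
  tangent_pair h k planar_start planar_end
  /\ angle planar_start planar_end = arc_angle h k.
Proof.
have hk1 := norm_unit h1; have kh1 := norm_unit k1.
have a : angle (unit_of h) (unit_of k) = angle h k.
  by rewrite angle_unit_l// angle_unit_r.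
have api : angle (unit_of h) (unit_of k) < pi by rewrite a.
have b0 := beta0; rewrite /arc_angle in b0.
have [th0' tk0'] := conj th0 tk0.
have ratio (x : R) : 0 <= x <= angle h k -> exists s,
    [/\ s = x / angle h k, 0 <= s <= 1 & s * angle h k = x].
  move=> xI; exists (x / angle h k); split => //.
    have [->|z] := eqVneq (angle h k) 0; first by rewrite invr0 mulr0 lexx ler01.
    have zp : 0 < angle h k by rewrite lt_def z angle_ge0.
    by rewrite divr_ge0 ?angle_ge0//= ?ler_pdivrMr// ?mul1r//; case/andP: xI.
  have [z|z] := eqVneq (angle h k) 0; last by rewrite divfK.
  by rewrite z mulr0; apply/eqP; rewrite eq_le -z; lra.
have [|s [sE sI sa]] := ratio (topen h); first by lra.
have [|t [tE tI ta]] := ratio (angle h k - topen k); first by lra.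
rewrite /planar_start /planar_end -sE -tE.
have u1 := enorm_sphere_arc hk1 kh1 api s; have v1 := enorm_sphere_arc hk1 kh1 api t.
have [s0 s1] := andP sI; have [t0 t1] := andP tI.
have hu : angle h (sphere_arc (unit_of h) (unit_of k) s) = topen h.
  rewrite -angle_unit_l// -{1}(sphere_arc0 api) angle_sphere_arc//.
  by rewrite subr0 a.
have kv : angle k (sphere_arc (unit_of h) (unit_of k) t) = topen k.
  rewrite -angle_unit_l// angleC -{2}(sphere_arc1 hk1 kh1 api) angle_sphere_arc//.
  by rewrite a mulrBl ta mul1r; ring.
have tp : tangent_pair h k (sphere_arc (unit_of h) (unit_of k) s)
    (sphere_arc (unit_of h) (unit_of k) t).
  by split => //; apply: tangent_of_angle.
split => //; apply/eqP; rewrite eq_le tangent_angle_ge// andbT.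
have [st|ts] := leP s t.
  by rewrite angle_sphere_arc// a mulrBl sa ta /arc_angle; lra.
by rewrite angleC angle_sphere_arc ?(ltW ts)// a mulrBl sa ta /arc_angle; lra.
Qed.

(** Minimality makes the triangle inequalities for h, u, k and for h, v, k equalities, and
    [angle h k < pi] then places u and v on the arc from h to k. *)
Lemma planar_tangent_pair_unique u v : tangent_pair h k u v ->
  angle u v = arc_angle h k -> u = planar_start /\ v = planar_end.
Proof.
move=> [u1 v1 hu kv] uv.
have au := tangent_angle h1 u1 hu; have av := tangent_angle k1 v1 kv.
have h0 : 0 < enorm h by rewrite (lt_le_trans ltr01).
have k0 : 0 < enorm k by rewrite (lt_le_trans ltr01).
have u0 : 0 < enorm u by rewrite u1.
have v0 : 0 < enorm v by rewrite v1.
have T1 := angle_triangle u0 v0 k0; have T2 := angle_triangle h0 u0 v0.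
have T3 := angle_triangle h0 v0 k0.
rewrite (angleC v k) av uv /arc_angle in T1 T3; rewrite au uv /arc_angle in T2.
have hk1 := norm_unit h1; have kh1 := norm_unit k1.
have api : angle (unit_of h) (unit_of k) < pi.
  by rewrite angle_unit_l// angle_unit_r.
split.
  rewrite [LHS](@angle_triangle_eq _ _ (unit_of h) u (unit_of k))//.
    by rewrite angle_unit_l// angle_unit_r// angle_unit_l// au.
  by rewrite angle_unit_l// angle_unit_r// angle_unit_l// angle_unit_r// au; lra.
rewrite [LHS](@angle_triangle_eq _ _ (unit_of h) v (unit_of k))//.
  rewrite angle_unit_l// angle_unit_r// angle_unit_l//.
  by have -> : angle h v = angle h k - topen k by lra.
by rewrite angle_unit_l// angle_unit_r// angle_unit_l// angle_unit_r// (angleC v k) av; lra.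
Qed.

End Planar.

Lemma angle_pi_opposite h k : 1 <= enorm h -> angle h k = pi ->
  exists c : R, c < 0 /\ k = c *: h.
Proof.
move=> h1 a; have h0 : 0 < enorm h by rewrite (lt_le_trans ltr01).
have k0 : 0 < enorm k.
  rewrite lt_def enorm_ge0 andbT; apply/eqP => /enorm_eq0 k0.
  have := cos_angle h k; rewrite a cospi k0 dotC dot0l mul0r; lra.
exists (- (enorm k / enorm h)); split; first by rewrite oppr_lt0 divr_gt0.
have E : enorm h *: k + enorm k *: h = 0.
  apply: dotvv_eq0; rewrite !dotE (dotC k h) -!enorm2 dot_angle a cospi; ring.
move/eqP: E; rewrite addr_eq0 => /eqP E.
have : (enorm h)^-1 *: (enorm h *: k) = (enorm h)^-1 *: - (enorm k *: h) by rewrite E.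
rewrite scalerA mulVf ?gt_eqF// scale1r => kE; rewrite [LHS]kE.
by rewrite scalerN scalerA scaleNr (mulrC _^-1).
Qed.

Section Opposite.
Variables h k : V.
Hypotheses (h1 : 1 <= enorm h) (k1 : 1 <= enorm k).
Hypothesis hk : exists c : R, c < 0 /\ k = c *: h.

Let h0 : 0 < enorm h. Proof. exact: lt_le_trans h1. Qed.
Let k0 : 0 < enorm k. Proof. exact: lt_le_trans k1. Qed.

Lemma opposite_dot : dot h k = - (enorm h * enorm k).
Proof.
have [c [c0 kE]] := hk; rewrite kE dotZr enormZ ltr0_norm// -enorm2; ring.
Qed.

Lemma opposite_angle : angle h k = pi.
Proof.
apply: angleP => //; first by rewrite pi_ge0 lexx.
by rewrite cospi opposite_dot mulrN1.
Qed.

Lemma opposite_perp w : dot h w = 0 -> dot k w = 0.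
Proof. by have [c [c0 ->]] := hk; rewrite dotZl => ->; rewrite mulr0. Qed.

Lemma opposite_arc_angleI : 0 <= arc_angle h k <= pi.
Proof.
by have := topenI h1; have := topenI k1; rewrite /arc_angle opposite_angle; lra.
Qed.

(** The angle pi occurs only for unit vectors h and k, where u = h and v = k are antipodal, the sine
    in [sphere_arc] vanishes and no arc is singled out. *)
Lemma opposite_arc_angle_lt : 0 < tlen h + tlen k -> arc_angle h k < pi.
Proof.
move=> S; rewrite /arc_angle opposite_angle.
have := topenI h1; have := topenI k1 => kI hI.
have [a|a] := eqVneq (topen h) 0; last first.
  have : 0 < topen h by rewrite lt_def a; case/andP: hI.
  by lra.
have [b|b] := eqVneq (topen k) 0; last first.
  have : 0 < topen k by rewrite lt_def b; case/andP: kI.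
  by lra.
by move: S; rewrite -!sin_topen// a b sin0; lra.
Qed.

Lemma opposite_cos_arc_angle : cos (arc_angle h k) =
  dot h k / (enorm h ^+ 2 * enorm k ^+ 2) + tlen h * tlen k / (enorm h * enorm k).
Proof.
have -> : arc_angle h k = - (topen h + topen k) + pi.
  by rewrite /arc_angle opposite_angle; ring.
rewrite cosDpi cosN cosD opposite_dot -!sin_topen//.
have cV (p : V) : 0 < enorm p -> 1 <= enorm p -> cos (topen p) = (enorm p)^-1.
  by move=> p0 p1; apply: (mulfI (lt0r_neq0 p0)); rewrite cos_topen// divff// lt0r_neq0.
by rewrite !cV//; field; rewrite !lt0r_neq0.
Qed.

(** The points of tangency from h form a sphere with centre h / |h|^2 and radius [tlen h] / |h| in
    the hyperplane orthogonal to h; w is the direction from the centre, common to both end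
    points. *)
Definition opposite_start w : V := (enorm h ^+ 2)^-1 *: h + (tlen h / enorm h) *: w.
Definition opposite_end w : V := (enorm k ^+ 2)^-1 *: k + (tlen k / enorm k) *: w.

Lemma opposite_tangent_pair w : dot h w = 0 -> dot w w = 1 ->
  tangent_pair h k (opposite_start w) (opposite_end w)
  /\ angle (opposite_start w) (opposite_end w) = arc_angle h k.
Proof.
move=> hw ww; have kw := opposite_perp hw.
have norm1 (p : V) : 0 < enorm p -> 1 <= enorm p -> dot p w = 0 ->
    enorm ((enorm p ^+ 2)^-1 *: p + (tlen p / enorm p) *: w) = 1.
  move=> p0 p1 pw; apply: enormP => //.
  rewrite !dotE (dotC w p) pw ww -enorm2 !mulr0 addr0 add0r mulr1.
  have := tlen2 p1; rewrite -enorm2 => t2.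
  transitivity ((1 + tlen p ^+ 2) / enorm p ^+ 2); first by field; rewrite gt_eqF.
  by rewrite t2 addrC subrK divff ?expr1n// sqrf_eq0 gt_eqF.
have dot1 (p : V) : 0 < enorm p -> dot p w = 0 ->
    dot p ((enorm p ^+ 2)^-1 *: p + (tlen p / enorm p) *: w) = 1.
  by move=> p0 pw; rewrite !dotE pw mulr0 addr0 -enorm2 mulVf// sqrf_eq0 gt_eqF.
have tp : tangent_pair h k (opposite_start w) (opposite_end w).
  by split; rewrite ?norm1 ?dot1.
have [u1 v1 _ _] := tp; split => //.
apply: angleP; rewrite ?u1 ?v1 ?opposite_arc_angleI// !mul1r.
rewrite opposite_cos_arc_angle !dotE (dotC w k) hw kw ww.
by field; rewrite !gt_eqF.
Qed.

End Opposite.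

Lemma tangent_perp h u : 1 <= enorm h -> enorm u = 1 -> dot h u = 1 ->
  let w := u - (enorm h ^+ 2)^-1 *: h in
  [/\ dot h w = 0, dot w w = (tlen h / enorm h) ^+ 2 & u = (enorm h ^+ 2)^-1 *: h + w].
Proof.
move=> h1 u1 hu w; have h0 : 0 < enorm h by rewrite (lt_le_trans ltr01).
split; last by rewrite addrC subrK.
  by rewrite /w !dotE hu -enorm2 mulVf ?subrr// sqrf_eq0 gt_eqF.
rewrite /w !dotE (dotC u h) hu -!enorm2 u1 expr_div_n tlen2// -enorm2.
by field; rewrite gt_eqF.
Qed.

Section OppositeForm.
Variables h k : V.
Hypotheses (h1 : 1 <= enorm h) (k1 : 1 <= enorm k).
Hypothesis hk : exists c : R, c < 0 /\ k = c *: h.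

(** The cosine of the prescribed angle makes the dot product of the components p and q orthogonal to
    h equal to |p| |q|, so they have a common direction. It is obtained by normalizing p, whose norm
    is positive with [tlen h]. *)
Lemma opposite_form u v : 0 < tlen h -> tangent_pair h k u v ->
  angle u v = arc_angle h k -> exists w, [/\ dot h w = 0, dot w w = 1,
    u = opposite_start h w & v = opposite_end k w].
Proof.
move=> t0 [u1 v1 hu kv] a; have h0 : 0 < enorm h by rewrite (lt_le_trans ltr01).
have k0 : 0 < enorm k by rewrite (lt_le_trans ltr01).
have [hu' uu uE] := tangent_perp h1 u1 hu; have [kv' vv vE] := tangent_perp k1 v1 kv.
move: (u - _) (v - _) => p q in hu' uu uE kv' vv vE *.
have kp := opposite_perp hk hu'.
have hq : dot h q = 0.
  have [c [c0 kE]] := hk; move: kv'; rewrite kE dotZl => /eqP.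
  by rewrite mulf_eq0 lt_eqF//= => /eqP.
have pq : dot p q = tlen h * tlen k / (enorm h * enorm k).
  have := dot_angle u v; rewrite u1 v1 a opposite_cos_arc_angle// !mul1r uE vE !dotE.
  rewrite (dotC p k) kp hq => E; apply: (addrI (dot h k / (enorm h ^+ 2 * enorm k ^+ 2))).
  by rewrite -E; field; rewrite !gt_eqF.
have tz : tlen h / enorm h != 0 by rewrite gt_eqF// divr_gt0.
exists ((tlen h / enorm h)^-1 *: p); split.
- by rewrite dotZr hu' mulr0.
- by rewrite dotZl dotZr uu expr2 mulKf// mulVf.
- by rewrite /opposite_start scalerA divff// scale1r.
- rewrite vE /opposite_end; congr (_ + _); apply/eqP; rewrite -subr_eq0.
  apply/eqP/dotvv_eq0; rewrite !dotE (dotC q p) uu vv pq.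
  by field; rewrite !gt_eqF.
Qed.

End OppositeForm.

Lemma perp_exists h : (1 < n)%N -> exists w, dot h w = 0 /\ dot w w = 1.
Proof.
move=> n1; suff [w wh w0] : exists2 w, dot h w = 0 & w != 0.
  have z : enorm w != 0 by apply: contraNneq w0 => /enorm_eq0 ->.
  exists ((enorm w)^-1 *: w); rewrite dotZr wh mulr0; split => //.
  by rewrite dotZl dotZr -enorm2 mulrA -invfM -expr2 mulVf// sqrf_eq0.
have : kermx h^T != 0.
  rewrite -mxrank_eq0 mxrank_ker -lt0n subn_gt0.
  by rewrite mxrank_tr (leq_ltn_trans (rank_leq_row h)).
move=> /rowV0Pn[w /sub_kermxP wh w0]; exists w => //.
have /rowP/(_ ord0) := wh; rewrite !mxE => E; rewrite dotC -E.
by apply: eq_bigr => i _; rewrite mxE.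
Qed.

(* If h and k are unit vectors, there may be no vector w as in opposite_form,
   but then u = h and v = k is the only tangent pair. *)
Lemma opposite_min_tangent_pair h k : 1 <= enorm h -> 1 <= enorm k ->
  (exists c : R, c < 0 /\ k = c *: h) -> forall u v, min_tangent_pair h k u v ->
  angle u v = arc_angle h k.
Proof.
move=> h1 k1 hk u v muv; have [uv _] := muv; have [u1 v1 hu kv] := uv.
have h0 : 0 < enorm h by rewrite (lt_le_trans ltr01).
have k0 : 0 < enorm k by rewrite (lt_le_trans ltr01).
(* Any nonzero vector orthogonal to h yields a pair attaining the bound. It will be the orthogonal
   component of u or of v, whichever is nonzero. *)
have from_perp w : dot h w = 0 -> dot w w != 0 -> angle u v = arc_angle h k.
  move=> hw w0; have z : enorm w != 0 by rewrite -sqrf_eq0 enorm2.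
  have [||uv0 a0] := @opposite_tangent_pair h k h1 k1 hk ((enorm w)^-1 *: w).
  - by rewrite dotZr hw mulr0.
  - by rewrite dotZl dotZr -enorm2 mulrA -invfM -expr2 mulVf// sqrf_eq0.
  by have /(_ u v)[/(_ muv)[]] := min_tangent_pair_angle h1 k1 uv0 a0.
have [hu' uu _] := tangent_perp h1 u1 hu; have [kv' vv _] := tangent_perp k1 v1 kv.
have [th|th] := eqVneq (tlen h) 0; last first.
  by apply: from_perp hu' _; rewrite uu sqrf_eq0 mulf_neq0// invr_eq0 gt_eqF.
have [tk|tk] := eqVneq (tlen k) 0; last first.
  apply: (from_perp (v - (enorm k ^+ 2)^-1 *: k)); last first.
    by rewrite vv sqrf_eq0 mulf_neq0// invr_eq0 gt_eqF.
  have [c [c0 kE]] := hk; move: kv'; rewrite {1}kE dotZl => /eqP.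
  by rewrite mulf_eq0 lt_eqF//= => /eqP.
have au := tangent_angle h1 u1 hu; have av := tangent_angle k1 v1 kv.
have top0 (p : V) : 1 <= enorm p -> tlen p = 0 -> enorm p = 1.
  move=> p1 tp; apply: enormP => //; have := tlen2 p1; rewrite tp expr0n expr1n/=; lra.
have hE := top0 h h1 th; have kE := top0 k k1 tk.
rewrite /arc_angle !topen_unit// !subr0.
rewrite topen_unit// in au; rewrite topen_unit// in av.
by rewrite (unit_angle0 hE u1 au) (unit_angle0 kE v1 av).
Qed.

End TangentPairs.

(** * The minimal gap and the three pieces *)

Section LinearPaths.
Context {R : realType} {n : nat}.
Local Notation V := 'rV[R]_n.
Local Notation E := (V * V)%type.
Implicit Types (P Q : E) (t : R).

Lemma hdiff_linpath P Q t :
  hdiff (linpath P Q t) = (1 - t) *: hdiff P + t *: hdiff Q.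
Proof. by rewrite /hdiff /linpath/=; apply/rowP => i; rewrite !mxE; ring. Qed.

Lemma mid_linpath P Q t : mid (linpath P Q t) = (1 - t) *: mid P + t *: mid Q.
Proof. by rewrite /mid /linpath/=; apply/rowP => i; rewrite !mxE; ring. Qed.

Lemma linpath0 P Q : linpath P Q 0 = P.
Proof. by rewrite /linpath subr0 scale1r scale0r addr0. Qed.

Lemma linpath1 P Q : linpath P Q 1 = Q.
Proof. by rewrite /linpath subrr scale1r scale0r add0r. Qed.

Lemma row_linpath P Q t :
  row_pair (linpath P Q t) = row_pair P + t *: (row_pair Q - row_pair P).
Proof.
rewrite /linpath row_pairD !row_pairZ scalerBr scalerBl scale1r.
by rewrite -addrA [- _ + _]addrC.
Qed.

Lemma linpath_lipschitz P Q : lipschitz01 (linpath P Q) (edist2 P Q).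
Proof.
move=> s t s0 st t1; rewrite !edist2_row !row_linpath opprD addrACA subrr add0r.
by rewrite -scalerBl enormZ distrC ger0_norm ?subr_ge0// mulrC edistC.
Qed.

Lemma linpath_unique_geodesic P Q : (forall t, 0 <= t <= 1 -> F0 (linpath P Q t)) ->
  unique_geodesic F0 P Q (linpath P Q).
Proof.
move=> F; have Kmin g : is_path F0 P Q g -> ((edist2 P Q)%:E <= path_length g)%E.
  move=> [_ g0 g1 _]; apply: length_ge_path_length.
  by have := length_ge_edist2 g ler01; rewrite g0 g1.
have geo := lipschitz01_geodesic (@linpath_lipschitz P Q) (linpath0 P Q) (linpath1 P Q)
  F reparam_id (fun _ _ => erefl) Kmin.
split => // g [gP gmin]; have [cg g0 g1 gF] := gP.
have gK := le_trans (gmin _ geo.1) (lipschitz01_path_length (@linpath_lipschitz P Q)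
  reparam_id (fun _ _ => erefl)).
have [|phi phiR gE] := minimal_factor (@linpath_lipschitz P Q) (linpath0 P Q)
  (linpath1 P Q) F Kmin gP gK; last first.
  by apply: (same_path_reparam phiR reparam_id gE).
move=> t /andP[t0 t1].
have L1 := length_ge_edist2 g t0; have L2 := length_ge_edist2 g t1.
rewrite g0 in L1; rewrite g1 in L2.
have := le_trans (length_ge_path_length (length_ge_cat L1 L2)) gK.
rewrite lee_fin; rewrite !edist2_row => le; rewrite !edist2_row in L1 L2.
have [|tau tauI [Ea Eb]] := @enormD_eq_param _ _ (row_pair (g t) - row_pair P)
    (row_pair Q - row_pair (g t)).
  rewrite [X in _ <= enorm X]addrC addrA subrK.
  by rewrite (edistC (row_pair (g t))) (edistC (row_pair Q)) (edistC (row_pair Q)).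
have S : row_pair (g t) - row_pair P + (row_pair Q - row_pair (g t)) = row_pair Q - row_pair P.
  by rewrite addrC addrA subrK.
rewrite S in Ea Eb; exists tau; split => //.
  by apply: row_pair_inj; rewrite row_linpath -Ea addrC subrK.
have [tau0 tau1] := andP tauI.
rewrite edistC Ea in L1; rewrite edistC Eb in L2.
rewrite enormZ ger0_norm// in L1; rewrite enormZ ger0_norm ?subr_ge0// in L2.
by rewrite (edistC (row_pair P)) !(mulrC (enorm _)).
Qed.

End LinearPaths.

Section Gap.
Context {R : realType} {n : nat}.
Variables a a' b b' : 'rV[R]_n.
Let h := hdiff (a, a').
Let k := hdiff (b, b').
Hypotheses (h1 : 1 <= enorm h) (k1 : 1 <= enorm k).
Let gap t : R := enorm ((1 - t) *: h + t *: k).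

Lemma min_gapP : exists2 t, 0 <= t <= 1 & min_gap a a' b b' = 2 * gap t /\
  forall s, 0 <= s <= 1 -> gap t <= gap s.
Proof.
have E t : Defs.edist (t *: b + (1 - t) *: a) (t *: b' + (1 - t) *: a') = 2 * gap t.
  have : t *: b + (1 - t) *: a - (t *: b' + (1 - t) *: a')
      = (- 2) *: ((1 - t) *: h + t *: k).
    by rewrite /h /k /hdiff/=; apply/rowP => i; rewrite !mxE; field.
  by rewrite /Defs.edist => ->; rewrite enormZ normrN ger0_norm.
have [t tI [m mle]] := min_gap_attained a a' b b'.
exists t => //; split; first by rewrite m E.
by move=> s sI; have := mle s sI; rewrite !E ler_pM2l.
Qed.

Lemma min_gap_ge2 : 2 <= min_gap a a' b b' <-> forall t, 0 <= t <= 1 -> 1 <= gap t.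
Proof.
have [t tI [-> mle]] := min_gapP; split=> [g2 s sI|H].
  by apply: le_trans (mle s sI); lra.
by have := H t tI; lra.
Qed.

Lemma min_gap_eq0 : min_gap a a' b b' = 0 <-> exists c : R, c < 0 /\ k = c *: h.
Proof.
have [t tI [-> mle]] := min_gapP; split.
  move=> /eqP; rewrite mulf_eq0 pnatr_eq0/= => /eqP/enorm_eq0 z.
  have t0 : t != 0.
    apply/eqP => t0; move: z; rewrite t0 subr0 scale1r scale0r addr0 => z.
    by move: h1; rewrite z enorm0 ler10.
  have t1 : t != 1.
    apply/eqP => t1; move: z; rewrite t1 subrr scale1r scale0r add0r => z.
    by move: k1; rewrite z enorm0 ler10.
  have tp : 0 < t by rewrite lt_def t0; case/andP: tI.
  have tlt : t < 1 by rewrite lt_def eq_sym t1; case/andP: tI.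
  exists (- ((1 - t) / t)); split; first by rewrite oppr_lt0 divr_gt0// subr_gt0.
  apply: (scalerI t0); rewrite [RHS]scalerA mulrN mulrCA divff// mulr1 scaleNr.
  by apply/eqP; rewrite -addr_eq0 addrC z.
move=> [c [c0 kE]].
have cp : 0 < 1 - c by lra.
(* The parameter at which the segment from h to c h passes through the origin. *)
have sI : 0 <= (1 - c)^-1 <= 1 by rewrite invr_ge0 (ltW cp)/= invf_le1//; lra.
have : gap t <= gap (1 - c)^-1 by exact: mle.
have -> : gap (1 - c)^-1 = 0.
  rewrite /gap kE (scalerA _ c) -scalerDl (_ : _ + _ = 0) ?scale0r ?enorm0//.
  by field; rewrite gt_eqF.
have : 0 <= gap t by exact: enorm_ge0.
lra.
Qed.

Lemma min_gap_gt0_angle : 0 < min_gap a a' b b' -> angle h k < pi.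
Proof.
rewrite !lt_def angle_lepi andbT => /andP[/eqP g0 _]; apply/eqP => E.
by apply/g0/min_gap_eq0; exact: angle_pi_opposite.
Qed.

Let dot_comb (p q w : 'rV[R]_n) (s t : R) :
  dot (s *: p + t *: q) w = s * dot p w + t * dot q w.
Proof. by rewrite dotDl !dotZl. Qed.

(** If h is the unit vector, the segment from h to k stays in the half-space of vectors with dot
    product at least 1 with h; likewise for k. *)
Lemma transversal_min_gap : transversal_end h k -> 2 <= min_gap a a' b b'.
Proof.
move=> [hk end1]; apply/min_gap_ge2 => t tI.
case: end1 => E.
  apply: le_trans (_ : dot ((1 - t) *: h + t *: k) h <= _).
    by rewrite dot_comb (dotC k h) -enorm2 E; nra.
  by apply: le_trans (cauchy_schwarz _ _) _; rewrite E mulr1.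
apply: le_trans (_ : dot ((1 - t) *: h + t *: k) k <= _).
  by rewrite dot_comb -enorm2 E; nra.
by apply: le_trans (cauchy_schwarz _ _) _; rewrite E mulr1.
Qed.

(* Otherwise the squared norm on the segment from h to k is at least
   1 + ((1 - t) S0 - t S1)^2, strictly in the interior. *)
Lemma min_gap_le2_arc_angle : min_gap a a' b b' <= 2 -> ~ transversal_end h k ->
  0 <= arc_angle h k.
Proof.
move=> g2 ntr; suff : topen h + topen k <= angle h k by rewrite /arc_angle; lra.
rewrite topen_le_angle// leNgt; apply/negP => vis; apply: ntr.
have [t tI [gE _]] := min_gapP.
have : gap t ^+ 2 <= 1 by have := enorm_ge0 ((1 - t) *: h + t *: k); rewrite -/(gap t); nra.
rewrite /gap enorm2.
have -> : dot ((1 - t) *: h + t *: k) ((1 - t) *: h + t *: k)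
    = (1 - t) ^+ 2 * dot h h + 2 * t * (1 - t) * dot h k + t ^+ 2 * dot k k.
  by move: h k => p q; rewrite !dotE (dotC q p); ring.
have hh := tlen2 h1; have kk := tlen2 k1.
have th := tlen_ge0 h; have tk := tlen_ge0 k.
move=> le; have sq := sqr_ge0 ((1 - t) * tlen h - t * tlen k).
have mixed : t * (1 - t) * (dot h k + tlen h * tlen k - 1) <= 0.
  have -> : t * (1 - t) * (dot h k + tlen h * tlen k - 1) =
    ((1 - t) ^+ 2 * dot h h + 2 * t * (1 - t) * dot h k + t ^+ 2 * dot k k - 1
     - ((1 - t) * tlen h - t * tlen k) ^+ 2
     - (1 - t) ^+ 2 * (dot h h - 1 - tlen h ^+ 2)
     - t ^+ 2 * (dot k k - 1 - tlen k ^+ 2)) / 2 by field.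
  by rewrite hh kk !subrr !mulr0 !subr0 pmulr_lle0 ?invr_gt0//; lra.
have [t0|t0] := eqVneq t 0.
  have th0 : tlen h = 0.
    move: le; rewrite t0 !expr0n/= !(mulr0, mul0r, subr0, addr0, expr1n, mul1r) => le.
    by apply/eqP; rewrite -sqrf_eq0 eq_le sqr_ge0 hh; lra.
  split; first by move: vis; rewrite th0 mul0r addr0.
  by left; apply: enormP => //; rewrite expr1n; move: hh; rewrite th0 expr0n/=; lra.
have [t1|t1] := eqVneq t 1.
  have tk0 : tlen k = 0.
    move: le; rewrite t1 subrr !expr0n/= !(mulr0, mul0r, add0r, expr1n, mul1r) => le.
    by apply/eqP; rewrite -sqrf_eq0 eq_le sqr_ge0 kk; lra.
  split; first by move: vis; rewrite tk0 mulr0 addr0.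
  by right; apply: enormP => //; rewrite expr1n; move: kk; rewrite tk0 expr0n/=; lra.
have tp : 0 < t by rewrite lt_def t0; case/andP: tI.
have tlt : t < 1 by rewrite lt_def eq_sym t1; case/andP: tI.
exfalso; move: mixed; rewrite pmulr_rle0; last by rewrite mulr_gt0// subr_gt0.
by lra.
Qed.

End Gap.

Section ThreePieces.
Context {R : realType} {n : nat}.
Local Notation V := 'rV[R]_n.
Local Notation E := (V * V)%type.

Lemma join_path (c g1 g2 : R -> E) (f1 f2 : R -> R) :
  (forall t, 0 <= t <= 1 -> g1 t = c (f1 t)) ->
  (forall t, 0 <= t <= 1 -> g2 t = c (f2 t)) ->
  forall t, 0 <= t <= 1 -> path_comp g1 g2 t = c (join f1 f2 t).
Proof.
move=> E1 E2 t tI; rewrite /path_comp /join; case: ifPn => t2.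
  by rewrite E1//; lra.
by rewrite -ltNge in t2; rewrite E2//; lra.
Qed.

Variables (P Q : E) (u v : V).
Let h := hdiff P.
Let k := hdiff Q.
Hypotheses (h1 : 1 <= enorm h) (k1 : 1 <= enorm k).
Hypothesis uv_tangent : tangent_pair h k u v.
Hypotheses (uv_arc : angle u v = arc_angle h k) (uv_pi : angle u v < pi).
Let L := detour h k.
Let sr := start_ratio h k.
Let er := end_ratio h k.
Let x := detour_point P Q sr.
Let y := detour_point P Q er.

Let LE : L = tlen h + angle u v + tlen k.
Proof. by rewrite /L /detour -uv_arc addrAC. Qed.

Let facts : [/\ 0 <= tlen h, 0 <= tlen k & 0 <= angle u v].
Proof. by rewrite !tlen_ge0 angle_ge0. Qed.

Let L0 : 0 <= L. Proof. by have [] := facts; rewrite LE; lra. Qed.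

Let srL : sr * L = tlen h.
Proof.
have [th tk b] := facts; have := L0; rewrite /sr /start_ratio -/L => L0'.
have [z|z] := eqVneq L 0; last by rewrite divfK.
by rewrite z mulr0; move: LE; lra.
Qed.

Let erL : er * L = tlen h + angle u v.
Proof.
have [th tk b] := facts; have := L0; rewrite /er /end_ratio -/L -uv_arc => L0'.
have [z|z] := eqVneq L 0; last by rewrite divfK.
by rewrite z mulr0; move: LE; lra.
Qed.

Let ratios : [/\ 0 <= sr, sr <= er & er <= 1].
Proof.
have [th tk b] := facts; have := L0; rewrite le_eqVlt => /orP[/eqP z|Lp].
  by rewrite /sr /er /start_ratio /end_ratio -/L -z invr0 !mulr0.
split; first by rewrite divr_ge0// ltW.
  by rewrite -(ler_pM2r Lp) srL erL; lra.
by rewrite -(ler_pM2r Lp) erL mul1r LE; lra.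
Qed.

Let affineI (s t r : R) : 0 <= s -> s <= t -> t <= 1 -> 0 <= r <= 1 ->
  0 <= affine s t r <= 1.
Proof. by move=> s0 st t1 rI; rewrite /affine; nra. Qed.

Let affineM (s t r c : R) : affine s t r * c = s * c + r * (t * c - s * c).
Proof. by rewrite /affine; ring. Qed.

Let point_affine (s t r : R) :
  (1 - r) *: detour_point P Q s + r *: detour_point P Q t
  = mid P + affine s t r *: (mid Q - mid P).
Proof.
by rewrite /detour_point /affine; apply/rowP => i; rewrite !mxE; ring.
Qed.

Let point0 : mid P = detour_point P Q 0.
Proof. by rewrite /detour_point scale0r addr0. Qed.

Let point1 : mid Q = detour_point P Q 1.
Proof. by rewrite /detour_point scale1r addrC subrK. Qed.

Lemma start_piece r : 0 <= r <= 1 ->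
  linpath P (x - u, x + u) r = detour_path P Q u v (affine 0 sr r).
Proof.
have [sr0 srer er1] := ratios; move=> rI.
have sI : 0 <= affine 0 sr r <= 1 by apply: affineI => //; exact: le_trans er1.
apply: (@detour_path_eq _ _ P Q u v (affine 0 sr r) (h + r *: (u - h)) sI).
- have -> : affine 0 sr r * L = r * tlen h by rewrite affineM srL; ring.
  by rewrite detour_curve_start.
- by rewrite mid_linpath mid_pair {1}point0 point_affine.
- by rewrite hdiff_linpath hdiff_pair -/h scalerBr scalerBl scale1r -addrA [- _ + _]addrC.
Qed.

Lemma arc_piece r : 0 <= r <= 1 ->
  sigma x u y v r = detour_path P Q u v (affine sr er r).
Proof.
have [sr0 srer er1] := ratios; move=> rI.
have sI : 0 <= affine sr er r <= 1 by exact: affineI.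
apply: (@detour_path_eq _ _ P Q u v (affine sr er r) (sphere_arc u v r) sI).
- have -> : affine sr er r * L = tlen h + r * angle u v.
    by rewrite affineM srL erL; ring.
  by rewrite detour_curve_arc.
- by rewrite mid_pair point_affine.
- by rewrite hdiff_pair.
Qed.

Lemma end_piece r : 0 <= r <= 1 ->
  linpath (y - v, y + v) Q r = detour_path P Q u v (affine er 1 r).
Proof.
have [sr0 srer er1] := ratios; move=> rI.
have sI : 0 <= affine er 1 r <= 1 by apply: affineI => //; exact: le_trans srer.
apply: (@detour_path_eq _ _ P Q u v (affine er 1 r) (v + r *: (k - v)) sI).
- have -> : affine er 1 r * L = tlen h + angle u v + r * tlen k.
    by rewrite affineM erL mul1r LE; ring.
  by rewrite detour_curve_end.
- by rewrite mid_linpath mid_pair {1}point1 point_affine.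
- by rewrite hdiff_linpath hdiff_pair -/k scalerBr scalerBl scale1r -addrA [- _ + _]addrC.
Qed.

Let aff (s t : R) C : s <= t -> t - s <= C -> nondecreasing_lipschitz (affine s t) C.
Proof. exact: nondecreasing_lipschitz_affine. Qed.

Lemma three_piece_reparam : exists2 phi, reparam phi &
  forall t, 0 <= t <= 1 -> three_piece P Q x u y v t = detour_path P Q u v (phi t).
Proof.
have [sr0 srer er1] := ratios.
exists (join (affine 0 sr) (join (affine sr er) (affine er 1))); last first.
  apply: join_path; first exact: start_piece.
  by apply: join_path; [exact: arc_piece|exact: end_piece].
apply: (@nondecreasing_lipschitz_reparam _ _ (2 * (2 * 1))).
- apply: nondecreasing_lipschitz_join.
  + by rewrite /join invr_ge0 ler0n /affine mulr0; ring.
  + by apply: aff; lra.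
  + apply: nondecreasing_lipschitz_join; last by apply: aff; lra.
      by rewrite /affine; ring.
    by apply: aff; lra.
- by rewrite /join invr_ge0 ler0n /affine !mulr0 mul0r addr0.
- have n1 : (1 <= 2^-1 :> R) = false by apply/negbTE; rewrite -ltNge; lra.
  have E1 : 2 * 1 - 1 = 1 :> R by ring.
  by rewrite /join n1 E1 n1 E1 /affine; ring.
Qed.

Lemma two_piece_reparam : angle u v = 0 -> exists2 phi, reparam phi &
  forall t, 0 <= t <= 1 ->
  path_comp (linpath P (x - u, x + u)) (linpath (y - v, y + v) Q) t
  = detour_path P Q u v (phi t).
Proof.
have [sr0 srer er1] := ratios; move=> b0.
have srer' : sr = er.
  by rewrite /sr /er /start_ratio /end_ratio -uv_arc b0 addr0.
exists (join (affine 0 sr) (affine er 1)); last first.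
  by apply: join_path; [exact: start_piece|exact: end_piece].
apply: (@nondecreasing_lipschitz_reparam _ _ (2 * 1)).
- apply: nondecreasing_lipschitz_join; [|by apply: aff; lra|by apply: aff; lra].
  by rewrite /affine srer'; ring.
- by rewrite /join invr_ge0 ler0n /affine !mulr0 mul0r addr0.
- have n1 : (1 <= 2^-1 :> R) = false by apply/negbTE; rewrite -ltNge; lra.
  have E1 : 2 * 1 - 1 = 1 :> R by ring.
  by rewrite /join n1 E1 /affine; ring.
Qed.

Lemma three_piece_geodesic : geodesic F0 P Q (three_piece P Q x u y v).
Proof.
have [phi phiR E] := three_piece_reparam.
exact: detour_path_geodesic h1 k1 uv_tangent uv_arc uv_pi _ _ phiR E.
Qed.

(** The denominator is the total length L of the curve of [hdiff]: x and y divide the segment of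
    midpoints as the contact points divide that curve. *)
Lemma point_formula (D := angle u v + tlen h + tlen k) :
  D != 0 ->
  D^-1 *: (angle u v *: mid P + tlen h *: mid Q + tlen k *: mid P) = x /\
  D^-1 *: (angle u v *: mid Q + tlen h *: mid Q + tlen k *: mid P) = y.
Proof.
have DE : D = L by rewrite LE /D; ring.
move=> D0; rewrite /x /y /detour_point /sr /er /start_ratio /end_ratio -/L -DE -uv_arc.
rewrite /D in D0 *; split; apply/rowP => i; rewrite !mxE; field;
  by rewrite ?D0.
Qed.

End ThreePieces.

Section ArcUnique.
Context {R : realType} {n : nat}.
Implicit Types (x y u v : 'rV[R]_n).

(** The arc is a [detour_path] with tangent segments of length zero, hence shortest even in the
    larger space [F0]. So a geodesic of [bdF0] is one of [F0], and the only point of tangency from a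
    unit vector is that vector itself. *)
Lemma sigma_unique_geodesic x u y v : enorm u = 1 -> enorm v = 1 -> angle u v < pi ->
  unique_geodesic bdF0 (x - u, x + u) (y - v, y + v) (sigma x u y v).
Proof.
move=> u1 v1 uv_pi; set P := (x - u, x + u); set Q := (y - v, y + v).
have hP : hdiff P = u by exact: hdiff_pair.
have kQ : hdiff Q = v by exact: hdiff_pair.
have tp : tangent_pair u v u v by rewrite /tangent_pair -!enorm2 u1 v1 expr1n.
have a : angle u v = arc_angle u v by rewrite /arc_angle !topen_unit// !subr0.
have h1 : 1 <= enorm (hdiff P) by rewrite hP u1.
have k1 : 1 <= enorm (hdiff Q) by rewrite kQ v1.
have tp' : tangent_pair (hdiff P) (hdiff Q) u v by rewrite hP kQ.
have a' : angle u v = arc_angle (hdiff P) (hdiff Q) by rewrite hP kQ.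
have sE t : 0 <= t <= 1 -> sigma x u y v t = detour_path P Q u v (id t).
  move=> tI; apply: (@detour_path_eq _ _ P Q u v t (sphere_arc u v t) tI).
  - rewrite hP kQ -[RHS](detour_curve_arc _ tp uv_pi tI) ?u1//.
    by rewrite /detour !tlen_unit// !add0r a.
  - by rewrite [LHS]mid_pair (mid_pair x u) (mid_pair y v); apply/rowP => i; rewrite !mxE; ring.
  - by rewrite hdiff_pair.
have [sP smin] := detour_path_geodesic h1 k1 tp' a' uv_pi reparam_id sE.
have sub g : is_path bdF0 P Q g -> is_path F0 P Q g.
  by move=> [cg g0 g1 gX]; split => // t /gX; exact: bdF0_sub_F0.
have sP' : is_path bdF0 P Q (sigma x u y v).
  have [cs s0 s1 _] := sP; split => // t tI; apply/bdF0P.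
  by rewrite hdiff_pair enorm_sphere_arc.
split; first by split => // g /sub; exact: smin.
move=> g [gP gmin].
have gF : geodesic F0 P Q g.
  split; first exact: sub.
  by move=> g' g'P; apply: le_trans (smin _ g'P); exact: gmin.
have [u' [v' [[u1' v1' uu' vv'] _ [phi phiR gE]]]] :=
  geodesic_detour h1 k1 tp' a' uv_pi gF.
have uniq (p q : 'rV[R]_n) : enorm p = 1 -> enorm q = 1 -> dot p q = 1 -> q = p.
  move=> p1 q1 pq; apply/esym/unit_angle0 => //.
  by rewrite /angle pq p1 q1 mulr1 divr1 acos1.
rewrite hP in uu'; rewrite kQ in vv'.
rewrite (uniq _ _ u1 u1' uu') (uniq _ _ v1 v1' vv') in gE.
exact: same_path_reparam phiR reparam_id gE sE.
Qed.

End ArcUnique.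

Theorem theorem1p1 (R : realType) (n : nat) (a a' b b' : 'rV[R]_n)
    (hP : F0 (a, a')) (hQ : F0 (b, b')) :
  let P := (a, a') in
  let Q := (b, b') in
  let h : 'rV[R]_n := 2^-1 *: (a' - a) in
  let k : 'rV[R]_n := 2^-1 *: (b' - b) in
  let A : 'rV[R]_n := 2^-1 *: (a' + a) in
  let B : 'rV[R]_n := 2^-1 *: (b' + b) in
  let delta := min_gap a a' b b' in
  let S0 : R := Num.sqrt (enorm h ^+ 2 - 1) in
  let S1 : R := Num.sqrt (enorm k ^+ 2 - 1) in
  [/\ (* (a) *)
      2 <= delta -> unique_geodesic F0 P Q (linpath P Q),
      (* (b) *)
      0 < delta <= 2 ->
        (exists g, unique_geodesic F0 P Q g) /\
        (~ transversal_end h k ->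
         exists u v : 'rV[R]_n,
           [/\ min_tangent_pair h k u v,
               forall u' v', min_tangent_pair h k u' v' -> u' = u /\ v' = v &
               let beta := angle u v in
               0 <= beta < pi /\
               exists x y : 'rV[R]_n,
                 let C0 := (x - u, x + u) in
                 let C1 := (y - v, y + v) in
                 [/\ beta + S0 + S1 != 0 ->
                       x = (beta + S0 + S1)^-1
                             *: (beta *: A + S0 *: B + S1 *: A) /\
                       y = (beta + S0 + S1)^-1
                             *: (beta *: B + S0 *: B + S1 *: A),
                     unique_geodesic bdF0 C0 C1 (sigma x u y v),
                     unique_geodesic F0 P Q (three_piece P Q x u y v),
                     beta = 0 ->
                       [/\ C0 = C1, delta = 2 &
                           same_path (path_comp (linpath P C0) (linpath C1 Q))
                                     (linpath P Q)] &
                     delta = 2 ->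
                       same_path (three_piece P Q x u y v) (linpath P Q)]]) &
      (* (c) *)
      (delta = 0 <-> exists c : R, c < 0 /\ k = c *: h) /\
      (delta = 0 ->
       let beta u v := angle u v in
       let x u v := (beta u v + S0 + S1)^-1
                      *: (beta u v *: A + S0 *: B + S1 *: A) in
       let y u v := (beta u v + S0 + S1)^-1
                      *: (beta u v *: B + S0 *: B + S1 *: A) in
       [/\ (1 < n)%N \/ 0 < S0 + S1 ->
             forall u v, min_tangent_pair h k u v <->
               exists w, [/\ dot h w = 0, dot w w = 1,
                 u = (enorm h ^+ 2)^-1 *: h + (S0 / enorm h) *: w &
                 v = (enorm k ^+ 2)^-1 *: k + (S1 / enorm k) *: w],
           forall u v, min_tangent_pair h k u v ->
             cos (beta u v) = dot h k / (enorm h ^+ 2 * enorm k ^+ 2)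
                              + S0 * S1 / (enorm h * enorm k),
           0 < S0 + S1 -> forall u v, min_tangent_pair h k u v ->
             [/\ 0 <= beta u v < pi,
                 unique_geodesic bdF0 (x u v - u, x u v + u)
                   (y u v - v, y u v + v) (sigma (x u v) u (y u v) v) &
                 geodesic F0 P Q (three_piece P Q (x u v) u (y u v) v)] &
           0 < S0 + S1 -> forall g, geodesic F0 P Q g ->
             exists u v : 'rV[R]_n, min_tangent_pair h k u v /\
               same_path g (three_piece P Q (x u v) u (y u v) v)])].
Proof.
move=> P Q h k A B delta S0 S1.
have h1 : 1 <= enorm (hdiff P) by apply/F0P.
have k1 : 1 <= enorm (hdiff Q) by apply/F0P.
have linear : 2 <= delta -> unique_geodesic F0 P Q (linpath P Q).
  move=> /(min_gap_ge2 a a' b b') d2; apply: linpath_unique_geodesic => t tI.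
  by apply/F0P; rewrite hdiff_linpath; exact: d2.
have points (u v : 'rV[R]_n) : angle u v = arc_angle h k -> angle u v + S0 + S1 != 0 ->
    (angle u v + S0 + S1)^-1 *: (angle u v *: A + S0 *: B + S1 *: A)
      = detour_point P Q (start_ratio h k) /\
    (angle u v + S0 + S1)^-1 *: (angle u v *: B + S0 *: B + S1 *: A)
      = detour_point P Q (end_ratio h k).
  by move=> uva; exact (@point_formula R n P Q u v uva).
split => //.
- move=> /andP[d0 d2].
  have hk_pi : angle h k < pi by exact: min_gap_gt0_angle d0.
  have main : ~ transversal_end h k -> exists u v : 'rV[R]_n, [/\ tangent_pair h k u v,
      angle u v = arc_angle h k, angle u v < pi,
      forall u' v', tangent_pair h k u' v' -> angle u' v' = arc_angle h k ->
        u' = u /\ v' = v &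
      unique_geodesic F0 P Q (three_piece P Q
        (detour_point P Q (start_ratio h k)) u (detour_point P Q (end_ratio h k)) v)].
    move=> ntr; have b0 : 0 <= arc_angle h k by exact: min_gap_le2_arc_angle ntr.
    have [uvt uva] := planar_tangent_pair h1 k1 hk_pi b0.
    have uvp : angle (planar_start h k) (planar_end h k) < pi.
      rewrite uva /arc_angle; have := topenI h1; have := topenI k1; move: hk_pi.
      by rewrite -/h -/k; lra.
    exists (planar_start h k), (planar_end h k); split => //.
      by move=> u' v'; exact: planar_tangent_pair_unique.
    split; first exact: three_piece_geodesic.
    move=> g' /(geodesic_detour h1 k1 uvt uva uvp)[u' [v' [uvt' uva' [phi phiR gE]]]].
    have [uE vE] := planar_tangent_pair_unique h1 k1 hk_pi uvt' uva'.
    rewrite uE vE in gE.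
    have [psi psiR pE] := three_piece_reparam h1 k1 uvt uva uvp.
    exact: same_path_reparam phiR psiR gE pE.
  split.
    (* In the transversal case the gap is also at least 2, so that the linear path serves. *)
    have [/transversal_min_gap|/main[u [v [_ _ _ _ g]]]] := pselect (transversal_end h k).
      by move=> d2'; exists (linpath P Q); apply: linear; exact: d2'.
    by eexists; exact: g.
  move=> ntr; have [u [v [uvt uva uvp uniq geo]]] := main ntr.
  have minP := min_tangent_pair_angle h1 k1 uvt uva.
  have [u1 v1 hu kv] := uvt.
  exists u, v; split; first by apply/minP.
    by move=> u' v' /minP[]; exact: uniq.
  split; first by rewrite angle_ge0.
  exists (detour_point P Q (start_ratio h k)), (detour_point P Q (end_ratio h k)).
  split => //.
  + by move=> D0; have [-> ->] := points u v uva D0.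
  + exact: sigma_unique_geodesic.
  + move=> b0; have uv : u = v by exact: unit_angle0 b0.
    have d2' : 2 <= delta.
      (* With u = v, both h and k lie in the tangent hyperplane at u, and so does the segment
         between them. *)
      apply/(min_gap_ge2 a a' b b') => t tI.
      apply: le_trans (_ : dot ((1 - t) *: h + t *: k) u <= _).
        by rewrite dotDl (dotZl (1 - t) h) (dotZl t k) hu uv kv; lra.
      by apply: le_trans (cauchy_schwarz _ _) _; rewrite u1 mulr1.
    have [phi phiR E] := two_piece_reparam h1 k1 uvt uva uvp b0.
    split.
    * by rewrite uv /end_ratio -uva b0 addr0.
    * by apply/eqP; rewrite eq_le d2.
    * by apply: (linear d2').2; exact: detour_path_geodesic h1 k1 uvt uva uvp _ _ phiR E.
  + by move=> dE; apply: (linear _).2; [rewrite dE|exact: geo.1].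
- split; first exact: min_gap_eq0.
  move=> d0 beta x y.
  have hk : exists c : R, c < 0 /\ k = c *: h by exact/(min_gap_eq0 h1 k1).
  have S00 : 0 <= S0 by exact: tlen_ge0.
  have S10 : 0 <= S1 by exact: tlen_ge0.
  have min_angle (u v : 'rV[R]_n) : min_tangent_pair h k u v -> angle u v = arc_angle h k.
    exact: opposite_min_tangent_pair.
  have b0 : 0 <= arc_angle h k by case/andP: (opposite_arc_angleI h1 k1 hk).
  have lt_pi (u v : 'rV[R]_n) : 0 < S0 + S1 -> angle u v = arc_angle h k -> angle u v < pi.
    by move=> S ->; exact: opposite_arc_angle_lt.
  have xyE (u v : 'rV[R]_n) : 0 < S0 + S1 -> angle u v = arc_angle h k ->
      x u v = detour_point P Q (start_ratio h k) /\
      y u v = detour_point P Q (end_ratio h k).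
    by move=> S uva; apply: points => //; rewrite uva gt_eqF//; lra.
  split.
  + move=> n1 u v; split=> [muv|[w [hw ww -> ->]]]; last first.
      have [uvt uva] := opposite_tangent_pair h1 k1 hk hw ww.
      by apply/(min_tangent_pair_angle h1 k1 uvt uva).
    have uva := min_angle _ _ muv; have [uvt _] := muv; have [u1 v1 hu kv] := uvt.
    (* The direction w comes from u if S0 is positive, from v after exchanging h and k if S1 is, and
       is arbitrary if both vanish. *)
    have [th|th] := eqVneq S0 0; last first.
      apply: opposite_form => //.
      by rewrite lt_def th.
    have [tk|tk] := eqVneq S1 0; last first.
      have kh : exists c : R, c < 0 /\ h = c *: k.
        have [c [c0 kE]] := hk; exists c^-1; rewrite invr_lt0; split => //.
        by rewrite kE scalerA mulVf ?scale1r// lt_eqF.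
      have vut : tangent_pair k h v u by split.
      have vua : angle v u = arc_angle k h.
        by rewrite angleC uva /arc_angle (angleC k h); ring.
      have [|w [kw ww vE uE]] := opposite_form k1 h1 kh _ vut vua.
        by rewrite lt_def tk.
      exists w; split => //; exact (opposite_perp kh kw).
    have [w [hw ww]] : exists w, dot h w = 0 /\ dot w w = 1.
      by case: n1 => [|]; [exact: perp_exists|rewrite th tk addr0 ltxx].
    exists w; split => //; rewrite ?th ?tk mul0r scale0r addr0.
      have [_ uu uE] := tangent_perp h1 u1 hu.
      rewrite [LHS]uE (dotvv_eq0 (etrans uu _)) ?addr0//.
      by rewrite -[tlen _]/S0 th mul0r expr0n.
    have [_ vv vE] := tangent_perp k1 v1 kv.
    rewrite [LHS]vE (dotvv_eq0 (etrans vv _)) ?addr0//.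
    by rewrite -[tlen _]/S1 tk mul0r expr0n.
  + by move=> u v /min_angle uva; rewrite /beta uva opposite_cos_arc_angle.
  + move=> S u v muv; have uva := min_angle _ _ muv; have uvp := lt_pi _ _ S uva.
    have [uvt _] := muv; have [u1 v1 _ _] := uvt; have [-> ->] := xyE _ _ S uva.
    split; first by rewrite angle_ge0.
      exact: sigma_unique_geodesic.
    exact: three_piece_geodesic.
  + move=> S g geo; have [[cg g0 g1 gF] _] := geo.
    have h0 : 0 < enorm h by exact: lt_le_trans h1.
    have k0 : 0 < enorm k by exact: lt_le_trans k1.
    have cdot : continuous (fun e : 'rV[R]_n * 'rV[R]_n => dot h (hdiff e)).
      by move=> e; apply: cvg_dot; [exact: cvg_cst|exact: continuous_hdiff].
    (* The path itself provides a direction orthogonal to h: its dot product with h goes from h.h >=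
       0 to h.k <= 0. *)
    have [|T TI ET] := path_ivt (v := 0) cg cdot (lexx 0) ler01 (lexx 1).
      right; rewrite g0 g1 -/h -/k opposite_dot// oppr_le0 mulr_ge0 ?enorm_ge0//=.
      exact: dotvv_ge0.
    have q1 : 1 <= enorm (hdiff (g T)) by apply/F0P/gF.
    have q0 : 0 < enorm (hdiff (g T)) by exact: lt_le_trans q1.
    have [||uvt uva] := @opposite_tangent_pair _ _ _ _ h1 k1 hk
      ((enorm (hdiff (g T)))^-1 *: hdiff (g T)).
    * by rewrite dotZr ET mulr0.
    * by rewrite -enorm2 angle_normalize// expr1n.
    have uvp := lt_pi _ _ S uva.
    have [u [v [uvt' uva' [phi phiR gE]]]] := geodesic_detour h1 k1 uvt uva uvp geo.
    exists u, v; split; first exact/(min_tangent_pair_angle h1 k1 uvt uva).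
    have [-> ->] := xyE _ _ S uva'.
    have [psi psiR pE] := three_piece_reparam h1 k1 uvt' uva' (lt_pi _ _ S uva').
    exact: same_path_reparam phiR psiR gE pE.
Qed.
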